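(* Let $I\subset\mathbb{R}$ be an interval and let $(m,n)\in\mathbb{Z}\times\mathbb{N}^{*}$ be coprime. Let $p^-,p^+:I\times\mathbb{R}\to\mathbb{R}\cup\{\pm\infty\}$ be continuous, $1$-periodic in the second variable, with $p^-(\varepsilon,q)<p^+(\varepsilon,q)$ for all $(\varepsilon,q)$. Suppose that for every $\varepsilon\in I$ we are given an exact-symplectic twist map $F_\varepsilon:\mathbb{A}^{\varepsilon}_{I,p^\pm}\to\mathbb{A}^{\varepsilon}_{I,p^\pm}$ such that: (i) the map $(\varepsilon,q,p)\in\mathbb{A}_{I,p^\pm}\mapsto F_\varepsilon(q,p)$ is (real-)analytic; (ii) $m/n\in \mathrm{TI}(F_\varepsilon)$ for every $\varepsilon\in I$. Then the set $$\mathcal{I}_{(m,n)}(\mathbb{R}):=\{\varepsilon\in I \mid F_\varepsilon \text{ has an } (m,n)\text{-periodic invariant graph}\}$$ is either discrete or equal to the whole of $I$. In particular, if $I$ is compact, then either $\mathcal{I}_{(m,n)}(\mathbb{R})=I$ or $\mathcal{I}_{(m,n)}(\mathbb{R})$ is at most finite.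
   Context: Notation: points of $\mathbb{R}^2$ are written $(q,p)$, with projections $\pi_q,\pi_p$. Families of annuli: $\mathbb{A}_{I,p^\pm}=\{(\varepsilon,q,p)\in I\times\mathbb{R}^2: p^-(\varepsilon,q)<p<p^+(\varepsilon,q)\}$ and, for $\varepsilon\in I$, $\mathbb{A}^\varepsilon_{I,p^\pm}=\{(q,p): p^-(\varepsilon,q)<p<p^+(\varepsilon,q)\}$. Twist maps: for continuous $1$-periodic $p^-<p^+:\mathbb{R}\to\mathbb{R}\cup\{\pm\infty\}$ put $\mathbb{A}_{p^\pm}=\{(q,p): p^-(q)<p<p^+(q)\}$. A diffeomorphism $F:\mathbb{A}_{p^\pm}\to\mathbb{A}_{p^\pm}$, $F(q,p)=(Q(q,p),P(q,p))$, is an exact-symplectic twist map if: (i) $F(q+k,p)=F(q,p)+(k,0)$ for $k\in\mathbb{Z}$; (ii) for each $q$, the map $p\mapsto Q(q,p)$, defined for $p^-(q)<p<p^+(q)$, is a diffeomorphism onto its image; (iii) for every neighborhood $V$ of $\mathrm{graph}(p^-)\cup\mathrm{graph}(p^+)$ there is another neighborhood $U$ of it with $F(U\cap\mathbb{A}_{p^\pm})\subseteq V\cap\mathbb{A}_{p^\pm}$; (iv) there are an open set $\mathcal{D}\subseteq\mathbb{R}^2$ (of pairs $(q,Q)$, invariant under $(q,Q)\mapsto(q+k,Q+k)$, $k\in\mathbb{Z}$) and a smooth $S:\mathcal{D}\to\mathbb{R}$ (generating function) with $S(q+k,Q+k)=S(q,Q)$ and $P\,dQ-p\,dq=dS(q,Q)$.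 Neighborhoods of the boundary graphs are in $\mathbb{R}^2$ (in $\mathbb{R}\times[-\infty,+\infty]$ where $p^\pm$ is infinite). Twist interval: $\mathrm{TI}(F)$ is the set of $\alpha\in\mathbb{R}$ for which there are neighborhoods $U^-$ of $\mathrm{graph}(p^-)$ and $U^+$ of $\mathrm{graph}(p^+)$ such that, for $(q,p)\in\mathbb{A}_{p^\pm}$, $(q,p)\in U^-\Rightarrow \pi_q\circ F(q,p)-q\le\alpha$ and $(q,p)\in U^+\Rightarrow\pi_q\circ F(q,p)-q\ge\alpha$. Periodic invariant graphs: let $\Gamma=\{(q,\gamma(q))\}\subset\mathbb{A}_{p^\pm}$ be the graph of a $1$-periodic Lipschitz continuous $\gamma:\mathbb{R}\to\mathbb{R}$. It is $(m,n)$-periodic if $F^n(q,\gamma(q))=(q+m,\gamma(q))$ for all $q\in\mathbb{R}$, and invariant if $F(\Gamma)\subseteq\Gamma$. *)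

(* Defs.v *)
From HB Require Import structures.
From mathcomp Require Import all_boot all_order all_algebra.
From mathcomp Require Import all_classical all_reals all_analysis.

Set Implicit Arguments.
Unset Strict Implicit.
Unset Printing Implicit Defensive.

Import Order.TTheory GRing.Theory Num.Theory.
Import numFieldNormedType.Exports.

Local Open Scope classical_set_scope.
Local Open Scope ring_scope.

(* Maps defined on a subset are represented by total functions; every
   definition below only depends on the values taken on the subset. *)

(* For [Ck_on] and [smooth_on], U is meant to be open: the derivatives are
   taken in the ambient space. *)
Fixpoint Ck_on (R : realType) (V W : normedModType R) (k : nat)
    (U : set V) (f : V -> W) : Prop :=
  if k is k'.+1 then
    (forall x, U x -> differentiable f x) /\
    (forall v : V, Ck_on k' U (fun x => 'D_v f x))
  else forall x, U x -> {for x, continuous f}.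

Definition smooth_on (R : realType) (V W : normedModType R)
    (U : set V) (f : V -> W) : Prop :=
  forall k, Ck_on k U f.

Definition diffeo (R : realType) (V W : normedModType R)
    (U : set V) (U' : set W) (f : V -> W) : Prop :=
  [/\ set_bij U U' f, smooth_on U f &
      exists2 g : W -> V, {in U, cancel f g} & smooth_on U' g].

(* The homogeneous part of degree d, at (u, v, w), of the formal power series
   with coefficients c in three variables. *)
Definition homog_part (R : realType) (c : nat -> nat -> nat -> R) (d : nat)
    (u v w : R) : R :=
  \sum_(i < d.+1) \sum_(j < d.+1) \sum_(k < d.+1 | (i + j + k == d)%N)
    c i j k * u ^+ i * v ^+ j * w ^+ k.

(* Real-analyticity on a set which need not be open: near each of its points,
   f agrees on the set with a power series. The series converges absolutely
   on the closed polydisc of radius r, so that the grouping of its terms by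
   degree is immaterial. *)
Definition analytic_on (R : realType) (A : set (R * (R * R)))
    (f : R * (R * R) -> R) : Prop :=
  forall a, A a -> exists (c : nat -> nat -> nat -> R) (r : R),
    [/\ 0 < r,
        cvgn (series (fun d => homog_part (fun i j k => `|c i j k|) d r r r)) &
        forall x, A x -> `|x - a| < r ->
          series (fun d =>
            homog_part c d (x.1 - a.1) (x.2.1 - a.2.1) (x.2.2 - a.2.2)) @ \oo
            --> f x].

(* S has no limit point in I. Being discrete in the subspace topology alone
   would allow infinitely many points when I is compact. *)
Definition discrete_in (R : realType) (I S : set R) : Prop :=
  S `<=` I /\ I `&` limit_point S = set0.

Definition fiber (R : realType) (pm pp : R -> \bar R) (q : R) : set R :=
  [set p | (pm q < p%:E < pp q)%E].

Definition annulus (R : realType) (pm pp : R -> \bar R) : set (R * R) :=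
  [set x | fiber pm pp x.1 x.2].

Definition annuli_family (R : realType) (I : set R) (pm pp : R -> R -> \bar R) :
    set (R * (R * R)) :=
  [set x | I x.1 /\ annulus (pm x.1) (pp x.1) x.2].

(* Graphs of the boundary functions live in R x [-oo, +oo], with its product
   topology; at finite values this has the same neighborhoods as R x R. *)
Definition egraph (R : realType) (p : R -> \bar R) : set (R * \bar R) :=
  [set z | z.2 = p z.1].

Definition einj (R : realType) (x : R * R) : R * \bar R := (x.1, x.2%:E).

Record exact_symplectic_twist_map (R : realType) (pm pp : R -> \bar R)
    (F : R * R -> R * R) : Prop := {
  twist_diffeo : diffeo (annulus pm pp) (annulus pm pp) F;
  twist_lift : forall (x : R * R) (k : int), annulus pm pp x ->
    F (x.1 + k%:~R, x.2) = ((F x).1 + k%:~R, (F x).2);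
  twist_fiber : forall q : R,
    diffeo (fiber pm pp q) [set (F (q, p)).1 | p in fiber pm pp q]
      (fun p : R => (F (q, p)).1);
  twist_boundary : forall V : set (R * \bar R),
    set_nbhs (egraph pm `|` egraph pp) V ->
    exists2 U : set (R * \bar R),
      set_nbhs (egraph pm `|` egraph pp) U &
      forall x, annulus pm pp x -> U (einj x) ->
        V (einj (F x)) /\ annulus pm pp (F x);
  (* The equality P dQ - p dq = dS(q, Q) is that of 1-forms in the variables
     (q, p), evaluated at the tangent vector v. *)
  twist_generating : exists (D : set (R * R)) (S : R * R -> R),
    [/\ open D /\
        (forall x, annulus pm pp x -> D (x.1, (F x).1)),
        forall (z : R * R) (k : int), D z -> D (z.1 + k%:~R, z.2 + k%:~R),
        smooth_on D S,
        forall (z : R * R) (k : int), D z ->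
          S (z.1 + k%:~R, z.2 + k%:~R) = S z &
        forall x, annulus pm pp x -> forall v : R * R,
          (F x).2 * 'd (fun y : R * R => (F y).1) x v - x.2 * v.1
          = 'd (fun y : R * R => S (y.1, (F y).1)) x v]
}.

Definition twist_interval (R : realType) (pm pp : R -> \bar R)
    (F : R * R -> R * R) : set R :=
  [set alpha | exists Um Up : set (R * \bar R),
    [/\ set_nbhs (egraph pm) Um, set_nbhs (egraph pp) Up &
        forall x, annulus pm pp x ->
          (Um (einj x) -> (F x).1 - x.1 <= alpha) /\
          (Up (einj x) -> alpha <= (F x).1 - x.1)]].

Definition periodic_invariant_graph (R : realType) (pm pp : R -> \bar R)
    (F : R * R -> R * R) (m : int) (n : nat) (gamma : R -> R) : Prop :=
  let Gamma := [set (q, gamma q) | q in [set: R]] in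
  [/\ periodic gamma 1 /\ lipschitz gamma,
      Gamma `<=` annulus pm pp,
      F @` Gamma `<=` Gamma &
      forall q : R, iter n F (q, gamma q) = (q + m%:~R, gamma q)].

Definition periodic_parameters (R : realType) (I : set R)
    (pm pp : R -> R -> \bar R) (F : R -> R * R -> R * R) (m : int) (n : nat) :
    set R :=
  [set e | I e /\
    exists gamma, periodic_invariant_graph (pm e) (pp e) (F e) m n gamma].

(* Main.v *)
Require Import Defs.
From mathcomp Require Import all_boot all_order all_algebra.
From mathcomp Require Import all_classical all_reals all_analysis.
From mathcomp Require Import ring lra zify.
Set Implicit Arguments.
Unset Strict Implicit.
Unset Printing Implicit Defensive.
Import Order.TTheory GRing.Theory Num.Theory.
Import numFieldNormedType.Exports.
Local Open Scope classical_set_scope.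
Local Open Scope ring_scope.

(** Call S the set of parameters e in I for which F_e has an (m,n)-periodic invariant graph. The
theorem follows by connectedness of the interval I from two facts about a limit point e0 of S
lying in I: e0 belongs to S ([limit_parameter]), and S contains a neighborhood of e0 in I
([continuation]). If I is compact and S is infinite, such a limit point exists.

Limits. The periodic graphs of nearby parameters are uniformly bounded and uniformly Lipschitz, so
that they have a limit, and being invariant and periodic passes to the limit. They are Lipschitz
because a periodic graph is carried to itself both by F_e and, up to a translation, by
F_e^(n-1) = F_e^(-1), so that both induce increasing maps of the line; with the twist condition the
first excludes steep descents and the second steep ascents ([local_slope]). They are bounded
because m/n lies in the twist interval: near the top and near the bottom of the annulus the map
F_e^n displaces points by more, respectively less, than m ([annulus_ends]), whereas the points above
a periodic graph are all displaced by more than m, and those below by less ([graph_sign]). Both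
facts are about curves that the map crosses in one direction ([orientation]).

Continuation. Let Q_n and P_n be the components of F_e^n, and fix a periodic graph g0 at e0. The
torsion of F_e0^n is positive along g0 ([graph_torsion], [torsion_gt0]), so that in a
thin tube around g0 and for all e near e0 the equation Q_n(e, q, p) = q + m has exactly one solution
p = gamma(e, q) ([radial_graph]). This radial graph is defined whether or not e is in S, and it is
the periodic graph of F_e when e is in S. Fix q. Then e |-> P_n(e, q, gamma(e, q)) - gamma(e, q) is an
analytic function of e that vanishes on S; its zeros cluster at e0, and therefore it vanishes for
all e near e0. So F_e^n translates the points of the radial graph by (m, 0), and uniqueness of the
solutions shows that this graph is invariant, periodic and Lipschitz.

Analyticity. The domain is only relatively open in I x R^2, and a power series represents F only on
the domain; so an analytic implicit function theorem in an open set does not apply at an end point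
of I. The notion used instead is that of a [tame] function: a uniform limit, on the points of I at
distance at most r from e1, of polynomials in e - e1 with bounded weighted l1 norm. These are the
restrictions of analytic functions on a disc, and they satisfy the identity theorem ([tame_eq0]). A
function of (e, q, p) is [regular] at a point if it is strictly differentiable there and maps tame
curves through the point to tame functions, with a remainder of second order. Analytic functions
are regular ([analytic_regular]), compositions of regular functions are regular ([regular_comp]),
and an implicit function is a uniform limit of Newton iterates which are tame with a common bound
([implicit_zero_identity]). *)

(** * Functions approximated by polynomials of bounded norm *)

Section Tame.
Context {R : realType}.
Implicit Types (r C c x e d tau eta : R) (I : set R) (T : {poly R}) (phi : R -> R).

(** A submultiplicative norm which bounds the polynomial on the whole complex disc of radius r.
Uniform convergence on the real points of I alone would not preserve analyticity; a bound in this
norm does. *)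
Definition wnorm r T : R := \sum_(i < size T) `|T`_i| * r ^+ i.

Lemma wnorm_widen r T N : (size T <= N)%N ->
  wnorm r T = \sum_(i < N) `|T`_i| * r ^+ i.
Proof.
move=> sN; rewrite /wnorm (big_ord_widen _ (fun i => `|T`_i| * r ^+ i) sN).
rewrite [RHS](bigID (fun i : 'I_N => (i < size T)%N)) /= [X in _ = _ + X]big1 ?addr0//.
by move=> i; rewrite -leqNgt => /(nth_default 0) ->; rewrite normr0 mul0r.
Qed.

Lemma wnorm_ge0 r T : 0 <= r -> 0 <= wnorm r T.
Proof. by move=> r0; apply: sumr_ge0 => i _; rewrite mulr_ge0 ?exprn_ge0. Qed.

Lemma wnormD r T U : 0 <= r -> wnorm r (T + U) <= wnorm r T + wnorm r U.
Proof.
move=> r0; pose N := maxn (size T) (size U).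
rewrite (wnorm_widen r (size_polyD T U)) (@wnorm_widen r T N) ?leq_maxl//.
rewrite (@wnorm_widen r U N) ?leq_maxr// -big_split /=.
apply: ler_sum => i _; rewrite coefD -mulrDl ler_wpM2r ?exprn_ge0//.
exact: ler_normD.
Qed.

Lemma wnormZ r c T : wnorm r (c *: T) = `|c| * wnorm r T.
Proof.
rewrite (wnorm_widen r (size_scale_leq c T)) mulr_sumr.
by apply: eq_bigr => i _; rewrite coefZ normrM mulrA.
Qed.

Lemma wnormC r c : wnorm r c%:P = `|c|.
Proof.
rewrite (@wnorm_widen r _ 1) ?size_polyC ?leq_b1//.
by rewrite big_ord_recl big_ord0 coefC eqxx expr0 mulr1 addr0.
Qed.

Lemma wnormMX r T : wnorm r (T * 'X) = r * wnorm r T.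
Proof.
have sz : (size (T * 'X)%R <= (size T).+1)%N.
  by rewrite (leq_trans (size_polyMleq _ _))// size_polyX addn2.
rewrite (wnorm_widen r sz) big_ord_recl coefMX eqxx normr0 mul0r add0r mulr_sumr.
by apply: eq_bigr => i _; rewrite coefMX /= exprS mulrCA.
Qed.

Lemma wnormX r : wnorm r 'X = r.
Proof. by rewrite -['X]mul1r wnormMX -[1%R]/(1%:P) wnormC normr1 mulr1. Qed.

Lemma wnormMXn r T n : wnorm r (T * 'X^n) = r ^+ n * wnorm r T.
Proof.
elim: n => [|n IHn]; first by rewrite !expr0 mul1r mulr1.
by rewrite exprSr mulrA wnormMX IHn exprS mulrA.
Qed.

Lemma wnorm_sum r (J : Type) (s : seq J) (P : pred J) (E : J -> {poly R}) :
  0 <= r -> wnorm r (\sum_(j <- s | P j) E j) <= \sum_(j <- s | P j) wnorm r (E j).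
Proof.
move=> r0; elim/big_rec2: _ => [|j y T _ h]; first by rewrite -[0]/(0%:P) wnormC normr0.
by apply: le_trans (wnormD _ _ r0) _; rewrite lerD2l.
Qed.

Lemma wnormM r T U : 0 <= r -> wnorm r (T * U) <= wnorm r T * wnorm r U.
Proof.
move=> r0; have -> : T * U = \sum_(i < size T) T`_i *: (U * 'X^i).
  rewrite -[X in X * U]coefK poly_def mulr_suml.
  by apply: eq_bigr => i _; rewrite -scalerAl mulrC.
apply: le_trans (wnorm_sum _ _ _ r0) _.
rewrite /wnorm mulr_suml; apply: ler_sum => i _.
by rewrite -/(wnorm _ _) wnormZ wnormMXn mulrA.
Qed.

Lemma wnorm_exp r T k : 0 <= r -> wnorm r (T ^+ k) <= wnorm r T ^+ k.
Proof.
move=> r0; elim: k => [|k IHk]; first by rewrite !expr0 -[1%R]/(1%:P) wnormC normr1.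
rewrite !exprS (le_trans (wnormM _ _ r0))// ler_wpM2l ?wnorm_ge0//.
Qed.

Lemma horner_wnorm r T x : `|x| <= r -> `|T.[x]| <= wnorm r T.
Proof.
move=> xr; rewrite horner_coef (le_trans (ler_norm_sum _ _ _))//.
by apply: ler_sum => i _; rewrite normrM normrX ler_wpM2l// lerXn2r ?nnegrE// (le_trans _ xr).
Qed.

(** The restriction to I of a function analytic on the disc of centre e1 and radius r, described by
its approximants, so that neither power series nor extensions outside I have to be handled. *)
Definition tame I (e1 : R) r C phi :=
  forall eta, 0 < eta -> exists2 T, wnorm r T <= C &
    forall e, I e -> `|e - e1| <= r -> `|phi e - T.[e - e1]| <= eta.

Lemma tameD I e1 r C C' phi psi : 0 <= r -> tame I e1 r C phi -> tame I e1 r C' psi ->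
  tame I e1 r (C + C') (fun e => phi e + psi e).
Proof.
move=> r0 tf tg eta eta0.
have [|T TC Tf] := tf (eta / 2); first by rewrite divr_gt0.
have [|U UC Ug] := tg (eta / 2); first by rewrite divr_gt0.
exists (T + U); first exact: le_trans (wnormD _ _ r0) (lerD _ _).
move=> e Ie er; rewrite hornerD opprD addrACA (splitr eta).
by rewrite (le_trans (ler_normD _ _))// lerD ?Tf ?Ug.
Qed.

Lemma tameZ I e1 r C c phi : tame I e1 r C phi ->
  tame I e1 r (`|c| * C) (fun e => c * phi e).
Proof.
move=> tf eta eta0; pose d := `|c| + 1.
have d0 : 0 < d by rewrite ltr_wpDl.
have [|T TC Tf] := tf (eta / d); first by rewrite divr_gt0.
exists (c *: T); first by rewrite wnormZ ler_wpM2l.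
move=> e Ie er; rewrite hornerZ -mulrBr normrM.
apply: le_trans (_ : d * (eta / d) <= _); last by rewrite mulrCA divff ?mulr1 ?gt_eqF.
by rewrite ler_pM ?Tf// lerDl.
Qed.

Lemma tame_le I e1 r C C' phi : C <= C' -> tame I e1 r C phi -> tame I e1 r C' phi.
Proof. by move=> CC tf eta /tf[T TC Tf]; exists T => //; exact: le_trans CC. Qed.

Lemma eq_tame I e1 r C phi psi :
  (forall e, I e -> `|e - e1| <= r -> phi e = psi e) ->
  tame I e1 r C phi -> tame I e1 r C psi.
Proof.
by move=> E tf eta /tf[T TC Tf]; exists T => // e Ie er; rewrite -E// Tf.
Qed.

Lemma tame_cst I e1 r c : tame I e1 r `|c| (fun=> c).
Proof.
by move=> eta eta0; exists c%:P; rewrite ?wnormC// => e _ _; rewrite hornerC subrr normr0 ltW.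
Qed.

Lemma tame_shift I e1 r : tame I e1 r r (fun e => e - e1).
Proof.
by move=> eta eta0; exists 'X; rewrite ?wnormX// => e _ _; rewrite hornerX subrr normr0 ltW.
Qed.

Lemma tame_unif I e1 r C phi :
  (forall eta, 0 < eta -> exists2 psi, tame I e1 r C psi &
     forall e, I e -> `|e - e1| <= r -> `|phi e - psi e| <= eta) ->
  tame I e1 r C phi.
Proof.
move=> H eta eta0; have e20 : 0 < eta / 2 by rewrite divr_gt0.
have [psi tpsi fpsi] := H _ e20; have [T TC Tpsi] := tpsi _ e20.
exists T => // e Ie er; rewrite (splitr eta) -(subrKA (psi e)).
by rewrite (le_trans (ler_normD _ _))// lerD ?fpsi ?Tpsi.
Qed.

Lemma tame_sup I e1 r C phi e : tame I e1 r C phi -> I e -> `|e - e1| <= r ->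
  `|phi e| <= C.
Proof.
move=> tf Ie er; apply/ler_addgt0Pr => eta /tf[T TC Tf].
rewrite -[phi e](subrK T.[e - e1]) addrC (le_trans (ler_normD _ _))//.
by rewrite lerD ?Tf// (le_trans (horner_wnorm T er)).
Qed.

(** A remainder of order k is bounded by the norm of the whole polynomial, whatever its degree.
This uniformity in the degree is what makes the identity theorem pass to limits. *)
Lemma horner_tail r T x k : 0 < r -> `|x| <= r ->
  `|T.[x] - \sum_(i < k) T`_i * x ^+ i| <= wnorm r T * (`|x| / r) ^+ k.
Proof.
move=> r0 xr; pose N := maxn (size T) k.
have hT : T.[x] = \sum_(i < N) T`_i * x ^+ i.
  by rewrite (@horner_coef_wide _ N)// leq_maxl.
have y1 : `|x| / r <= 1 by rewrite ler_pdivrMr ?mul1r.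
have y0 : 0 <= `|x| / r by rewrite divr_ge0// ltW.
rewrite hT (@wnorm_widen r T N) ?leq_maxl//.
have kN : (k <= N)%N by rewrite leq_maxr.
rewrite (big_ord_widen _ (fun i => T`_i * x ^+ i) kN).
rewrite (bigID (fun i : 'I_N => (i < k)%N)) /= addrAC subrr add0r.
rewrite (le_trans (ler_norm_sum _ _ _))// mulr_suml.
rewrite [leRHS](bigID (fun i : 'I_N => (i < k)%N)) /= ler_wpDl//.
  by apply: sumr_ge0 => i _; rewrite !mulr_ge0// exprn_ge0// ltW.
apply: ler_sum => i; rewrite -leqNgt => ki.
rewrite normrM normrX -mulrA ler_wpM2l//.
have -> : `|x| ^+ i = r ^+ i * (`|x| / r) ^+ i.
  by rewrite -exprMn mulrC divfK ?gt_eqF.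
by rewrite ler_wpM2l ?exprn_ge0 ?(ltW r0)// ler_wiXn2l.
Qed.

(** By induction on k: if the coefficients below k are negligible, then at a zero e very close to
e1 the term of degree k dominates the remainder, so that it has to be small too. *)
Lemma tame_coef_small I e1 r C phi : 0 < r -> 0 <= C ->
  (forall d, 0 < d -> exists e, [/\ I e, e != e1, `|e - e1| < d & phi e = 0]) ->
  forall k tau, 0 < tau -> exists2 eta : R, 0 < eta & forall T, wnorm r T <= C ->
   (forall e, I e -> `|e - e1| <= r -> `|phi e - T.[e - e1]| <= eta) ->
   forall i, (i < k)%N -> `|T`_i| <= tau.
Proof.
move=> r0 C0 Z; elim=> [|k IHk] tau tau0; first by exists 1.
pose d := Num.min r (tau * r ^+ k.+1 / (2 * C + 1)).
have D0 : 0 < 2 * C + 1 by rewrite ltr_wpDl// mulr_ge0.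
have d0 : 0 < d by rewrite lt_min r0 divr_gt0// mulr_gt0// exprn_gt0.
have [e [Ie ene ed fe0]] := Z _ d0.
pose x : R := `|e - e1|; have x0 : 0 < x by rewrite normr_gt0 subr_eq0.
have xr : x <= r by rewrite ltW// (lt_le_trans ed)// ge_min lexx.
have xd : x * (2 * C + 1) <= tau * r ^+ k.+1.
  by rewrite -ler_pdivlMr// ltW// (lt_le_trans ed)// ge_min lexx orbT.
pose M := \sum_(i < k) x ^+ i + 1.
have M0 : 0 < M by rewrite ltr_wpDl// sumr_ge0// => i _; rewrite exprn_ge0// ltW.
have xk0 : 0 < x ^+ k by rewrite exprn_gt0.
have txk : 0 < tau * x ^+ k / 4 by rewrite divr_gt0// mulr_gt0.
pose tau' := Num.min tau (tau * x ^+ k / 4 / M).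
have [|eta eta0 Heta] := IHk tau'; first by rewrite lt_min tau0 divr_gt0.
exists (Num.min eta (tau * x ^+ k / 4)); first by rewrite lt_min eta0 txk.
move=> T TC Tf.
have low i : (i < k)%N -> `|T`_i| <= tau'.
  by apply: Heta => // e' Ie' e'r; rewrite (le_trans (Tf _ Ie' e'r))// ge_min lexx.
move=> i; rewrite ltnS leq_eqVlt => /predU1P[->|/low h]; last first.
  by rewrite (le_trans h)// ge_min lexx.
have hT : `|T.[e - e1]| <= tau * x ^+ k / 4.
  have := Tf _ Ie xr; rewrite fe0 sub0r normrN => /le_trans; apply.
  by rewrite ge_min lexx orbT.
have hS : `|\sum_(i < k) T`_i * (e - e1) ^+ i| <= tau * x ^+ k / 4.
  apply: (le_trans (ler_norm_sum _ _ _)).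
  apply: (@le_trans _ _ (\sum_(i < k) tau' * x ^+ i)).
    by apply: ler_sum => j _; rewrite normrM normrX ler_wpM2r ?low ?ltn_ord//.
  rewrite -mulr_sumr (@le_trans _ _ (tau' * M))//.
    by rewrite ler_wpM2l ?lerDl// le_min (ltW tau0) ltW// divr_gt0.
  by rewrite -ler_pdivlMr// ge_min lexx orbT.
have := horner_tail T k.+1 r0 xr; rewrite big_ord_recr /= -/x => hk.
have hk' : wnorm r T * (x / r) ^+ k.+1 <= tau * x ^+ k / 2.
  apply: (@le_trans _ _ (C * (x / r) ^+ k.+1)).
    by rewrite ler_wpM2r ?exprn_ge0 ?divr_ge0 ?(ltW x0) ?(ltW r0).
  rewrite expr_div_n exprS mulrA ler_pdivrMr ?exprn_gt0// mulrA.
  have -> : tau * x ^+ k / 2 * r ^+ k.+1 = (tau * r ^+ k.+1 / 2) * x ^+ k.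
    by ring.
  rewrite ler_wpM2r ?(ltW xk0)//; lra.
rewrite -(ler_pM2r xk0).
have -> : `|T`_k| * x ^+ k = `|T`_k * (e - e1) ^+ k| by rewrite normrM normrX.
move: hT hS hk hk'; rewrite !ler_norml => /andP[? ?] /andP[? ?] /andP[? ?] ?.
by apply/andP; split; lra.
Qed.

Lemma half_expr_small C d : 0 < d -> exists k, C * (2^-1) ^+ k <= d.
Proof.
move=> d0; have : (fun k => C * (2^-1 : R) ^+ k) @ \oo --> C * 0.
  apply: cvgM; first exact: cvg_cst.
  by apply: cvg_expr; rewrite ger0_norm ?invr_ge0// invf_lt1 ?ltr1n.
rewrite mulr0 => /cvgr0Pnorm_le/(_ d d0)[k _ /(_ k (leqnn k)) /=] h; exists k.
by rewrite (le_trans (ler_norm _)).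
Qed.

(** Identity theorem. All low coefficients of a good approximant are small since the zeros cluster
at e1, and at distance r / 2 from e1 the high terms are small by [horner_tail]. *)
Lemma tame_eq0 I e1 r C phi : 0 < r -> 0 <= C -> tame I e1 r C phi ->
  (forall d, 0 < d -> exists e, [/\ I e, e != e1, `|e - e1| < d & phi e = 0]) ->
  forall e, I e -> `|e - e1| <= r / 2 -> phi e = 0.
Proof.
move=> r0 C0 tf Z e Ie er; apply/eqP; rewrite -normr_eq0 eq_le normr_ge0 andbT.
have xr : `|e - e1| <= r by rewrite (le_trans er)// ler_pdivrMr// mulr_natr mulr2n lerDl ltW.
apply/ler_addgt0Pl => d d0; rewrite addr0.
have [k hk] := half_expr_small C (divr_gt0 d0 (ltr0n R 3)).
pose M := \sum_(i < k) r ^+ i + 1.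
have M0 : 0 < M by rewrite ltr_wpDl// sumr_ge0// => i _; rewrite exprn_ge0// ltW.
have d30 : 0 < d / 3 by rewrite divr_gt0.
have [|eta eta0 Heta] := tame_coef_small r0 C0 Z k (_ : 0 < d / 3 / M).
  by rewrite divr_gt0.
have [|T TC Tf] := tf (Num.min eta (d / 3)); first by rewrite lt_min eta0.
have low i : (i < k)%N -> `|T`_i| <= d / 3 / M.
  by apply: Heta => // e' Ie' e'r; rewrite (le_trans (Tf _ Ie' e'r))// ge_min lexx.
have h1 : `|phi e - T.[e - e1]| <= d / 3.
  by rewrite (le_trans (Tf _ Ie xr))// ge_min lexx orbT.
have h2 : `|\sum_(i < k) T`_i * (e - e1) ^+ i| <= d / 3.
  apply: (le_trans (ler_norm_sum _ _ _)).
  apply: (@le_trans _ _ (\sum_(i < k) d / 3 / M * r ^+ i)).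
    apply: ler_sum => j _; rewrite normrM normrX ler_pM ?low ?exprn_ge0//.
    by rewrite lerXn2r// nnegrE ltW.
  rewrite -mulr_sumr (@le_trans _ _ (d / 3 / M * M))//.
    by rewrite ler_wpM2l ?lerDl// divr_ge0 ?(ltW d30) ?(ltW M0).
  by rewrite divfK ?gt_eqF.
have h3 : `|T.[e - e1] - \sum_(i < k) T`_i * (e - e1) ^+ i| <= d / 3.
  apply: (le_trans (horner_tail T k r0 xr)); apply: le_trans hk.
  apply: ler_pM => //; first by rewrite wnorm_ge0 ?(ltW r0).
    by rewrite exprn_ge0// divr_ge0 ?(ltW r0).
  rewrite lerXn2r ?nnegrE ?invr_ge0//; first by rewrite divr_ge0 ?(ltW r0).
  by rewrite ler_pdivrMr// mulrC.
move: h1 h2 h3; rewrite !ler_norml => /andP[? ?] /andP[? ?] /andP[? ?].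
by apply/andP; split; lra.
Qed.

End Tame.

(** * Homogeneous parts of a power series *)

Lemma cvg_norm_le {R : realType} {T : Type} (FF : set_system T)
    {PF : ProperFilter FF} (u : T -> R) (l B : R) :
  u @ FF --> l -> (\forall n \near FF, `|u n| <= B) -> `|l| <= B.
Proof.
move=> ul uB; apply/ler_addgt0Pr => d d0.
move/cvgrPdist_le : ul => /(_ d d0) ul.
have [n [h uBn]] : exists n, `|l - u n| <= d /\ `|u n| <= B.
  by apply: (@filter_ex _ FF); near=> n; split; near: n.
rewrite -[l](subrK (u n)) addrC (le_trans (ler_normD _ _))// lerD//.
Unshelve. all: by end_near.
Qed.

Section Homog.
Context {R : realType}.
Implicit Types (c : nat -> nat -> nat -> R) (d : nat) (u v w r rho : R).

Definition habs c d : R :=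
  \sum_(i < d.+1) \sum_(j < d.+1) \sum_(k < d.+1 | (i + j + k == d)%N) `|c i j k|.

Lemma habs_ge0 c d : 0 <= habs c d.
Proof. by rewrite /habs; do 3 (apply: sumr_ge0 => ? _). Qed.

Lemma homog_norm c d r :
  homog_part (fun i j k => `|c i j k|) d r r r = r ^+ d * habs c d.
Proof.
rewrite /homog_part /habs mulr_sumr; apply: eq_bigr => i _.
rewrite mulr_sumr; apply: eq_bigr => j _; rewrite mulr_sumr.
apply: eq_bigr => k /eqP dE; have -> : r ^+ d = r ^+ i * r ^+ j * r ^+ k.
  by rewrite -!exprD dE.
by ring.
Qed.

(** The homogeneous part evaluated at polynomials: the approximants of an analytic function along a
curve are finite sums of these. *)
Definition homogP c d (U V W : {poly R}) : {poly R} :=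
  \sum_(i < d.+1) \sum_(j < d.+1) \sum_(k < d.+1 | (i + j + k == d)%N)
    c i j k *: (U ^+ i * V ^+ j * W ^+ k).

Lemma horner_homogP c d U V W x :
  (homogP c d U V W).[x] = homog_part c d U.[x] V.[x] W.[x].
Proof.
rewrite /homogP /homog_part horner_sum; apply: eq_bigr => i _.
rewrite horner_sum; apply: eq_bigr => j _; rewrite horner_sum.
by apply: eq_bigr => k _; rewrite hornerZ !hornerM !horner_exp !mulrA.
Qed.

Lemma wnorm_homogP c d U V W r rho : 0 <= r -> 0 <= rho -> wnorm r U <= rho ->
  wnorm r V <= rho -> wnorm r W <= rho ->
  wnorm r (homogP c d U V W) <= rho ^+ d * habs c d.
Proof.
move=> r0 p0 Up Vp Wp; rewrite -homog_norm.
rewrite (le_trans (wnorm_sum _ _ _ r0))//; apply: ler_sum => i _.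
rewrite (le_trans (wnorm_sum _ _ _ r0))//; apply: ler_sum => j _.
rewrite (le_trans (wnorm_sum _ _ _ r0))//; apply: ler_sum => k _.
have E T n : wnorm r T <= rho -> wnorm r (T ^+ n) <= rho ^+ n.
  move=> Tp; rewrite (le_trans (wnorm_exp _ _ r0))// lerXn2r// nnegrE.
  exact: wnorm_ge0.
rewrite wnormZ -!mulrA ler_wpM2l// mulrA.
rewrite (le_trans (wnormM _ _ r0))// mulrA ler_pM ?wnorm_ge0// ?E//.
by rewrite (le_trans (wnormM _ _ r0))// ler_pM ?wnorm_ge0// ?E.
Qed.

Lemma homog_le c d u v w rho : 0 <= rho ->
  `|u| <= rho -> `|v| <= rho -> `|w| <= rho ->
  `|homog_part c d u v w| <= rho ^+ d * habs c d.
Proof.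
move=> p0 up vp wp; rewrite -homog_norm /homog_part.
rewrite (le_trans (ler_norm_sum _ _ _))//; apply: ler_sum => i _.
rewrite (le_trans (ler_norm_sum _ _ _))//; apply: ler_sum => j _.
rewrite (le_trans (ler_norm_sum _ _ _))//; apply: ler_sum => k _.
have E t n : `|t| <= rho -> `|t ^+ n| <= rho ^+ n.
  by move=> tp; rewrite normrX lerXn2r// nnegrE.
by rewrite -!mulrA !normrM ler_wpM2l// ler_pM ?mulr_ge0 ?E// ler_pM ?E.
Qed.

Lemma homog0 c u v w : homog_part c 0 u v w = c 0 0 0%N.
Proof.
rewrite /homog_part; do 3 rewrite big_mkcond big_ord_recl big_ord0 /= addr0.
by rewrite !expr0 !mulr1.
Qed.

Lemma homog1 c u v w :
  homog_part c 1 u v w = c 1 0 0%N * u + c 0 1 0%N * v + c 0 0 1%N * w.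
Proof.
have E (f : nat -> R) b : \sum_(k < 2 | (b + k == 1)%N) f k =
    (b == 1%N)%:R * f 0%N + (b == 0%N)%:R * f 1%N.
  rewrite big_mkcond !big_ord_recl big_ord0 /= addr0 addn0 /bump /= addn1 eqSS.
  by do 2 case: ifP => _; rewrite ?mul1r ?mul0r.
rewrite /homog_part !big_ord_recl !big_ord0 /= /bump /= !addn0 !add0n.
by rewrite !(E (fun k => c _ _ k * _ * _ * w ^+ k)) /= !expr0 !expr1; ring.
Qed.

Lemma expr_lip u v rho i : `|u| <= rho -> `|v| <= rho ->
  rho * `|u ^+ i - v ^+ i| <= i%:R * rho ^+ i * `|u - v|.
Proof.
move=> up vp; have p0 : 0 <= rho by exact: le_trans up.
elim: i => [|i IHi]; first by rewrite !expr0 subrr normr0 mulr0 mul0r mul0r.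
have -> : u ^+ i.+1 - v ^+ i.+1 = u * (u ^+ i - v ^+ i) + (u - v) * v ^+ i.
  by rewrite !exprS; ring.
have h1 : `|u * (u ^+ i - v ^+ i)| <= rho * `|u ^+ i - v ^+ i|.
  by rewrite normrM ler_wpM2r.
have h2 : `|(u - v) * v ^+ i| <= `|u - v| * rho ^+ i.
  by rewrite normrM normrX ler_wpM2l// lerXn2r.
apply: (@le_trans _ _ (rho * (rho * `|u ^+ i - v ^+ i| + `|u - v| * rho ^+ i))).
  by rewrite ler_wpM2l// (le_trans (ler_normD _ _))// lerD.
rewrite exprS -natr1 mulrDr.
have -> : (i%:R + 1) * (rho * rho ^+ i) * `|u - v| =
  rho * (i%:R * rho ^+ i * `|u - v|) + rho * (`|u - v| * rho ^+ i) by ring.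
by rewrite lerD2r ler_wpM2l.
Qed.

(** Multiplied by rho on the left to avoid the exponent d - 1 on the right. *)
Lemma homog_lip c d u v w u' v' w' rho : 0 < rho ->
  `|u| <= rho -> `|v| <= rho -> `|w| <= rho ->
  `|u'| <= rho -> `|v'| <= rho -> `|w'| <= rho ->
  rho * `|homog_part c d u v w - homog_part c d u' v' w'| <=
  d%:R * rho ^+ d * habs c d * (`|u - u'| + `|v - v'| + `|w - w'|).
Proof.
move=> p0 up vp wp up' vp' wp'; set D := _ + _ + _.
have D0 : 0 <= D by rewrite !addr_ge0.
have p0' := ltW p0.
have X t n : `|t| <= rho -> `|t ^+ n| <= rho ^+ n.
  by move=> tp; rewrite normrX lerXn2r// nnegrE.
have M i j k : (i + j + k == d)%N ->
  rho * `|u ^+ i * v ^+ j * w ^+ k - u' ^+ i * v' ^+ j * w' ^+ k| <= d%:R * rho ^+ d * D.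
  move=> /eqP dE.
  have -> : u ^+ i * v ^+ j * w ^+ k - u' ^+ i * v' ^+ j * w' ^+ k =
    (u ^+ i - u' ^+ i) * (v ^+ j * w ^+ k) + (v ^+ j - v' ^+ j) * (u' ^+ i * w ^+ k)
    + (w ^+ k - w' ^+ k) * (u' ^+ i * v' ^+ j) by ring.
  apply: (@le_trans _ _ (i%:R * rho ^+ i * `|u - u'| * (rho ^+ j * rho ^+ k)
     + j%:R * rho ^+ j * `|v - v'| * (rho ^+ i * rho ^+ k)
     + k%:R * rho ^+ k * `|w - w'| * (rho ^+ i * rho ^+ j))).
    have G s s' n t t' m m' : `|s| <= rho -> `|s'| <= rho -> `|t| <= rho -> `|t'| <= rho ->
      rho * `|(s ^+ n - s' ^+ n) * (t ^+ m * t' ^+ m')| <=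
        n%:R * rho ^+ n * `|s - s'| * (rho ^+ m * rho ^+ m').
      move=> sp sp' tp tp'; rewrite normrM [leLHS]mulrA.
      apply: ler_pM; [exact: mulr_ge0|exact: normr_ge0|exact: expr_lip|].
      by rewrite normrM; apply: ler_pM => //; exact: X.
    apply: (@le_trans _ _ (rho * (`|(u ^+ i - u' ^+ i) * (v ^+ j * w ^+ k)|
      + `|(v ^+ j - v' ^+ j) * (u' ^+ i * w ^+ k)|
      + `|(w ^+ k - w' ^+ k) * (u' ^+ i * v' ^+ j)|))).
      rewrite ler_wpM2l// (le_trans (ler_normD _ _))// lerD2r.
      exact: ler_normD.
    by rewrite !mulrDr !lerD ?G.
  have -> : rho ^+ d = rho ^+ i * rho ^+ j * rho ^+ k by rewrite -dE !exprD.
  have -> : i%:R * rho ^+ i * `|u - u'| * (rho ^+ j * rho ^+ k) +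
     j%:R * rho ^+ j * `|v - v'| * (rho ^+ i * rho ^+ k) +
     k%:R * rho ^+ k * `|w - w'| * (rho ^+ i * rho ^+ j) =
     (i%:R * `|u - u'| + j%:R * `|v - v'| + k%:R * `|w - w'|)
       * (rho ^+ i * rho ^+ j * rho ^+ k) by ring.
  rewrite [leRHS]mulrAC ler_wpM2r ?mulr_ge0 ?exprn_ge0//.
  have hi : (i <= d)%N by rewrite -dE -addnA leq_addr.
  have hj : (j <= d)%N by rewrite -dE (addnC i) -addnA leq_addr.
  have hk : (k <= d)%N by rewrite -dE leq_addl.
  by rewrite !mulrDr !lerD// ler_wpM2r// ler_nat.
rewrite /homog_part /habs -!sumrB.
have -> : d%:R * rho ^+ d * (\sum_(i < d.+1) \sum_(j < d.+1)
     \sum_(k < d.+1 | (i + j + k == d)%N) `|c i j k|) * D =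
  \sum_(i < d.+1) \sum_(j < d.+1) \sum_(k < d.+1 | (i + j + k == d)%N)
     `|c i j k| * (d%:R * rho ^+ d * D).
  rewrite mulrAC mulrC mulr_suml; apply: eq_bigr => i _; rewrite mulr_suml.
  by apply: eq_bigr => j _; rewrite mulr_suml.
rewrite mulrC -ler_pdivlMr// (le_trans (ler_norm_sum _ _ _))// mulr_suml.
apply: ler_sum => i _; rewrite -sumrB (le_trans (ler_norm_sum _ _ _))// mulr_suml.
apply: ler_sum => j _; rewrite -sumrB (le_trans (ler_norm_sum _ _ _))// mulr_suml.
apply: ler_sum => k ijk; rewrite ler_pdivlMr//.
rewrite -!mulrA -!mulrBr normrM -!mulrA ler_wpM2l// mulrC.
by have := M _ _ _ ijk; rewrite -!mulrA.
Qed.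

End Homog.

(** * Regular functions of a parameter and a point *)

Section Regular.
Context {R : realType}.
Local Notation pt := (R * (R * R))%type.
Implicit Types (A : set pt) (I : set R) (f g : pt -> R) (a l x y : pt).

Definition norm1 x : R := `|x.1| + `|x.2.1| + `|x.2.2|.
Definition lin l x : R := l.1 * x.1 + l.2.1 * x.2.1 + l.2.2 * x.2.2.

(** Relative to A, since A need not be open in the direction of the parameter, where I may have an
end point. *)
Definition strict_diff A f a l := forall eta : R, 0 < eta -> exists2 r : R, 0 < r &
  forall x y, A x -> A y -> norm1 (x - a) < r -> norm1 (y - a) < r ->
    `|f x - f y - lin l (x - y)| <= eta * norm1 (x - y).

Definition tame_curve I (e1 r rho : R) (X : R -> pt) a :=
  [/\ tame I e1 r rho (fun e => (X e - a).1),
      tame I e1 r rho (fun e => (X e - a).2.1) &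
      tame I e1 r rho (fun e => (X e - a).2.2)].

(** Curves whose distance to a is tame of size rho are mapped to functions whose distance to the
linear part is tame of size rho ^ 2. The remainder is thus negligible
before rho when rho is small, with a constant C that does not depend on the curve. *)
Definition tame_diff I A f a l := exists C s : R, [/\ 0 <= C, 0 < s &
  forall r rho (X : R -> pt), 0 < r -> r <= rho -> rho <= s ->
    (forall e, I e -> `|e - a.1| <= r -> A (X e)) ->
    tame_curve I a.1 r rho X a ->
    tame I a.1 r (C * rho ^+ 2) (fun e => f (X e) - f a - lin l (X e - a))].

Definition regular I A f a l := strict_diff A f a l /\ tame_diff I A f a l.

Lemma norm1_ge0 x : 0 <= norm1 x. Proof. by rewrite !addr_ge0. Qed.

Lemma norm1D x y : norm1 (x + y) <= norm1 x + norm1 y.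
Proof.
have := ler_normD x.1 y.1; have := ler_normD x.2.1 y.2.1.
have := ler_normD x.2.2 y.2.2; rewrite /norm1 /=; lra.
Qed.

Lemma norm1N x : norm1 (- x) = norm1 x.
Proof. by rewrite /norm1 /= !normrN. Qed.

Lemma norm1_lt x r : norm1 x < r -> `|x| < r.
Proof.
move=> xr; rewrite prod_normE/= prod_normE/= !gt_max.
have := normr_ge0 x.1; have := normr_ge0 x.2.1; have := normr_ge0 x.2.2.
by move: xr; rewrite /norm1 => *; apply/and3P; split; lra.
Qed.

Lemma lin_le l x : `|lin l x| <= norm1 l * norm1 x.
Proof.
rewrite /lin; apply: le_trans (_ : `|l.1| * `|x.1| + `|l.2.1| * `|x.2.1| + `|l.2.2| * `|x.2.2| <= _).
  by rewrite -!normrM (le_trans (ler_normD _ _))// lerD2r ler_normD.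
rewrite /norm1; have := normr_ge0 l.1; have := normr_ge0 l.2.1.
have := normr_ge0 l.2.2; have := normr_ge0 x.1; have := normr_ge0 x.2.1.
have := normr_ge0 x.2.2; nra.
Qed.

(** The linear part of the power series at a serves for both notions; the terms of degree at least
two are dominated by the series of norms, which converges at radius s. Curves are kept in the ball of
radius s / 4, so that all of them stay in the domain of convergence. *)
Lemma analytic_regular I A f a : analytic_on A f -> A a -> exists l, regular I A f a l.
Proof.
move=> fan Aa; have [c [s [s0 cv fx]]] := fan a Aa.
exists (c 1 0 0, (c 0 1 0, c 0 0 1))%N; set l : pt := (_, _).
pose ha d : R := s ^+ d * habs c d.
have ha0 d : 0 <= ha d by rewrite mulr_ge0 ?habs_ge0 ?exprn_ge0 ?(ltW s0).
have haE : series ha = series (fun d => homog_part (fun i j k => `|c i j k|) d s s s).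
  by congr series; apply/funext => d; rewrite homog_norm.
rewrite -haE in cv; pose Cs : R := limn (series ha).
have Cs_ge n : \sum_(0 <= d < n) ha d <= Cs.
  by apply: (nondecreasing_cvgn_le _ cv); apply: nondecreasing_series => ? _ _; exact: ha0.
have Cs0 : 0 <= Cs by apply: le_trans (Cs_ge 0); rewrite big_geq.
pose h d x := homog_part c d (x - a).1 (x - a).2.1 (x - a).2.2.
have split2 (u : nat -> R) n :
    \sum_(0 <= d < n.+2) u d = u 0 + u 1 + \sum_(0 <= d < n) u d.+2.
  by rewrite !big_nat_recl// addrA.
have h0 x : h 0 x = c 0 0 0 by rewrite /h homog0.
have h1 x : h 1 x = lin l (x - a) by rewrite /h homog1.
have hle x (d : nat) (rho : R) : 0 <= rho -> `|(x - a).1| <= rho -> `|(x - a).2.1| <= rho ->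
    `|(x - a).2.2| <= rho -> `|h d x| <= rho ^+ d * habs c d by exact: homog_le.
have c2 (u : nat -> R) (L : R) : series u @ \oo --> L ->
    (fun n => \sum_(0 <= d < n.+2) u d) @ \oo --> L.
  move=> uL; rewrite -(cvg_shiftn 2) in uL; apply: cvg_trans uL.
  by apply: near_eq_cvg; near=> n; rewrite /series /= addn2.
have fa : f a = c 0 0 0.
  apply/eqP; rewrite -subr_eq0 -normr_le0.
  have := fx a Aa; rewrite subrr normr0 => /(_ s0) /c2 ca.
  apply: (cvg_norm_le (cvgB ca (cvg_cst (c 0 0 0)))); near=> n.
  rewrite -[X in `|X|]/(\sum_(0 <= d < n.+2) h d a - c 0 0 0).
  rewrite normr_le0 split2 (h0 a) (h1 a) subrr /lin !mulr0 !addr0.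
  rewrite big1_seq ?addr0 ?subrr// => d _; apply/eqP; rewrite -normr_le0.
  have := hle a d.+2 0 (lexx _); rewrite subrr normr0 expr0n mul0r; exact.
split.
  move=> eta eta0.
  pose rho := Num.min (s / 2) (eta * s ^+ 2 / (2 * (Cs + 1))).
  have Cs1 : 0 < Cs + 1 by rewrite ltr_wpDl.
  have p0 : 0 < rho by rewrite lt_min !(divr_gt0, mulr_gt0, exprn_gt0).
  have ps : rho <= s / 2 by rewrite ge_min lexx.
  have pe : 2 * rho * Cs <= eta * s ^+ 2.
    have : rho * (2 * (Cs + 1)) <= eta * s ^+ 2.
      by rewrite -ler_pdivlMr ?mulr_gt0// ge_min lexx orbT.
    by apply: le_trans; nra.
  exists rho => // x y Ax Ay xa ya.
  have xs : `|x - a| < s by apply: norm1_lt; lra.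
  have ys : `|y - a| < s by apply: norm1_lt; lra.
  have cx := c2 _ _ (fx x Ax xs); have cy := c2 _ _ (fx y Ay ys).
  apply: (cvg_norm_le (cvgB (cvgB cx cy) (cvg_cst (lin l (x - y))))); near=> n.
  rewrite -[X in `|X|]/(\sum_(0 <= d < n.+2) h d x - \sum_(0 <= d < n.+2) h d y - lin l (x - y)).
  rewrite !split2 !h0 !h1.
  have -> : c 0 0 0 + lin l (x - a) + \sum_(0 <= d < n) h d.+2 x -
     (c 0 0 0 + lin l (y - a) + \sum_(0 <= d < n) h d.+2 y) - lin l (x - y) =
     \sum_(0 <= d < n) (h d.+2 x - h d.+2 y).
    by rewrite sumrB /lin /=; ring.
  have s2 : 0 < s ^+ 2 by rewrite exprn_gt0.
  apply: (@le_trans _ _ (\sum_(0 <= d < n) 2 * rho / s ^+ 2 * norm1 (x - y) * ha d.+2)).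
    rewrite (le_trans (ler_norm_sum _ _ _))//; apply: ler_sum => d _.
    rewrite -(ler_pM2l p0); apply: le_trans (homog_lip c d.+2 p0 _ _ _ _ _ _) _.
    1-6: by move: (xa) (ya); rewrite /norm1; have := normr_ge0 (x - a).1;
      have := normr_ge0 (x - a).2.1; have := normr_ge0 (x - a).2.2;
      have := normr_ge0 (y - a).1; have := normr_ge0 (y - a).2.1;
      have := normr_ge0 (y - a).2.2; move=> *; lra.
    have -> : `|(x - a).1 - (y - a).1| + `|(x - a).2.1 - (y - a).2.1| +
              `|(x - a).2.2 - (y - a).2.2| = norm1 (x - y).
      by rewrite /norm1 /= !opprB !addrA !subrK.
    have K : d.+2%:R * rho ^+ d <= 2 * s ^+ d.
      apply: (@le_trans _ _ (d.+2%:R * (s / 2) ^+ d)).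
        by rewrite ler_wpM2l// lerXn2r ?nnegrE ?divr_ge0 ?(ltW p0) ?(ltW s0).
      rewrite expr_div_n mulrA ler_pdivrMr ?exprn_gt0// mulrAC ler_wpM2r//.
        by rewrite exprn_ge0 ?(ltW s0).
      rewrite -natrX -natrM ler_nat; elim: d => // d; rewrite expnS; lia.
    rewrite [leRHS](_ : _ = (2 * s ^+ d) * (rho ^+ 2 * habs c d.+2 * norm1 (x - y))); last first.
      by rewrite /ha (exprS s d.+1) (exprS s d); field; exact: lt0r_neq0.
    rewrite [leLHS](_ : _ = (d.+2%:R * rho ^+ d) * (rho ^+ 2 * habs c d.+2 * norm1 (x - y))).
      by rewrite ler_wpM2r// !mulr_ge0 ?norm1_ge0 ?habs_ge0 ?exprn_ge0// ltW.
    by rewrite (exprS rho d.+1) (exprS rho d); ring.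
  rewrite -mulr_sumr mulrAC ler_wpM2r ?norm1_ge0//.
  apply: (@le_trans _ _ (2 * rho / s ^+ 2 * Cs)).
    apply: ler_wpM2l; first by rewrite divr_ge0 ?(ltW s2)// mulr_ge0 ?(ltW p0).
    apply: le_trans (Cs_ge n.+2); rewrite split2 lerDr addr_ge0//.
  by rewrite mulrAC ler_pdivrMr.
exists (Cs / s ^+ 2), (s / 4); split.
- by rewrite divr_ge0// exprn_ge0// ltW.
- by rewrite divr_gt0.
move=> r rho X r0 rp ps AX [t1 t2 t3] eta eta0.
have p0 : 0 < rho by exact: lt_le_trans rp.
have rr e : I e -> `|e - a.1| <= r -> forall T, wnorm r T <= rho -> `|T.[e - a.1]| <= rho.
  by move=> _ er T; apply: le_trans; exact: horner_wnorm.
have [N hN] : exists N, Cs - \sum_(0 <= d < N.+2) ha d <= eta / 2.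
  have e20 : 0 < eta / 2 by rewrite divr_gt0.
  have /cvgrPdist_le /(_ _ e20)[N _ /(_ N (leqnn N)) /= hN] := c2 _ _ cv.
  by exists N; apply: le_trans hN; exact: ler_norm.
have tail x : A x -> norm1 (x - a) < s -> `|f x - \sum_(0 <= d < N.+2) h d x| <= eta / 2.
  move=> Ax xa; have cx := fx x Ax (norm1_lt xa).
  apply: (cvg_norm_le (cvgB cx (cvg_cst (\sum_(0 <= d < N.+2) h d x)))).
  near=> n; have nN : (N.+2 <= n)%N by near: n; exact: nbhs_infty_ge.
  rewrite -[X in `|X|]/(\sum_(0 <= d < n) h d x - \sum_(0 <= d < N.+2) h d x).
  rewrite (big_cat_nat (leq0n _) nN)//= addrAC subrr add0r.
  apply: (@le_trans _ _ (\sum_(N.+2 <= d < n) ha d)).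
    rewrite (le_trans (ler_norm_sum _ _ _))//; apply: ler_sum => d _.
    apply: hle; rewrite ?(ltW s0)//; move: xa; rewrite /norm1.
    + have := normr_ge0 (x - a).2.1; have := normr_ge0 (x - a).2.2; lra.
    + have := normr_ge0 (x - a).1; have := normr_ge0 (x - a).2.2; lra.
    + have := normr_ge0 (x - a).1; have := normr_ge0 (x - a).2.1; lra.
  apply: le_trans hN; rewrite lerBrDl; apply: le_trans (Cs_ge n).
  by rewrite (big_cat_nat (leq0n _) nN).
pose K := \sum_(0 <= d < N) (d.+2%:R * rho ^+ d.+2 * habs c d.+2 / rho).
have K0 : 0 <= K.
  apply: sumr_ge0 => d _; apply: divr_ge0; last exact: ltW.
  apply: mulr_ge0; last exact: habs_ge0.
  by apply: mulr_ge0; rewrite ?ler0n// exprn_ge0// ltW.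
have [|T1 T1p T1f] := t1 (eta / 2 / (3 * (K + 1))).
  by rewrite !divr_gt0// mulr_gt0// ltr_wpDl.
have [|T2 T2p T2f] := t2 (eta / 2 / (3 * (K + 1))).
  by rewrite !divr_gt0// mulr_gt0// ltr_wpDl.
have [|T3 T3p T3f] := t3 (eta / 2 / (3 * (K + 1))).
  by rewrite !divr_gt0// mulr_gt0// ltr_wpDl.
have s2 : 0 < s ^+ 2 by rewrite exprn_gt0.
exists (\sum_(0 <= d < N) homogP c d.+2 T1 T2 T3).
  rewrite (le_trans (wnorm_sum _ _ _ (ltW r0)))//.
  apply: (@le_trans _ _ (\sum_(0 <= d < N) rho ^+ 2 / s ^+ 2 * ha d.+2)).
    apply: ler_sum => d _.
    apply: le_trans (wnorm_homogP _ _ (ltW r0) (ltW p0) T1p T2p T3p) _.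
    have K' : rho ^+ d <= s ^+ d.
      by rewrite lerXn2r ?nnegrE ?(ltW p0) ?(ltW s0)//; lra.
    rewrite [leRHS](_ : _ = s ^+ d * (rho ^+ 2 * habs c d.+2)); last first.
      by rewrite /ha (exprS s d.+1) (exprS s d); field; exact: lt0r_neq0.
    rewrite [leLHS](_ : _ = rho ^+ d * (rho ^+ 2 * habs c d.+2)).
      by rewrite ler_wpM2r// mulr_ge0 ?habs_ge0 ?exprn_ge0// ltW.
    by rewrite (exprS rho d.+1) (exprS rho d); ring.
  rewrite -mulr_sumr mulrC mulrA mulrAC ler_pM2r ?exprn_gt0//.
  apply: ler_wpM2r; first by rewrite invr_ge0 ltW.
  by apply: le_trans (Cs_ge N.+2); rewrite split2 lerDr addr_ge0.
move=> e Ie er; rewrite fa.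
have X1 := tame_sup t1 Ie er; have X2 := tame_sup t2 Ie er.
have X3 := tame_sup t3 Ie er.
rewrite horner_sum (eq_bigr _ (fun d _ => horner_homogP c d.+2 T1 T2 T3 (e - a.1))).
have AXe := AX e Ie er.
have Xs : norm1 (X e - a) < s.
  by rewrite /norm1; lra.
have -> : f (X e) - c 0 0 0 - lin l (X e - a) -
   \sum_(0 <= d < N) homog_part c d.+2 T1.[e - a.1] T2.[e - a.1] T3.[e - a.1] =
   (f (X e) - \sum_(0 <= d < N.+2) h d (X e)) +
   \sum_(0 <= d < N) (h d.+2 (X e) -
       homog_part c d.+2 T1.[e - a.1] T2.[e - a.1] T3.[e - a.1]).
  by rewrite split2 h0 h1 sumrB; ring.
rewrite (splitr eta) (le_trans (ler_normD _ _))// lerD ?tail//.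
set D := eta / 2 / (3 * (K + 1)) in T1f T2f T3f.
have K1 : 0 < K + 1 by rewrite ltr_wpDl.
have D0 : 0 <= D by rewrite !divr_ge0 ?mulr_ge0 ?(ltW eta0) ?(ltW K1).
apply: (@le_trans _ _ (K * (3 * D))); last first.
  have -> : eta / 2 = (K + 1) * (3 * D) by rewrite /D; field; exact: lt0r_neq0.
  by apply: ler_wpM2r; lra.
rewrite (le_trans (ler_norm_sum _ _ _))// /K mulr_suml; apply: ler_sum => d _.
rewrite mulrAC ler_pdivlMr// mulrC.
apply: le_trans (homog_lip c d.+2 p0 X1 X2 X3 _ _ _) _; rewrite ?rr//.
apply: ler_wpM2l.
  apply: mulr_ge0; last exact: habs_ge0.
  by apply: mulr_ge0; rewrite ?ler0n// exprn_ge0// ltW.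
have := T1f e Ie er; have := T2f e Ie er; have := T3f e Ie er; lra.
Unshelve. all: by end_near.
Qed.

End Regular.

(** * Composition of regular functions *)

Section RegularComp.
Context {R : realType}.
Local Notation pt := (R * (R * R))%type.
Implicit Types (A : set pt) (I : set R) (f g : pt -> R) (a l x y : pt).

Lemma linB l x y : lin l (x - y) = lin l x - lin l y.
Proof. by rewrite /lin /=; ring. Qed.

Lemma strict_diff_lip A f a l : strict_diff A f a l -> exists2 r : R, 0 < r &
  forall x y, A x -> A y -> norm1 (x - a) < r -> norm1 (y - a) < r ->
    `|f x - f y| <= (norm1 l + 1) * norm1 (x - y).
Proof.
move=> /(_ 1 ltr01)[r r0 fr]; exists r => // x y Ax Ay xa ya.
have := fr x y Ax Ay xa ya; rewrite mul1r => h.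
rewrite -[X in `|X|](subrK (lin l (x - y))) (le_trans (ler_normD _ _))//.
by rewrite (mulrDl (norm1 l)) mul1r addrC lerD// lin_le.
Qed.

Lemma tame_lin I (e1 r rho : R) (X : R -> pt) a l : 0 <= r ->
  tame_curve I e1 r rho X a ->
  tame I e1 r (norm1 l * rho) (fun e => lin l (X e - a)).
Proof.
move=> r0 [t1 t2 t3].
have := tameD r0 (tameD r0 (tameZ l.1 t1) (tameZ l.2.1 t2)) (tameZ l.2.2 t3).
by rewrite -!mulrDl; exact.
Qed.

Definition lcomp (lg l1 l2 : pt) : pt :=
  (lg.1 + lg.2.1 * l1.1 + lg.2.2 * l2.1,
   (lg.2.1 * l1.2.1 + lg.2.2 * l2.2.1, lg.2.1 * l1.2.2 + lg.2.2 * l2.2.2)).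

Lemma lcompE lg l1 l2 x : lin (lcomp lg l1 l2) x = lin lg (x.1, (lin l1 x, lin l2 x)).
Proof. by rewrite /lin /lcomp /=; ring. Qed.

Section comp.
Variables (I : set R) (A : set pt) (f1 f2 g : pt -> R) (a l1 l2 lg : pt).
Hypotheses (Aa : A a).
Let Phi (x : pt) : pt := (x.1, (f1 x, f2 x)).
Hypothesis APhi : forall x, A x -> A (Phi x).

Let lin_rem x y : g (Phi x) - g (Phi y) - lin (lcomp lg l1 l2) (x - y) =
  (g (Phi x) - g (Phi y) - lin lg (Phi x - Phi y)) +
  lg.2.1 * (f1 x - f1 y - lin l1 (x - y)) + lg.2.2 * (f2 x - f2 y - lin l2 (x - y)).
Proof. by rewrite lcompE /lin /=; ring. Qed.

(** The parameter is carried along unchanged, so that g composed with this map is one step of the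
iteration of a family of plane maps. *)
Lemma strict_diff_comp : strict_diff A f1 a l1 -> strict_diff A f2 a l2 ->
  strict_diff A g (Phi a) lg -> strict_diff A (g \o Phi) a (lcomp lg l1 l2).
Proof.
move=> d1 d2 dg eta eta0.
have [r1 r10 L1] := strict_diff_lip d1; have [r2 r20 L2] := strict_diff_lip d2.
pose K : R := 1 + (norm1 l1 + 1) + (norm1 l2 + 1).
have K0 : 0 < K by have := norm1_ge0 l1; have := norm1_ge0 l2; rewrite /K; lra.
have [|rg rg0 Dg] := dg (eta / 2 / K); first by rewrite !divr_gt0.
pose M : R := norm1 lg + 1.
have M0 : 0 < M by have := norm1_ge0 lg; rewrite /M; lra.
have e'0 : 0 < eta / 2 / M by rewrite !divr_gt0.
have [r3 r30 D1] := d1 _ e'0; have [r4 r40 D2] := d2 _ e'0.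
pose r := Num.min (Num.min r1 r2) (Num.min (Num.min r3 r4) (rg / K)).
exists r; first by rewrite !lt_min r10 r20 r30 r40 divr_gt0.
move=> x y Ax Ay; rewrite !lt_min -!andbA => /and5P[x1 x2 x3 x4 xg] /and5P[y1 y2 y3 y4 yg].
have LPhi u v : A u -> A v -> norm1 (u - a) < r1 -> norm1 (u - a) < r2 ->
    norm1 (v - a) < r1 -> norm1 (v - a) < r2 -> norm1 (Phi u - Phi v) <= K * norm1 (u - v).
  move=> Au Av u1 u2 v1 v2; have := L1 u v Au Av u1 v1; have := L2 u v Au Av u2 v2.
  have -> : norm1 (Phi u - Phi v) = `|u.1 - v.1| + `|f1 u - f1 v| + `|f2 u - f2 v| by [].
  rewrite /K => h2 h1.
  have : `|u.1 - v.1| <= norm1 (u - v) by rewrite /norm1 /= -addrA lerDl addr_ge0.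
  lra.
have aa : norm1 (a - a) = 0 by rewrite subrr /norm1 /= normr0; lra.
have Bg u : A u -> norm1 (u - a) < r1 -> norm1 (u - a) < r2 ->
    norm1 (u - a) < rg / K -> norm1 (Phi u - Phi a) < rg.
  move=> Au u1 u2; rewrite ltr_pdivlMr// mulrC; apply: le_lt_trans.
  by apply: LPhi; rewrite ?aa.
have := Dg _ _ (APhi Ax) (APhi Ay) (Bg x Ax x1 x2 xg) (Bg y Ay y1 y2 yg).
have := LPhi x y Ax Ay x1 x2 y1 y2.
have := D1 x y Ax Ay x3 y3; have := D2 x y Ax Ay x4 y4.
set N := norm1 (x - y) => h2 h1 hK hg.
rewrite /= lin_rem.
have hg' : `|g (Phi x) - g (Phi y) - lin lg (Phi x - Phi y)| <= eta / 2 * N.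
  apply: (le_trans hg); rewrite -(mulrA (eta / 2)) ler_wpM2l ?divr_ge0 ?(ltW eta0)//.
  by rewrite ler_pdivrMl.
have N0 : 0 <= N by exact: norm1_ge0.
have q1 : `|lg.2.1 * (f1 x - f1 y - lin l1 (x - y))| <= `|lg.2.1| * (eta / 2 / M * N).
  by rewrite normrM ler_wpM2l.
have q2 : `|lg.2.2 * (f2 x - f2 y - lin l2 (x - y))| <= `|lg.2.2| * (eta / 2 / M * N).
  by rewrite normrM ler_wpM2l.
have q3 : (`|lg.2.1| + `|lg.2.2|) * (eta / 2 / M * N) <= eta / 2 * N.
  rewrite mulrA ler_wpM2r// mulrCA ler_piMr ?divr_ge0 ?(ltW eta0)//.
  rewrite ler_pdivrMr// mul1r /M /norm1; have := normr_ge0 lg.1; lra.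
rewrite (le_trans (ler_normD _ _))// (le_trans (lerD (ler_normD _ _) (lexx _)))//.
move: hg' q1 q2 q3; rewrite mulrDl; lra.
Qed.

(** The image of a tame curve of size rho is a tame curve of size K * rho; the linear parts and the
second order remainders are estimated separately. *)
Lemma tame_diff_comp : tame_diff I A f1 a l1 -> tame_diff I A f2 a l2 ->
  tame_diff I A g (Phi a) lg -> tame_diff I A (g \o Phi) a (lcomp lg l1 l2).
Proof.
move=> [C1 [s1 [C10 s10 t1]]] [C2 [s2 [C20 s20 t2]]] [Cg [sg [Cg0 sg0 tg]]].
pose K : R := 1 + (norm1 l1 + C1) + (norm1 l2 + C2).
have n1 := norm1_ge0 l1; have n2 := norm1_ge0 l2.
have K1 : 1 <= K by rewrite /K; lra.
have K0 : 0 < K by exact: lt_le_trans K1.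
exists (Cg * K ^+ 2 + `|lg.2.1| * C1 + `|lg.2.2| * C2).
exists (Num.min (Num.min s1 s2) (Num.min 1 (sg / K))); split.
- by rewrite !addr_ge0// mulr_ge0// exprn_ge0// ltW.
- by rewrite !lt_min s10 s20 ltr01 divr_gt0.
move=> r rho X r0 rp; rewrite !le_min -!andbA => /and4P[ps1 ps2 p1 psg] AX tX.
have p0 : 0 < rho by exact: lt_le_trans rp.
have r0' := ltW r0.
have u1 := t1 r rho X r0 rp ps1 AX tX; have u2 := t2 r rho X r0 rp ps2 AX tX.
have pK : rho <= K * rho by rewrite ler_peMl// ltW.
have small (l : pt) (C : R) : 0 <= C -> norm1 l + C <= K -> norm1 l * rho + C * rho ^+ 2 <= K * rho.
  move=> C0 h; apply: (@le_trans _ _ ((norm1 l + C) * rho)); last first.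
    by apply: ler_wpM2r => //; exact: ltW.
  rewrite (mulrDl (norm1 l)) lerD2l ler_wpM2l// expr2 ler_piMr// ltW//.
have tPhi : tame_curve I (Phi a).1 r (K * rho) (Phi \o X) (Phi a).
  split => /=.
  - by case: tX => t _ _; apply: tame_le t.
  - apply: (@eq_tame _ _ _ _ _ _ _ _ (tame_le _ (tameD r0' u1 (tame_lin l1 r0' tX)))).
      by move=> e _ _; rewrite subrK.
    by rewrite addrC small// /K; lra.
  - apply: (@eq_tame _ _ _ _ _ _ _ _ (tame_le _ (tameD r0' u2 (tame_lin l2 r0' tX)))).
      by move=> e _ _; rewrite subrK.
    by rewrite addrC small// /K; lra.
have Kps : K * rho <= sg by rewrite mulrC -ler_pdivlMr.
have ug := tg r (K * rho) (Phi \o X) r0 (le_trans rp pK) Kps _ tPhi.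
have AP e : I e -> `|e - (Phi a).1| <= r -> A ((Phi \o X) e).
  by move=> Ie er; apply/APhi/AX.
have tt := tameD r0' (tameD r0' (ug AP) (tameZ lg.2.1 u1)) (tameZ lg.2.2 u2).
apply: (@eq_tame _ _ _ _ _ _ _ _ (tame_le _ tt)).
  by move=> e _ _; rewrite /= lin_rem.
by rewrite exprMn !mulrDl !mulrA.
Qed.

Lemma regular_comp : regular I A f1 a l1 -> regular I A f2 a l2 ->
  regular I A g (Phi a) lg -> regular I A (g \o Phi) a (lcomp lg l1 l2).
Proof.
move=> [d1 t1] [d2 t2] [dg tg]; split; first exact: strict_diff_comp.
exact: tame_diff_comp.
Qed.

End comp.
End RegularComp.

(** * Identity principle along an implicit curve *)

Section ImplicitZeros.
Context {R : realType}.
Local Notation pt := (R * (R * R))%type.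
Variables (I : set R) (A : set pt) (G H : pt -> R) (e1 q p1 : R) (lG lH : pt).
Let a : pt := (e1, (q, p1)).
Hypotheses (Ga : G a = 0) (rG : regular I A G a lG) (rH : regular I A H a lH)
  (lG0 : 0 < lG.2.2).
Hypothesis Aopen : exists2 r : R, 0 < r & forall e p, I e -> `|e - e1| < r ->
  `|p - p1| < r -> A (e, (q, p)).
Variable gam : R -> R.
Hypothesis gam0 : exists2 r : R, 0 < r & forall e, I e -> `|e - e1| < r ->
  G (e, (q, gam e)) = 0.
Hypothesis gam_cont : forall d, 0 < d -> exists2 r : R, 0 < r &
  forall e, I e -> `|e - e1| < r -> `|gam e - p1| < d.

Let kap := lG.2.2.

(** The curve gam solves G = 0, and the simplified Newton step p - G / kap maps curves tame of size
rho to such curves while contracting the distance to gam by one half. Hence gam is a uniform limit of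
tame curves with a common bound, it is tame itself, so H along gam is tame, and the identity theorem
applies to it. *)
Lemma implicit_zero_identity :
  (forall d : R, 0 < d -> exists e, [/\ I e, e != e1, `|e - e1| < d &
     H (e, (q, gam e)) = 0]) ->
  exists2 r : R, 0 < r & forall e, I e -> `|e - e1| < r -> H (e, (q, gam e)) = 0.
Proof.
move=> Z.
have [dG [CG [sG [CG0 sG0 tG]]]] := rG; have [_ [CH [sH [CH0 sH0 tH]]]] := rH.
have kap0 : 0 < kap by [].
have [|rS rS0 SG] := dG (kap / 2); first by rewrite divr_gt0.
have [rA rA0 AA] := Aopen; have [r0 r00 G0] := gam0.
have CG1 : 0 < CG + 1 by lra.
pose rho : R := Num.min (Num.min sG sH)
  (Num.min (Num.min (rS / 3) (rA / 2)) (kap / 2 / (CG + 1))).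
have p0 : 0 < rho by rewrite !lt_min sG0 sH0 !divr_gt0.
have : rho <= rho by []; rewrite {2}/rho !le_min -!andbA => /and5P[psG psH pS pA pk].
have pk' : CG * rho <= kap / 2.
  by move: pk; rewrite ler_pdivlMr// => pk; nra.
have [rc rc0 gc] := gam_cont p0.
pose r : R := Num.min (Num.min (rho / 2) (rho / 2 / (`|lG.1 / kap| + 1))) (Num.min (rc / 2) (r0 / 2)).
have n1 : 0 < `|lG.1 / kap| + 1 by rewrite ltr_wpDl.
have r_gt0 : 0 < r by rewrite !lt_min !divr_gt0.
have : r <= r by []; rewrite {2}/r !le_min -!andbA => /and4P[rr1 rr2 rr3 rr4].
have rp : r <= rho by lra.
have lr : `|lG.1 / kap| * r <= rho / 2.
  move: rr2; rewrite ler_pdivlMr// mulrDr mulr1 mulrC => h; lra.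
have r0' := ltW r_gt0.
pose X (p : R -> R) e : pt := (e, (q, p e)).
have gamr e : I e -> `|e - e1| <= r -> `|gam e - p1| <= rho.
  by move=> Ie er; rewrite ltW// gc//; lra.
have AX p : (forall e, I e -> `|e - e1| <= r -> `|p e - p1| <= rho) ->
    forall e, I e -> `|e - e1| <= r -> A (X p e).
  by move=> hp e Ie er; apply: AA => //; [|have := hp e Ie er]; lra.
have Xs p : (forall e, I e -> `|e - e1| <= r -> `|p e - p1| <= rho) ->
    forall e, I e -> `|e - e1| <= r -> norm1 (X p e - a) < rS.
  by move=> hp e Ie er; have := hp e Ie er; rewrite /norm1 /= subrr normr0; lra.
have tc p : tame I e1 r rho (fun e => p e - p1) -> tame_curve I e1 r rho (X p) a.
  move=> tp; split => //=; first exact: tame_le rp (tame_shift _ _ _).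
  apply: eq_tame (tame_le (ltW p0) _) => [e _ _|]; first by rewrite /= subrr.
  by rewrite -[X in tame _ _ _ X](normr0 R); exact: tame_cst.
(* Newton steps with the derivative kap frozen at the base point *)
pose step (p : R -> R) e := p e - G (X p e) / kap.
(* the linear parts in p cancel; what remains is of second order, or the drift lG.1 * (e - e1),
     small since r is small compared to rho *)
have tstep p : tame I e1 r rho (fun e => p e - p1) ->
    tame I e1 r rho (fun e => step p e - p1).
  move=> tp; have hp e : I e -> `|e - e1| <= r -> `|p e - p1| <= rho.
    exact: tame_sup tp.
  have u := tG r rho (X p) r_gt0 rp psG (AX p hp) (tc p tp).
  apply: (@eq_tame _ _ _ _ _ _ _ _ (tame_le _
    (tameD r0' (tameZ (- kap^-1) u) (tameZ (- (lG.1 / kap)) (tame_shift I e1 r))))).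
    move=> e Ie er; rewrite /step Ga /lin /= subrr -/kap; field; exact: lt0r_neq0.
  rewrite !normrN (ger0_norm (_ : 0 <= kap^-1)) ?invr_ge0 ?(ltW kap0)//.
  have : kap^-1 * (CG * rho ^+ 2) <= rho / 2.
    by rewrite ler_pdivrMl// expr2; nra.
  lra.
have cstep p : (forall e, I e -> `|e - e1| <= r -> `|p e - p1| <= rho) ->
    forall e, I e -> `|e - e1| <= r -> `|gam e - step p e| <= 2^-1 * `|gam e - p e|.
  move=> hp e Ie er.
  have := SG _ _ (AX p hp e Ie er) (AX gam gamr e Ie er) (Xs p hp e Ie er) (Xs gam gamr e Ie er).
  rewrite {2}/X G0//; last by lra.
  rewrite /lin /norm1 /= !subrr !normr0 !mulr0 !add0r subr0 -/kap.
  have -> : gam e - step p e = kap^-1 * (G (X p e) - kap * (p e - gam e)).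
    rewrite /step; field; exact: lt0r_neq0.
  rewrite normrM (ger0_norm (_ : 0 <= kap^-1)) ?invr_ge0 ?(ltW kap0)//.
  rewrite ler_pdivrMl// (distrC (gam e)) => h; lra.
pose P j := iter j step (fun=> p1).
have tP j : tame I e1 r rho (fun e => P j e - p1).
  elim: j => [|j IHj]; last exact: tstep.
  apply: eq_tame (tame_le (ltW p0) _) => [e _ _|]; last first.
    by rewrite -[X in tame _ _ _ X](normr0 R); exact: tame_cst.
  by rewrite /= subrr.
have cP j e : I e -> `|e - e1| <= r -> `|gam e - P j e| <= 2^-1 ^+ j * rho.
  move=> Ie er; elim: j => [|j IHj]; first by rewrite expr0 mul1r gamr.
  apply: le_trans (cstep _ _ _ Ie er) _; first by move=> ? ? ?; exact: tame_sup (tP j) _ _.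
  by rewrite exprS -mulrA ler_wpM2l.
have tgam : tame I e1 r rho (fun e => gam e - p1).
  apply: tame_unif => eta eta0.
  have [j hj] := half_expr_small rho eta0.
  exists (fun e => P j e - p1) => // e Ie er.
  by rewrite opprB addrA subrK (le_trans (cP j e Ie er))// mulrC.
have u := tH r rho (X gam) r_gt0 rp psH (AX _ gamr) (tc _ tgam).
have u' := tameD r0' (tameD r0' u (tame_cst I e1 r (H a))) (tame_lin lH r0' (tc _ tgam)).
exists (r / 2); first by rewrite divr_gt0.
move=> e Ie er.
have K : tame I e1 r (CH * rho ^+ 2 + `|H a| + norm1 lH * rho) (fun e => H (X gam e)).
  by apply: eq_tame u' => e' _ _; ring.
apply: (tame_eq0 r_gt0 _ K Z Ie (ltW er)).
rewrite !addr_ge0// mulr_ge0 ?norm1_ge0 ?exprn_ge0//; exact: ltW.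
Qed.

End ImplicitZeros.

(** * Strict differentiability in the plane *)

Section PlaneCalculus.
Context {R : realType}.
Implicit Types (D : set (R * R)) (f : R * R -> R) (x v l : R * R).

Definition taxi v : R := `|v.1| + `|v.2|.
Definition lin2 l v : R := l.1 * v.1 + l.2 * v.2.

Definition strict_diff2 D f x l := forall eta : R, 0 < eta -> exists2 r : R, 0 < r &
  forall y z, D y -> D z -> taxi (y - x) < r -> taxi (z - x) < r ->
    `|f y - f z - lin2 l (y - z)| <= eta * taxi (y - z).

Definition box_open D := forall x, D x -> exists2 r : R, 0 < r &
  forall y, taxi (y - x) < r -> D y.

(** The derivative of f is compared with a number through difference quotients, since strict
differentiability speaks of finite increments only. *)
Lemma derive_near_cst f x v (c eta : R) : differentiable f x ->
  (exists2 r : R, 0 < r & forall h : R, h != 0 -> `|h| < r ->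
     `|f (x + h *: v) - f x - h * c| <= eta * `|h|) ->
  `|'d f x v - c| <= eta.
Proof.
move=> df [r r0 H]; rewrite -deriveE//.
have dv : (fun h : R => h^-1 *: ((f \o shift x) (h *: v) - f x)) @ 0^' --> 'D_v f x.
  exact: diff_derivable df.
apply: (cvg_norm_le (cvgB dv (cvg_cst c))); near=> h.
have h0 : h != 0 by near: h; exact: nbhs_dnbhs_neq.
have hr : `|h| < r by near: h; apply: dnbhs0_lt.
rewrite -[X in `|X|]/(h^-1 * (f (h *: v + x) - f x) - c) addrC (addrC (h *: v)).
rewrite -(ler_pM2r (_ : 0 < `|h|)) ?normr_gt0// -normrM.
have -> : (- c + h^-1 * (f (x + h *: v) - f x)) * h = f (x + h *: v) - f x - h * c.
  by field.
exact: H.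
Unshelve. all: by end_near.
Qed.

Lemma is_derive_line f x v (t : R) : differentiable f (x + t *: v) ->
  is_derive t (1 : R) (fun s : R => f (x + s *: v)) ('d f (x + t *: v) v).
Proof.
move=> df; have dv := @diff_derivable _ _ _ _ _ v df.
have E : (fun h : R => h^-1 *: (((fun s : R => f (x + s *: v)) \o shift t) (h *: (1 : R)) -
     f (x + t *: v))) =
  (fun h : R => h^-1 *: ((f \o shift (x + t *: v)) (h *: v) - f (x + t *: v))).
  apply/funext => h /=; congr (_ *: (f _ - _)).
  by rewrite -[h%:A]/(h * 1) mulr1 scalerDl addrCA.
apply: DeriveDef; first by rewrite /derivable E.
by rewrite /derive E -deriveE.
Qed.

(** A strictly differentiable function which is differentiable has a derivative continuous at x. *)
Lemma strict_diff2_partial D f x l (eta : R) : box_open D -> D x -> strict_diff2 D f x l ->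
  (forall y, D y -> differentiable f y) -> 0 < eta ->
  exists2 r : R, 0 < r & forall y, taxi (y - x) < r -> forall v, taxi v <= 1 ->
    `|'d f y v - lin2 l v| <= eta.
Proof.
move=> oD Dx sf df eta0; have [r r0 Hr] := sf _ eta0; have [s s0 Ds] := oD x Dx.
exists (Num.min r s / 2) => [|y yr v v1]; first by rewrite divr_gt0// lt_min r0.
have m0 : 0 < Num.min r s by rewrite lt_min r0.
have [mr ms] : Num.min r s <= r /\ Num.min r s <= s by rewrite !ge_min !lexx orbT.
have t0 w : 0 <= taxi w by rewrite /taxi addr_ge0.
have Dy : D y by apply: Ds; lra.
apply: derive_near_cst; first exact: df.
exists (Num.min r s / 2) => [|h h0 hr]; first by rewrite divr_gt0.
have thv : taxi (h *: v) <= `|h|.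
  rewrite /taxi /= -[h *: v.1]/(h * v.1) -[h *: v.2]/(h * v.2) !normrM -mulrDr.
  by rewrite ler_piMr.
have tri w1 w2 : taxi (w1 + w2) <= taxi w1 + taxi w2.
  by have := ler_normD w1.1 w2.1; have := ler_normD w1.2 w2.2; rewrite /taxi /=; lra.
have yh : taxi (y + h *: v - x) < Num.min r s.
  by rewrite addrAC; have := tri (y - x) (h *: v); lra.
have := Hr (y + h *: v) y (Ds _ (lt_le_trans yh ms)) Dy (lt_le_trans yh mr) _.
rewrite [_ - y]addrAC subrr add0r => /(_ _) h1.
have -> : h * lin2 l v = lin2 l (h *: v).
  by rewrite /lin2 /= -[h *: v.1]/(h * v.1) -[h *: v.2]/(h * v.2); ring.
apply: le_trans (h1 _) _; first by lra.
by rewrite ler_wpM2l// ltW.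
Qed.

End PlaneCalculus.

(** * Exactness and area preservation *)

Section AreaPreserving.
Context {R : realType}.
Implicit Types (D : set (R * R)) (f : R * R -> R) (x v l : R * R).

Lemma differentiable_fst x : differentiable (fun y : R * R => y.1 : R) x.
Proof. by apply: linear_differentiable => y; exact: cvg_fst. Qed.

Lemma differentiable_comp1 (g : R * R -> R * R) x :
  differentiable g x -> differentiable (fun y => (g y).1 : R) x.
Proof. by move=> dg; apply: (differentiable_comp dg (differentiable_fst _)). Qed.

(** The difference of two translates is a function of one variable, to which the mean value theorem
applies; a second difference over a rectangle is obtained in this way in either direction. *)
Lemma MVT_diff f (df : R * R -> R) x y v (h : R) : 0 < h ->
  (forall t : R, 0 <= t <= h -> differentiable f (x + t *: v) /\
     'd f (x + t *: v) v = df (x + t *: v)) ->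
  (forall t : R, 0 <= t <= h -> differentiable f (y + t *: v) /\
     'd f (y + t *: v) v = df (y + t *: v)) ->
  exists2 t : R, 0 < t < h &
    (f (x + h *: v) - f (y + h *: v)) - (f x - f y) =
    h * (df (x + t *: v) - df (y + t *: v)).
Proof.
move=> h0 dx dy.
pose g (t : R) : R := f (x + t *: v) - f (y + t *: v).
have D (t : R) : 0 <= t <= h -> is_derive t (1 : R) g (df (x + t *: v) - df (y + t *: v)).
  move=> th; have [dx' <-] := dx t th; have [dy' <-] := dy t th.
  exact: (is_deriveB (is_derive_line dx') (is_derive_line dy')).
have [t|| t] := @MVT R g (fun t => df (x + t *: v) - df (y + t *: v)) 0 h h0.
- by rewrite in_itv /= => /andP[t1 t2]; apply: D; rewrite !ltW.
- apply: continuous_in_subspaceT => s; rewrite inE /= in_itv /= => sh.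
  have /derivable1_diffP/differentiable_continuous cs := @ex_derive _ _ _ _ _ _ _ (D s sh).
  exact: cs.
- rewrite in_itv /= => th; rewrite subr0 /g !scale0r !addr0 => E.
  by exists t => //; rewrite E mulrC.
Qed.

(** P dQ - p dq is exact, so that it has zero exterior derivative and dP /\ dQ = dp /\ dq. Without
second derivatives: W = T - P(x) Q is a primitive of (P - P(x)) dQ - p dq, its second difference over
a square of side h is computed by the mean value theorem in the two directions, and the two results
are h ^ 2 times expressions whose difference is the determinant minus one, up to o(1). *)
Lemma exact_det D (P Q T : R * R -> R) x lQ lP : box_open D -> D x ->
  strict_diff2 D Q x lQ -> strict_diff2 D P x lP ->
  (forall y, D y -> differentiable Q y) -> (forall y, D y -> differentiable T y) ->
  (forall y, D y -> forall v, P y * 'd Q y v - y.2 * v.1 = 'd T y v) ->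
  lQ.1 * lP.2 - lQ.2 * lP.1 = 1.
Proof.
move=> oD Dx sQ sP dQ dT E.
pose M : R := `|lP.1| + `|lP.2| + 2 * (`|lQ.1| + `|lQ.2|) + 2.
have M0 : 0 < M by rewrite ltr_wpDl// !addr_ge0// mulr_ge0// addr_ge0.
suff H eta : 0 < eta -> eta <= 1 -> `|lQ.1 * lP.2 - lQ.2 * lP.1 - 1| <= 4 * M * eta.
  apply/eqP; rewrite -subr_eq0 -normr_le0; apply/ler_addgt0Pl => d d0; rewrite addr0.
  apply: le_trans (H (Num.min 1 (d / (4 * M))) _ _) _.
  - by rewrite lt_min ltr01 divr_gt0// mulr_gt0.
  - by rewrite ge_min lexx.
  by rewrite mulrC -ler_pdivlMr ?mulr_gt0// ge_min lexx orbT.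
move=> eta0 eta1.
have [r1 r10 H1] := strict_diff2_partial oD Dx sQ dQ eta0.
have [r2 r20 H2] := sP _ eta0; have [r3 r30 H3] := oD x Dx.
have [m [m0 mr1 mr2 mr3]] : exists m : R, [/\ 0 < m, m <= r1, m <= r2 & m <= r3].
  exists (Num.min (Num.min r1 r2) r3).
  by rewrite !lt_min r10 r20 r30; split=> //; rewrite !ge_min lexx ?orbT.
have [h h0 mh] : exists2 h : R, 0 < h & m = 3 * h.
  exists (m / 3); first by rewrite divr_gt0.
  by field.
have [pt ptE] : exists pt : R -> R -> R * R, forall s t, pt s t = x + (s, t)
  by exists (fun s t => x + (s, t)).
have pt0 : pt 0 0 = x by rewrite ptE addr0.
have tp (s t : R) : 0 <= s <= h -> 0 <= t <= h -> taxi (pt s t - x) = s + t.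
  move=> /andP[s0 _] /andP[t0 _].
  by rewrite ptE [x + _]addrC addrK /taxi /= !ger0_norm.
have Dp s t : 0 <= s <= h -> 0 <= t <= h -> D (pt s t).
  by move=> sh th; apply: H3; rewrite tp//; lra.
have [dq dqE] : exists dq : R * R -> R * R -> R, forall y v, 'd Q y v = dq y v.
  by exists (fun y v => 'd Q y v).
(* W is a primitive of (P - P(x)) dQ - p dq *)
have [W dW] : exists W : R * R -> R, forall y, D y -> forall v,
    differentiable W y /\ 'd W y v = (P y - P x) * dq y v - y.2 * v.1.
  have dPQ y : D y -> differentiable (P x *: Q) y.
    by move=> Dy; exact: (differentiableZ _ (dQ y Dy)).
  exists (T - P x *: Q) => y Dy v; split; first exact: (differentiableB (dT y Dy) (dPQ y Dy)).
  rewrite (diffB (dT y Dy) (dPQ y Dy)) (diffZ _ (dQ y Dy)).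
  rewrite -[LHS]/('d T y v - P x * 'd Q y v) -(E y Dy v) dqE; ring.
pose e1 : R * R := (1, 0); pose e2 : R * R := (0, 1).
have pe1 (s t u : R) : pt s t + u *: e1 = pt (s + u) t.
  rewrite !ptE -addrA; congr (_ + _); rewrite /e1; congr pair => /=.
  - by rewrite -[u%:A]/(u * 1) mulr1.
  - by rewrite -[u *: 0]/(u * 0) mulr0 addr0.
have pe2 (s t u : R) : pt s t + u *: e2 = pt s (t + u).
  rewrite !ptE -addrA; congr (_ + _); rewrite /e2; congr pair => /=.
  - by rewrite -[u *: 0]/(u * 0) mulr0 addr0.
  - by rewrite -[u%:A]/(u * 1) mulr1.
have hh : 0 <= h <= h by rewrite (ltW h0) /=.
have zh : 0 <= (0 : R) <= h by apply/andP; split; [exact: lexx|exact: ltW].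
have estP (a b : R) : 0 <= a <= h -> 0 <= b <= h ->
    `|P (pt a b) - P x - (lP.1 * a + lP.2 * b)| <= eta * (2 * h).
  move=> ah bh; have tab := tp a b ah bh.
  have := H2 (pt a b) x (Dp _ _ ah bh) Dx.
  rewrite tab subrr [taxi 0]/taxi /= normr0 addr0.
  have -> : lin2 lP (pt a b - x) = lP.1 * a + lP.2 * b.
    by rewrite ptE [x + _]addrC addrK.
  move=> H; apply: le_trans (H _ _) _; [lra|lra|].
  by rewrite ler_wpM2l ?(ltW eta0)//; lra.
have est (a b c k : R) : 0 <= a <= h -> 0 <= b <= h -> `|c - k| <= eta ->
    `|k| <= `|lQ.1| + `|lQ.2| ->
    `|(P (pt a b) - P x) * c - (lP.1 * a + lP.2 * b) * k| <= M * eta * h.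
  move=> ah bh ck k1; have := estP a b ah bh.
  set p := P (pt a b) - P x; set q := lP.1 * a + lP.2 * b => pq.
  have q0 : `|q| <= (`|lP.1| + `|lP.2|) * h.
    rewrite (le_trans (ler_normD _ _))// !normrM mulrDl.
    case/andP: ah => a0 ah; case/andP: bh => b0 bh.
    by rewrite (ger0_norm a0) (ger0_norm b0) lerD// ler_wpM2l.
  have -> : p * c - q * k = q * (c - k) + (p - q) * k + (p - q) * (c - k) by ring.
  rewrite (le_trans (ler_normD _ _))// (le_trans (lerD (ler_normD _ _) (lexx _)))//.
  rewrite !normrM.
  have i1 : `|q| * `|c - k| <= (`|lP.1| + `|lP.2|) * h * eta by exact: ler_pM.
  have i2 : `|p - q| * `|k| <= eta * (2 * h) * (`|lQ.1| + `|lQ.2|) by exact: ler_pM.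
  have i3 : `|p - q| * `|c - k| <= eta * (2 * h) * 1.
    by apply: ler_pM => //; exact: le_trans eta1.
  rewrite /M; lra.
have c1 (a b : R) : 0 <= a <= h -> 0 <= b <= h -> `|dq (pt a b) e1 - lQ.1| <= eta.
  move=> ah bh; have := H1 (pt a b) _ e1 _; rewrite dqE tp// /lin2 /taxi /= normr1 normr0.
  by rewrite mulr1 mulr0 !addr0 lexx; apply=> //; lra.
have c2 (a b : R) : 0 <= a <= h -> 0 <= b <= h -> `|dq (pt a b) e2 - lQ.2| <= eta.
  move=> ah bh; have := H1 (pt a b) _ e2 _; rewrite dqE tp// /lin2 /taxi /= normr1 normr0.
  by rewrite mulr1 mulr0 !add0r lexx; apply=> //; lra.
have k1 : `|lQ.1| <= `|lQ.1| + `|lQ.2| by rewrite lerDl.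
have k2 : `|lQ.2| <= `|lQ.1| + `|lQ.2| by rewrite lerDr.
have [t th Eu] : exists2 t : R, 0 < t < h &
    (W (pt h h) - W (pt h 0)) - (W (pt 0 h) - W (pt 0 0)) =
    h * ((P (pt t h) - P x) * dq (pt t h) e1 - (pt t h).2 * e1.1 -
      ((P (pt t 0) - P x) * dq (pt t 0) e1 - (pt t 0).2 * e1.1)).
  have [||t th] := @MVT_diff W (fun y => (P y - P x) * dq y e1 - y.2 * e1.1) (pt 0 h) (pt 0 0) e1 h h0.
  - by move=> u uh; rewrite pe1 add0r; apply/(dW _ _)/Dp.
  - by move=> u uh; rewrite pe1 add0r; apply/(dW _ _)/Dp.
  by rewrite !pe1 !add0r => eqW; exists t.
have [s sh Ev] : exists2 s : R, 0 < s < h &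
    (W (pt h h) - W (pt 0 h)) - (W (pt h 0) - W (pt 0 0)) =
    h * ((P (pt h s) - P x) * dq (pt h s) e2 - (pt h s).2 * e2.1 -
      ((P (pt 0 s) - P x) * dq (pt 0 s) e2 - (pt 0 s).2 * e2.1)).
  have [||s sh] := @MVT_diff W (fun y => (P y - P x) * dq y e2 - y.2 * e2.1) (pt h 0) (pt 0 0) e2 h h0.
  - by move=> u uh; rewrite pe2 add0r; apply/(dW _ _)/Dp.
  - by move=> u uh; rewrite pe2 add0r; apply/(dW _ _)/Dp.
  by rewrite !pe2 !add0r => eqW; exists s.
have th' : 0 <= t <= h by case/andP: th => *; rewrite !ltW.
have sh' : 0 <= s <= h by case/andP: sh => *; rewrite !ltW.
have := est t h _ _ th' hh (c1 t h th' hh) k1.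
have := est t 0 _ _ th' zh (c1 t 0 th' zh) k1.
have := est h s _ _ hh sh' (c2 h s hh sh') k2.
have := est 0 s _ _ zh sh' (c2 0 s zh sh') k2.
have swap (i j k l : R) : i - j - (k - l) = i - k - (j - l) by ring.
rewrite swap Ev in Eu; have {Eu Ev} eqU := mulfI (lt0r_neq0 h0) Eu.
have pth : (pt t h).2 = (pt t 0).2 + h by rewrite !ptE /= addr0.
rewrite pth -[e1.1]/(1 : R) -[e2.1]/(0 : R) in eqU.
rewrite !ler_norml => /andP[? ?] /andP[? ?] /andP[? ?] /andP[? ?].
by apply/andP; split; rewrite -(ler_pM2r h0); lra.
Qed.

End AreaPreserving.

(** * Fibers of the annulus and the twist condition *)

Section ExtendedRealEnds.
Context {R : realType}.
Implicit Types (x : \bar R) (V : set (\bar R)) (p M : R).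

(** Turns neighborhoods of a boundary value, finite or infinite, into a real threshold. *)
Lemma ereal_nbhs_right x V p0 : (x < p0%:E)%E -> nbhs x V ->
  exists M, [/\ (x < M%:E)%E, M < p0 & forall p, (x < p%:E)%E -> p <= M -> V p%:E].
Proof.
case: x => [r| |] //.
- rewrite lte_fin => rp0 nV.
  have /nbhs_ballP[d /= d0 dV] : nbhs r (fun s => V s%:E) := nV.
  have [d1 [d10 d1d d1p]] : exists d1 : R, [/\ 0 < d1, d1 < d & d1 < p0 - r].
    exists (Num.min d (p0 - r) / 2).
    have m0 : 0 < Num.min d (p0 - r) by rewrite lt_min d0 subr_gt0.
    have : Num.min d (p0 - r) <= d /\ Num.min d (p0 - r) <= p0 - r.
      by rewrite !ge_min !lexx orbT.
    by move=> [? ?]; split; lra.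
  exists (r + d1); split; rewrite ?lte_fin; [lra|lra|move=> p].
  rewrite lte_fin => rp pM; apply: dV; rewrite -ball_normE /ball_ /= ltr_distl; lra.
- move=> _ [M0 [_ MV]]; exists (Num.min (M0 - 1) (p0 - 1)).
  have : Num.min (M0 - 1) (p0 - 1) <= M0 - 1 /\ Num.min (M0 - 1) (p0 - 1) <= p0 - 1.
    by rewrite !ge_min !lexx orbT.
  move=> [? ?]; split; rewrite ?ltNyr//; first by lra.
  by move=> p _ pM; apply: MV; rewrite lte_fin; lra.
Qed.

Lemma ereal_nbhs_left x V p0 : (p0%:E < x)%E -> nbhs x V ->
  exists M, [/\ (M%:E < x)%E, p0 < M & forall p, (p%:E < x)%E -> M <= p -> V p%:E].
Proof.
case: x => [r| |] //.
- rewrite lte_fin => rp0 nV.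
  have /nbhs_ballP[d /= d0 dV] : nbhs r (fun s => V s%:E) := nV.
  have [d1 [d10 d1d d1p]] : exists d1 : R, [/\ 0 < d1, d1 < d & d1 < r - p0].
    exists (Num.min d (r - p0) / 2).
    have m0 : 0 < Num.min d (r - p0) by rewrite lt_min d0 subr_gt0.
    have : Num.min d (r - p0) <= d /\ Num.min d (r - p0) <= r - p0.
      by rewrite !ge_min !lexx orbT.
    by move=> [? ?]; split; lra.
  exists (r - d1); split; rewrite ?lte_fin; [lra|lra|move=> p].
  rewrite lte_fin => rp pM; apply: dV; rewrite -ball_normE /ball_ /= ltr_distl; lra.
- move=> _ [M0 [_ MV]]; exists (Num.max (M0 + 1) (p0 + 1)).
  have : M0 + 1 <= Num.max (M0 + 1) (p0 + 1) /\ p0 + 1 <= Num.max (M0 + 1) (p0 + 1).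
    by rewrite !le_max !lexx orbT.
  move=> [? ?]; split; rewrite ?ltry//; first by lra.
  by move=> p _ pM; apply: MV; rewrite lte_fin; lra.
Qed.

Lemma nbhs_slice (T : topologicalType) (U : set (R * T)) q (x : T) :
  nbhs (q, x) U -> nbhs x (fun e => U (q, e)).
Proof.
move=> [[U1 U2] /= [h1 h2] h]; apply: filterS h2 => e U2e.
by apply: (h (q, e)); split => //=; exact: nbhs_singleton.
Qed.

Lemma fiber_nonempty (pm pp : R -> \bar R) q : (pm q < pp q)%E -> exists p, fiber pm pp q p.
Proof.
rewrite /fiber /=; case: (pm q) => [r| |]; case: (pp q) => [s| |] //.
- by rewrite lte_fin => rs; exists ((r + s) / 2); rewrite !lte_fin; apply/andP; split; lra.
- by move=> _; exists (r + 1); rewrite lte_fin ltry ltrDl ltr01.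
- by move=> _; exists (s - 1); rewrite lte_fin ltNyr ltrBlDr ltrDl ltr01.
- by move=> _; exists 0; rewrite ltNyr ltry.
Qed.

Lemma fiber_between (pm pp : R -> \bar R) q p1 p2 p : fiber pm pp q p1 -> fiber pm pp q p2 ->
  p1 <= p <= p2 -> fiber pm pp q p.
Proof.
rewrite /fiber /= => /andP[h1 _] /andP[_ h2] /andP[p1p pp2].
by rewrite (lt_le_trans h1) ?lee_fin// (le_lt_trans _ h2) ?lee_fin.
Qed.

End ExtendedRealEnds.

Section FixedTwist.
Context {R : realType}.
Variables (pm pp : R -> \bar R) (F : R * R -> R * R) (alpha : R).
Hypotheses (tw : exact_symplectic_twist_map pm pp F).
Let A := annulus pm pp.
Hypothesis oA : box_open A.
Hypothesis ti : twist_interval pm pp F alpha.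

Lemma twist_differentiable x : A x -> differentiable F x.
Proof. by move=> Ax; case: (twist_diffeo tw) => _ /(_ 1%N)[+ _] _; exact. Qed.

Lemma twist_mem x : A x -> A (F x).
Proof. by case: (twist_diffeo tw) => -[+ _ _] _ _; exact. Qed.

Lemma twist_inj x y : A x -> A y -> F x = F y -> x = y.
Proof.
by case: (twist_diffeo tw) => -[_ + _] _ _ Ax Ay; apply; rewrite inE.
Qed.

Lemma twist_det x l1 l2 : A x -> strict_diff2 A (fun y => (F y).1) x l1 ->
  strict_diff2 A (fun y => (F y).2) x l2 -> l1.1 * l2.2 - l1.2 * l2.1 = 1.
Proof.
move=> Ax s1 s2; have [D [S [[oD DA] _ Ssm _ HS]]] := twist_generating tw.
have dT y : A y -> differentiable (fun y : R * R => S (y.1, (F y).1)) y.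
  move=> Ay; have [dS _] := Ssm 1%N.
  apply: (@differentiable_comp _ _ _ _ (fun y : R * R => (y.1, (F y).1)) S).
    apply: differentiable_pair; first exact: differentiable_fst.
    exact/differentiable_comp1/twist_differentiable.
  exact/dS/DA.
apply: (exact_det oA Ax s1 s2 _ dT) => [y Ay|y Ay v].
  exact/differentiable_comp1/twist_differentiable.
by rewrite (HS y Ay v).
Qed.

Lemma twist_cont_fiber q p : fiber pm pp q p -> {for p, continuous (fun p => (F (q, p)).1)}.
Proof.
move=> qp; have dF : differentiable F (q, p) by exact: twist_differentiable.
have c1 : (fun p => (q, p)) @ p --> (q, p) by move=> U; exact: nbhs_slice.
have c2 := cvg_comp _ _ c1 (differentiable_continuous (differentiable_comp1 dF)).
exact: c2.
Qed.

(** On a fiber the map is injective and continuous, hence monotone. The twist interval decides the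
direction: the displacement is at most alpha near the bottom and at least alpha near the top. *)
Lemma twist_mono q p p' : fiber pm pp q p -> fiber pm pp q p' -> p < p' ->
  (F (q, p)).1 < (F (q, p')).1.
Proof.
move=> qp qp' pp'; have [Um [Up [nUm nUp HU]]] := ti.
have [b [b1 b2 b3]] : exists M, [/\ (pm q < M%:E)%E, M < p &
    forall p, (pm q < p%:E)%E -> p <= M -> Um (q, p%:E)].
  apply: (@ereal_nbhs_right _ (pm q) (fun e => Um (q, e)) p); first by case/andP: qp.
  exact: nbhs_slice (nUm (q, pm q) erefl).
have [t [t1 t2 t3]] : exists M, [/\ (M%:E < pp q)%E, p' < M &
    forall p, (p%:E < pp q)%E -> M <= p -> Up (q, p%:E)].
  apply: (@ereal_nbhs_left _ (pp q) (fun e => Up (q, e)) p'); first by case/andP: qp'.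
  exact: nbhs_slice (nUp (q, pp q) erefl).
have fb : fiber pm pp q b.
  by rewrite /fiber /= b1 /= (lt_trans _ (proj2 (andP qp)))// lte_fin.
have ft : fiber pm pp q t.
  by rewrite /fiber /= t1 andbT (lt_trans (proj1 (andP qp')))// lte_fin.
have fbt r : r \in `[b, t] -> fiber pm pp q r.
  by rewrite in_itv /=; exact: fiber_between.
have ctf : {within `[b, t], continuous (fun p => (F (q, p)).1)}.
  by apply: continuous_in_subspaceT => r /set_mem; rewrite /= => /fbt; exact: twist_cont_fiber.
have inj : {in `[b, t] &, injective (fun p => (F (q, p)).1)}.
  move=> r s /fbt fr /fbt fs; case: (twist_fiber tw q) => -[_ + _] _ _.
  by apply; rewrite inE.
have bt : b < t by rewrite (lt_trans b2)// (lt_trans pp').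
have bI : b \in `[b, t] by rewrite in_itv /= lexx ltW.
have tI : t \in `[b, t] by rewrite in_itv /= lexx andbT ltW.
have [up|down] := itv_continuous_inj_mono ctf inj.
  by apply: up => //; rewrite in_itv /= !ltW// ?(lt_trans b2)// (lt_trans pp').
have := down _ _ tI bI bt; have [+ _] := HU (q, b) fb; have [_ +] := HU (q, t) ft.
rewrite /einj /= => /(_ (t3 t t1 (lexx _))) ? /(_ (b3 b b1 (lexx _))) ? ?; lra.
Qed.

(** The inverse on the fiber is differentiable, so the partial derivative is not zero; it is not
negative since the map increases on fibers. *)
Lemma twist_partial_gt0 x l : A x -> strict_diff2 A (fun y => (F y).1) x l -> 0 < l.2.
Proof.
case: x => q p Ax sl; have dF : differentiable (fun y => (F y).1 : R) (q, p).
  exact/differentiable_comp1/twist_differentiable.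
have pE r : (q, r) = (q, 0) + r *: (0, 1) :> R * R.
  by congr pair => /=; rewrite -?[_ *: _]/(r * _) ?mulr0 ?mulr1 ?addr0 ?add0r.
have dl : 'd (fun y => (F y).1 : R) (q, p) (0, 1) = l.2.
  apply/eqP; rewrite -subr_eq0 -normr_le0; apply/ler_addgt0Pl => e e0; rewrite addr0.
  have dF' y : A y -> differentiable (fun y => (F y).1 : R) y.
    by move=> Ay; exact/differentiable_comp1/twist_differentiable.
  have [r r0 /(_ (q, p))] := strict_diff2_partial oA Ax sl dF' e0.
  rewrite subrr [taxi 0]/taxi /= normr0 addr0 => /(_ r0 (0, 1)).
  by rewrite /taxi /lin2 /= normr0 normr1 add0r mulr0 mulr1 add0r; apply.
have dh : is_derive p (1 : R) (fun r => (F (q, r)).1) l.2.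
  have := @is_derive_line _ (fun y => (F y).1 : R) (q, 0) (0, 1) p.
  rewrite -pE dl => /(_ dF) h.
  by rewrite (_ : (fun r => _) = (fun s : R => (F ((q, 0) + s *: (0, 1))).1))//;
    apply/funext => r; rewrite -pE.
have l0 : l.2 != 0.
  have [_ _ [g gK /(_ 1%N)[dg _]]] := twist_fiber tw q.
  have /derivable1_diffP dgp : differentiable g (F (q, p)).1 by apply: dg; exists p.
  have E : 'D_1 (g \o (fun r => (F (q, r)).1)) p = 1.
    rewrite -[RHS](derive_id p (1 : R)); apply: near_eq_derive.
    have [r r0 Hr] := oA Ax; near=> s.
    rewrite /= gK// inE; apply: (Hr (q, s)).
    rewrite /taxi /= subrr normr0 add0r distrC; near: s.
    by exists r => //= t; rewrite /ball /=.
  have := @derive1_comp _ (fun r => (F (q, r)).1) g p (@ex_derive _ _ _ _ _ _ _ dh) dgp.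
  rewrite !derive1E E (@derive_val _ _ _ _ _ _ _ dh).
  by apply: contra_eq_neq => ->; rewrite mulr0 oner_neq0.
rewrite lt_neqAle eq_sym l0 /= leNgt; apply/negP => ln.
have [|r r0 Hr] := sl (- l.2); first by rewrite oppr_gt0.
have [s s0 Hs] := oA Ax.
pose t := Num.min r s / 2.
have m0 : 0 < Num.min r s by rewrite lt_min r0.
have [tr ts t0] : [/\ t < r, t < s & 0 < t].
  have : Num.min r s <= r /\ Num.min r s <= s by rewrite !ge_min !lexx orbT.
  by rewrite /t => -[? ?]; split; lra.
have tE : taxi ((q, p + t) - (q, p)) = t.
  by rewrite /taxi /= subrr normr0 add0r addrAC subrr add0r gtr0_norm.
have At : A (q, p + t) by apply: Hs; rewrite tE.
have := twist_mono Ax At; rewrite ltrDl => /(_ t0).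
have := Hr (q, p + t) (q, p) At Ax; rewrite tE => /(_ tr).
rewrite [taxi (_ - _)]/taxi /lin2 /= !subrr !normr0 addr0 => /(_ r0).
rewrite mulr0 add0r (addrAC p) subrr add0r ler_norml => /andP[_]; lra.
Unshelve. all: by end_near.
Qed.

End FixedTwist.

(** * Curves are crossed in one direction *)

Section Orientation.
Context {R : realType}.
Variables (A : set (R * R)) (F : R * R -> R * R).
Hypothesis oA : box_open A.
Hypothesis convA : forall q p1 p2 p : R, A (q, p1) -> A (q, p2) -> p1 <= p <= p2 -> A (q, p).
Hypothesis injF : forall x y, A x -> A y -> F x = F y -> x = y.
Hypothesis twF : forall x, A x -> exists l1 l2,
  [/\ strict_diff2 A (fun y => (F y).1) x l1, strict_diff2 A (fun y => (F y).2) x l2,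
      0 < l1.2 & l1.1 * l2.2 - l1.2 * l2.1 = 1].

Lemma strict_diff2_fiber_cont f q p l : A (q, p) -> strict_diff2 A f (q, p) l ->
  {for p, continuous (fun p => f (q, p))}.
Proof.
move=> Aqp sf; apply/cvgrPdist_le => e e0.
have [r r0 Hr] := sf _ ltr01; have [s s0 Hs] := oA Aqp.
pose K := `|l.2| + 1; have K0 : 0 < K by rewrite ltr_wpDl.
have near_lt (d : R) : 0 < d -> \forall t \near p, `|p - t| < d.
  by move=> d0; exists d => //= t; rewrite /ball /=.
near=> p'.
have tE : taxi ((q, p) - (q, p')) = `|p - p'| by rewrite /taxi /= subrr normr0 add0r.
have tE' : taxi ((q, p') - (q, p)) = `|p - p'|.
  by rewrite /taxi /= subrr normr0 add0r distrC.
have Ap' : A (q, p') by apply: Hs; rewrite tE'; near: p'; exact: near_lt.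
have pr : `|p - p'| < r by near: p'; exact: near_lt.
have pe : `|p - p'| < e / K by near: p'; apply: near_lt; rewrite divr_gt0.
have := Hr _ _ Aqp Ap'; rewrite tE tE' mul1r subrr [taxi 0]/taxi /= normr0 addr0.
move=> /(_ r0 pr); rewrite /lin2 /= subrr mulr0 add0r => h.
rewrite -[X in `|X|](subrK (l.2 * (p - p'))) (le_trans (ler_normD _ _))//.
move: pe; rewrite ltr_pdivlMr// /K mulrDr mulr1 normrM; lra.
Unshelve. all: by end_near.
Qed.

Section graph.
Variables (c c' f : R -> R) (mu M : R).
Hypotheses (Ac : forall q, A (q, c q)) (Fc : forall q, F (q, c q) = (f q, c' (f q))).
Hypothesis f_onto : forall Q, exists q, f q = Q.
Hypothesis f_mono : {homo f : x y / x < y}.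
Hypotheses (mu0 : 0 < mu) (M0 : 0 < M).
Hypothesis f_bilip : forall q1 q2, mu * `|q1 - q2| <= `|f q1 - f q2| <= M * `|q1 - q2|.
Hypothesis c_lip : forall q, exists L d : R, [/\ 0 <= L, 0 < d &
  forall q', `|q' - q| < d -> `|c q' - c q| <= L * `|q' - q|].
Hypothesis c'_cont : continuous c'.

(** The curve c is mapped onto the curve c', and a point just above c has the same first image
coordinate as a point of c slightly to the right, by the twist. The determinant being one, the image
is above c' by about (q' - q) / l1.2, where q' is the abscissa of that point. *)
Lemma orientation_local q : exists2 d : R, 0 < d & forall h : R, h != 0 -> `|h| < d ->
  A (q, c q + h) /\ 0 < h * ((F (q, c q + h)).2 - c' (F (q, c q + h)).1).
Proof.
have [l1 [l2 [s1 s2 l12 det]]] := twF (Ac q).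
have [L [dc [L0 dc0 Lc]]] := c_lip q.
have [ro ro0 Ho] := oA (Ac q).
pose K : R := l1.2 + l1.2 / 2; have K0 : 0 < K by rewrite /K; lra.
pose C1 : R := (1 + L) * (K / mu) + 1.
have Kmu : 0 < K / mu by rewrite divr_gt0.
have C10 : 0 < C1 by rewrite ltr_wpDl// mulr_ge0 ?(ltW Kmu)//; lra.
pose B : R := (`|l2.2| + l1.2) * C1.
have B0 : 0 < B by rewrite mulr_gt0// ltr_wpDl.
pose eta := Num.min (l1.2 / 2) (l1.2 / 2 / M / 2 / B).
have eta0 : 0 < eta by rewrite lt_min !divr_gt0.
have [eta1 eta2] : eta <= l1.2 / 2 /\ eta * B <= l1.2 / 2 / M / 2.
  by rewrite -ler_pdivlMr// !ge_min !lexx orbT.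
have [r1 r10 H1] := s1 _ eta0; have [r2 r20 H2] := s2 _ eta0.
pose r := Num.min (Num.min r1 r2) (Num.min ro dc).
have r0 : 0 < r by rewrite !lt_min r10 r20 ro0.
have [rr1 rr2 rro rdc] : [/\ r <= r1, r <= r2, r <= ro & r <= dc].
  by rewrite !ge_min !lexx !orbT.
exists (r / C1) => [|h h0]; first by rewrite divr_gt0.
rewrite ltr_pdivlMr// => hr.
have hpos : 0 < `|h| by rewrite normr_gt0.
have C11 : `|h| <= `|h| * C1 by rewrite ler_peMr// lerDr mulr_ge0 ?(ltW Kmu)//; lra.
set xh := (q, c q + h).
have xhE : xh - (q, c q) = (0, h) by congr pair => /=; ring.
have txh : taxi (xh - (q, c q)) = `|h| by rewrite xhE /taxi /= normr0 add0r.
have Axh : A xh by apply: Ho; rewrite txh; lra.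
split=> //.
have [q' fq'] := f_onto (F xh).1.
(* (q', c q') is the point of the curve with the same first image coordinate as xh *)
pose a := q' - q; pose b := h - (c q' - c q).
have Fq1 : (F (q, c q)).1 = f q by rewrite Fc.
have hQ : `|f q' - f q - l1.2 * h| <= eta * `|h|.
  have := H1 xh (q, c q) Axh (Ac q); rewrite txh subrr [taxi 0]/taxi /= normr0 addr0.
  rewrite fq' -Fq1 xhE /lin2 /= mulr0 add0r.
  by apply=> //; lra.
have := f_bilip q' q; rewrite -/a => /andP[mua Ma].
have fK : `|f q' - f q| <= K * `|h|.
  rewrite -[X in `|X|](subrK (l1.2 * h)) (le_trans (ler_normD _ _))//.
  rewrite normrM (gtr0_norm l12) /K mulrDl addrC lerD2l (le_trans hQ)//.
  by rewrite ler_wpM2r.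
have fl : l1.2 / 2 * `|h| <= `|f q' - f q|.
  have : `|l1.2 * h| <= `|f q' - f q| + eta * `|h|.
    rewrite -[X in `|X| <= _](subrK (f q' - f q)) addrC (le_trans (ler_normD _ _))//.
    by rewrite lerD2l distrC.
  rewrite normrM (gtr0_norm l12).
  have : eta * `|h| <= l1.2 / 2 * `|h| by rewrite ler_wpM2r.
  lra.
have aK : `|a| <= K / mu * `|h|.
  by rewrite mulrAC ler_pdivlMr// mulrC (le_trans mua).
have al : l1.2 / 2 / M * `|h| <= `|a|.
  rewrite -(ler_pM2l M0) (_ : M * _ = l1.2 / 2 * `|h|); first exact: le_trans Ma.
  by field; exact: lt0r_neq0.
have aC : (1 + L) * `|a| + `|h| <= C1 * `|h|.
  have -> : C1 * `|h| = (1 + L) * (K / mu * `|h|) + `|h| by rewrite /C1; ring.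
  by rewrite lerD2r ler_wpM2l//; lra.
have La : 0 <= L * `|a| by rewrite mulr_ge0.
have ar : `|a| < dc by move: aC hr; rewrite mulrDl mul1r mulrC; lra.
have cL := Lc _ ar; rewrite -/a in cL.
have bC : `|a| + `|b| <= C1 * `|h|.
  have : `|b| <= `|h| + L * `|a| by rewrite (le_trans (ler_normB _ _))// lerD2l.
  move: aC; rewrite mulrDl mul1r; lra.
have ay : taxi ((q', c q') - (q, c q)) < r.
  rewrite /taxi /= -/a; move: aC hr; rewrite mulrDl mul1r mulrC; lra.
have xyE : xh - (q', c q') = (- a, b) by congr pair => /=; rewrite /a /b; ring.
have txy : taxi (xh - (q', c q')) = `|a| + `|b| by rewrite xyE /taxi /= normrN.
have Fq' : F (q', c q') = ((F xh).1, c' (F xh).1) by rewrite Fc fq'.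
have e1 := H1 xh (q', c q') Axh (Ac q'); rewrite txh txy xyE Fq' /lin2 /= in e1.
have e2 := H2 xh (q', c q') Axh (Ac q'); rewrite txh txy xyE Fq' /lin2 /= in e2.
have {}e1 : `|l1.1 * (- a) + l1.2 * b| <= eta * (C1 * `|h|).
  move: e1; rewrite subrr sub0r normrN => e1.
  by apply: le_trans (e1 _ _) _; [lra|lra|rewrite ler_wpM2l// ltW].
set D := (F xh).2 - _.
have {}e2 : `|D - (l2.1 * (- a) + l2.2 * b)| <= eta * (C1 * `|h|).
  by apply: le_trans (e2 _ _) _; [lra|lra|rewrite ler_wpM2l// ltW].
have ah : 0 < a * h.
  have fh : 0 < (f q' - f q) * h.
    have Lh : eta * `|h| * `|h| <= l1.2 / 2 * `|h| * `|h| by rewrite !ler_wpM2r.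
    have : `|(f q' - f q - l1.2 * h) * h| <= eta * `|h| * `|h| by rewrite normrM ler_wpM2r.
    have hh : 0 < `|h| * `|h| by rewrite mulr_gt0.
    have hhE : `|h| * `|h| = h * h by rewrite -normrM ger0_norm// -expr2 sqr_ge0.
    rewrite ler_norml -!mulrA hhE => /andP[+ _]; move: Lh hh; rewrite -!mulrA hhE; nra.
  rewrite /a; case: (ltgtP q q') => [qq'|qq'|qq'].
  - have fp : 0 < f q' - f q by rewrite subr_gt0; exact: f_mono.
    by rewrite mulr_gt0 ?subr_gt0// -(pmulr_rgt0 _ fp).
  - have fp : f q' - f q < 0 by rewrite subr_lt0; exact: f_mono.
    by rewrite nmulr_rgt0 ?subr_lt0// -(nmulr_rgt0 _ fp).
  - by move: fh; rewrite qq' subrr mul0r ltxx.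
have key : l1.2 * D - a = l2.2 * (l1.1 * (- a) + l1.2 * b) + l1.2 * (D - (l2.1 * (- a) + l2.2 * b)).
  have aE : a * (l1.1 * l2.2 - l1.2 * l2.1) = a by rewrite det mulr1.
  by rewrite -[X in _ - X = _]aE; ring.
have small : `|l1.2 * D - a| < `|a|.
  rewrite key (le_lt_trans (ler_normD _ _))// !normrM (gtr0_norm l12).
  have q1 : `|l2.2| * `|l1.1 * (- a) + l1.2 * b| <= `|l2.2| * (eta * (C1 * `|h|)).
    by rewrite ler_wpM2l.
  have q2 : l1.2 * `|D - (l2.1 * (- a) + l2.2 * b)| <= l1.2 * (eta * (C1 * `|h|)).
    by rewrite ler_wpM2l// ltW.
  apply: (@le_lt_trans _ _ (eta * B * `|h|)); first by rewrite /B; lra.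
  apply: lt_le_trans al; rewrite ltr_pM2r//; apply: (le_lt_trans eta2).
  by rewrite ltr_pdivrMr// ltr_pMr ?ltr1n// divr_gt0// divr_gt0.
have a0 : a != 0 by apply: contraTneq ah => ->; rewrite mul0r ltxx.
have aD : 0 < a * D.
  have : `|(l1.2 * D - a) * a| < `|a| * `|a| by rewrite normrM ltr_pM2r// normr_gt0.
  rewrite -normrM ltr_norml => /andP[+ _].
  rewrite (ger0_norm (_ : 0 <= a * a)) -?expr2 ?sqr_ge0// => h1.
  by rewrite -(pmulr_rgt0 _ l12); move: h1; lra.
rewrite -(pmulr_rgt0 _ ah) (_ : a * h * (h * D) = (h * h) * (a * D)); last by ring.
by rewrite mulr_gt0// -expr2 exprn_even_gt0.
Qed.

(** The sign is known near the curve by [orientation_local], and along the fiber it cannot change: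
a point outside c with image on c' would contradict injectivity. *)
Lemma orientation q p : A (q, p) -> p != c q ->
  0 < (p - c q) * ((F (q, p)).2 - c' (F (q, p)).1).
Proof.
move=> Aqp pc; set h := p - c q; have h0 : h != 0 by rewrite subr_eq0.
have [d d0 loc] := orientation_local q.
pose pt s := c q + s * h.
have As s : 0 <= s <= 1 -> A (q, pt s).
  move=> /andP[s0 s1]; have [hp|hn] := ltP 0 h.
    apply: (convA (Ac q) Aqp); rewrite /pt lerDl mulr_ge0 ?(ltW hp)//=.
    have : s * h <= h by rewrite ler_piMl// ltW.
    by rewrite /h; lra.
  apply: (convA Aqp (Ac q)); rewrite /pt gerDl mulr_ge0_le0// andbT.
  have : h <= s * h by rewrite ler_niMl.
  by rewrite /h; lra.
pose g s := (F (q, pt s)).2 - c' (F (q, pt s)).1.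
have gc s : 0 <= s <= 1 -> {for s, continuous g}.
  move=> s01; have [l1 [l2 [s1 s2 _ _]]] := twF (As s s01).
  have cp : {for s, continuous pt}.
    apply: cvgD; first exact: cvg_cst.
    by apply: cvgM; [exact: cvg_id|exact: cvg_cst].
  have c1 := cvg_comp _ _ cp (strict_diff2_fiber_cont (As s s01) s1).
  have c2 := cvg_comp _ _ cp (strict_diff2_fiber_cont (As s s01) s2).
  apply: cvgB; first exact: c2.
  exact: (cvg_comp _ _ c1 (@c'_cont _)).
have gn s : 0 < s <= 1 -> g s != 0.
  move=> /andP[s0 s1]; apply/negP; rewrite subr_eq0 => /eqP E.
  have As' : A (q, pt s) by apply: As; rewrite ltW.
  have [q' fq'] := f_onto (F (q, pt s)).1.
  have : F (q, pt s) = F (q', c q').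
    by rewrite Fc fq' -E; case: (F (q, pt s)).
  move/(injF As' (Ac q')) => [<- /eqP].
  by rewrite /pt -subr_eq0 addrAC subrr add0r mulf_eq0 (negbTE h0) orbF gt_eqF.
pose s0 := Num.min 1 (d / 2 / `|h|).
have hp : 0 < `|h| by rewrite normr_gt0.
have s00 : 0 < s0 by rewrite lt_min ltr01 !divr_gt0.
have s01 : s0 <= 1 by rewrite ge_min lexx.
have s0h : `|s0 * h| < d.
  rewrite normrM (gtr0_norm s00).
  have : s0 <= d / 2 / `|h| by rewrite ge_min lexx orbT.
  by rewrite ler_pdivlMr// => /le_lt_trans; apply; lra.
have [_ g0] := loc (s0 * h) (mulf_neq0 (lt0r_neq0 s00) h0) s0h.
rewrite -/(pt s0) -/(g s0) -mulrA pmulr_rgt0// in g0.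
have -> : (F (q, p)).2 - c' (F (q, p)).1 = g 1.
  have pt1 : pt 1 = p by rewrite /pt mul1r /h addrC subrK.
  by rewrite /g pt1.
rewrite ltNge; apply/negP => g1.
have [||s] := @IVT R g s0 1 0 s01.
- by apply: continuous_in_subspaceT => s /set_mem; rewrite /= in_itv /= => /andP[s0s s1];
    apply: gc; rewrite s1 (le_trans (ltW s00)).
- have [hpos|hneg] := ltP 0 h.
    rewrite pmulr_rgt0// in g0; rewrite pmulr_rle0// in g1.
    by rewrite ge_min g1 orbT le_max ltW.
  have {}hneg : h < 0 by rewrite lt_neqAle h0.
  rewrite nmulr_rgt0// in g0; rewrite nmulr_rle0// in g1.
  by rewrite ge_min (ltW g0) le_max g1 orbT.
rewrite in_itv /= => /andP[s0s s1] gs0.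
by have := gn s; rewrite gs0 eqxx s1 (lt_le_trans s00)// => /(_ isT).
Qed.

End graph.
End Orientation.

(** * Slopes, Lipschitz bounds and compactness of a segment *)

Section Slope.
Context {R : realType}.
Implicit Types (g : R -> R) (K q : R).

(** A bound for the slopes of the chords at q only; unlike a Lipschitz bound it can be checked
pointwise. *)
Definition slope_le g K q := exists2 d : R, 0 < d &
  forall q', `|q' - q| < d -> `|g q' - g q| <= K * `|q' - q|.

(** The supremum of the points up to which the bound holds is reached, and cannot be less than the
right end. *)
Lemma slope_lipschitz g K : 0 <= K -> (forall q, slope_le g K q) ->
  forall q q', `|g q' - g q| <= K * `|q' - q|.
Proof.
move=> K0 sg; suff H a b : a <= b -> `|g b - g a| <= K * (b - a).
  move=> q q'; have [qq'|/ltW qq'] := leP q q'.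
    by rewrite (@ger0_norm _ (q' - q)) ?subr_ge0// H.
  by rewrite distrC (distrC q') (@ger0_norm _ (q - q')) ?subr_ge0// H.
move=> ab; pose S := [set x | a <= x <= b /\
  forall y, a <= y <= x -> `|g y - g a| <= K * (y - a)].
have Sa : S a.
  split=> [|y]; first by rewrite lexx.
  by rewrite -eq_le => /eqP <-; rewrite !subrr normr0 mulr0.
have hS : has_sup S by split; [exists a|exists b => x [/andP[]]].
set s := sup S.
have as_ : a <= s by exact: (ub_le_sup hS.2).
have sb : s <= b by apply: ge_sup; [exists a|move=> x [/andP[]]].
have Ss y : a <= y <= s -> `|g y - g a| <= K * (y - a).
  move=> /andP[ay]; rewrite le_eqVlt => /predU1P[->|ys]; last first.
    have [x Sx yx] : exists2 x, S x & y < x.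
      have sy : 0 < s - y by rewrite subr_gt0.
      have [x Sx sx] := sup_adherent sy hS; exists x => //.
      by move: sx; rewrite -/s; lra.
    by case: Sx => _; apply; rewrite ay ltW.
  have [d d0 sd] := sg s; have [x Sx sx] := sup_adherent d0 hS.
  have xs : x <= s by exact: (ub_le_sup hS.2).
  have xd : `|x - s| < d by rewrite distrC ger0_norm ?subr_ge0//; move: sx; rewrite -/s; lra.
  have ax : a <= x by case: Sx => /andP[].
  have h1 : `|g x - g a| <= K * (x - a) by case: Sx => _; apply; rewrite ax lexx.
  have xsE : `|x - s| = s - x by rewrite distrC ger0_norm ?subr_ge0.
  have := sd x xd; rewrite xsE (distrC (g x)) => h2.
  rewrite -(subrKA (g x)) (le_trans (ler_normD _ _))//; lra.
have [sltb|] := ltP s b; last first.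
  by move=> bs; apply: Ss; rewrite ab bs.
have [d d0 sd] := sg s.
pose x := Num.min b (s + d / 2).
have sx : s < x by rewrite lt_min sltb ltrDl divr_gt0.
have [xb xd] : x <= b /\ x <= s + d / 2 by rewrite !ge_min !lexx orbT.
suff : S x by move=> /(ub_le_sup hS.2); rewrite -/s leNgt sx.
split; first by rewrite xb andbT (le_trans as_)// ltW.
move=> y /andP[ay yx]; have [ys|sy] := leP y s; first by apply: Ss; rewrite ay.
have yd : `|y - s| < d by rewrite gtr0_norm ?subr_gt0//; lra.
have ysE : `|y - s| = y - s by rewrite gtr0_norm ?subr_gt0.
have := sd y yd; rewrite ysE => h2.
have h1 := Ss s; rewrite as_ lexx in h1; have {}h1 := h1 isT.
rewrite -(subrKA (g s)) (le_trans (ler_normD _ _))//; lra.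
Qed.

Lemma near_dist q (t : R) : 0 < t -> \forall x \near q, `|q - x| < t.
Proof. by move=> t0; exists t => //= x; rewrite /ball /=. Qed.

Lemma slope_le_cont g K q : slope_le g K q -> {for q, continuous g}.
Proof.
move=> [d d0 sd]; apply/cvgrPdist_le => e e0; near=> q'.
have n1 : 0 < `|K| + 1 by rewrite ltr_wpDl.
have qd : `|q - q'| < d by near: q'; exact: near_dist.
have qe : `|q - q'| < e / (`|K| + 1).
  by near: q'; apply: near_dist; rewrite divr_gt0// ltr_wpDl.
have qd' : `|q' - q| < d by rewrite distrC.
have := sd q' qd'; rewrite (distrC (g q')) (distrC q') => /le_trans; apply.
move: qe; rewrite ltr_pdivlMr// => qe.
apply: (@le_trans _ _ (`|K| * `|q - q'|)); first by rewrite ler_wpM2r// ler_norm.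
by have := normr_ge0 (q - q'); move: qe; rewrite mulrDr mulr1 mulrC; lra.
Unshelve. all: by end_near.
Qed.

(** Compactness of a segment, for a property which holds near each point for all large K. With K ^-1
for the radii, the single constant K collects finitely many bounds of all kinds. *)
Lemma segment_cover (P : R -> R -> Prop) (a b : R) :
  (forall x, x \in `[a, b] -> exists r K0 : R, 0 < r /\
     forall y K, `|y - x| < r -> K0 <= K -> P K y) ->
  exists2 K : R, 1 <= K & forall x, x \in `[a, b] -> P K x.
Proof.
move=> loc; have /compact_near_coveringP cov := @segment_compact R a b.
have cK : \forall K \near +oo, `[a, b] `<=` P K.
  apply: cov => x abx; have [r [K0 [r0 Hr]]] := loc x abx.
  exists ([set y | `|x - y| < r], [set K | K0 <= K]).
    by split; [exact: near_dist|exact: nbhs_pinfty_ge (num_real K0)].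
  by move=> [y K] /= [yr KK]; apply: Hr; rewrite // distrC.
have [K [K1 KK]] := filter_ex (filterI (nbhs_pinfty_ge (num_real (1 : R))) cK).
by exists K.
Qed.

End Slope.

(** * Periodic functions *)

Section Periodic.
Context {R : realType}.

Lemma periodic_int (T : Type) (f : R -> T) : (forall q, f (q + 1) = f q) ->
  forall (k : int) q, f (q + k%:~R) = f q.
Proof.
move=> fp; have H (n : nat) q : f (q + n%:R) = f q.
  by elim: n q => [|n IHn] q; rewrite ?addr0// -natr1 addrA fp.
case=> n q; first by rewrite -pmulrn H.
by rewrite NegzE mulrNz -pmulrn -(H n.+1) subrK.
Qed.

Lemma lipschitz_const (g : R -> R) : lipschitz g -> exists2 L : R, 0 <= L &
  forall q q', `|g q' - g q| <= L * `|q' - q|.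
Proof.
move=> lg; have [L [L0 gL]] : exists L : R, 0 < L /\ L.-lipschitz g.
  by apply: (@filter_ex _ (pinfty_nbhs R)); near=> L; split; near: L => //; exact: nbhs_pinfty_gt.
exists L => [|q q']; first exact: ltW.
exact: (gL (q', q)).
Unshelve. all: by end_near.
Qed.

Lemma floor_shift (q : R) : exists (k : int) (q0 : R), q = q0 + k%:~R /\ q0 \in `[0, 1].
Proof.
exists (Num.floor q), (q - (Num.floor q)%:~R); split; first by rewrite subrK.
rewrite in_itv /= subr_ge0 ge_floor /= lerBlDr.
by rewrite addrC -intrD1 ltW// floorD1_gt.
Qed.

End Periodic.

(** * Dynamics around a periodic invariant graph *)

Section GraphDynamics.
Context {R : realType}.
Variables (pm pp : R -> \bar R) (F : R * R -> R * R) (alpha : R).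
Hypotheses (tw : exact_symplectic_twist_map pm pp F).
Let A := annulus pm pp.
Hypotheses (oA : box_open A)
  (sF : forall x, A x -> exists l1 l2, strict_diff2 A (fun y => (F y).1) x l1 /\
     strict_diff2 A (fun y => (F y).2) x l2).
Hypothesis ti : twist_interval pm pp F alpha.

Lemma twist_data x : A x -> exists l1 l2,
  [/\ strict_diff2 A (fun y => (F y).1) x l1, strict_diff2 A (fun y => (F y).2) x l2,
      0 < l1.2 & l1.1 * l2.2 - l1.2 * l2.1 = 1].
Proof.
move=> Ax; have [l1 [l2 [s1 s2]]] := sF Ax; exists l1, l2; split => //.
  exact: (twist_partial_gt0 tw oA ti Ax s1).
exact: (twist_det tw oA Ax s1 s2).
Qed.

Lemma iter_mem k x : A x -> A (iter k F x).
Proof. by move=> Ax; elim: k => //= k; exact: twist_mem. Qed.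

Lemma iter_shift n (k : int) q p : A (q, p) ->
  iter n F (q + k%:~R, p) = ((iter n F (q, p)).1 + k%:~R, (iter n F (q, p)).2).
Proof.
move=> Aqp; elim: n => //= n ->.
by rewrite (twist_lift tw k (iter_mem n Aqp)).
Qed.

Variables (m : int) (n : nat) (gam : R -> R).
Hypothesis n0 : (0 < n)%N.
Hypothesis pig : periodic_invariant_graph pm pp F m n gam.
Let f q := (F (q, gam q)).1.

Lemma graph_mem q : A (q, gam q).
Proof. by case: pig => _ + _ _; apply; exists q. Qed.

Lemma graph_map q : F (q, gam q) = (f q, gam (f q)).
Proof.
case: pig => _ _ inv _; have [q' _ E] : [set (q, gam q) | q in [set: R]] (F (q, gam q)).
  by apply: inv; exists (q, gam q) => //; exists q.
by rewrite /f -E.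
Qed.

Lemma graph_iter k q : iter k F (q, gam q) = (iter k f q, gam (iter k f q)).
Proof. by elim: k => //= k ->; rewrite graph_map. Qed.

Lemma graph_period q : iter n f q = q + m%:~R.
Proof. by case: pig => _ _ _ /(_ q); rewrite graph_iter => -[]. Qed.

Lemma gam_shift (k : int) q : gam (q + k%:~R) = gam q.
Proof. by case: pig => -[+ _] _ _ _; move=> /periodic_int; exact. Qed.

Lemma graph_shift (k : int) q : f (q + k%:~R) = f q + k%:~R.
Proof. by rewrite /f gam_shift (twist_lift tw _ (graph_mem q)). Qed.

Lemma graph_inj q q' : f q = f q' -> q = q'.
Proof.
move=> E; have := graph_map q; rewrite E -graph_map.
by move/(twist_inj tw (graph_mem q) (graph_mem q')) => [].
Qed.

Lemma graph_onto Q : exists q, f q = Q.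
Proof.
exists (iter n.-1 f (Q - m%:~R)).
by rewrite -iterS prednK// graph_period subrK.
Qed.

Lemma graph_slope_local q0 : exists K r : R, 0 < r /\ forall q q',
  `|q - q0| < r -> `|q' - q0| < r -> `|f q' - f q| <= K * `|q' - q|.
Proof.
have [l1 [l2 [s1 s2 _ _]]] := twist_data (graph_mem q0).
have [L L0 gL] := lipschitz_const (proj2 (let: And4 h _ _ _ := pig in h)).
have [r r0 Hr] := s1 _ ltr01.
have L1 : 0 < 1 + L by lra.
exists ((`|l1.1| + `|l1.2| + 1) * (1 + L)), (r / (1 + L)); split; first by rewrite divr_gt0.
have tx u v : taxi ((u, gam u) - (v, gam v)) <= (1 + L) * `|u - v|.
  by rewrite /taxi /= mulrDl mul1r lerD2l.
move=> q q'; rewrite !ltr_pdivlMr// => qr q'r.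
have := Hr _ _ (graph_mem q') (graph_mem q).
move=> /(_ (le_lt_trans (tx _ _) _)) h; have {}h := h _; move: h.
rewrite mulrC => /(_ q'r) /(_ (le_lt_trans (tx _ _) _)) h; have {}h := h _; move: h.
rewrite mulrC => /(_ qr); rewrite -/(f q) -/(f q') mul1r.
set v := (q', gam q') - (q, gam q) => h.
rewrite -[X in `|X|](subrK (lin2 l1 v)) (le_trans (ler_normD _ _))//.
have lv : `|lin2 l1 v| <= (`|l1.1| + `|l1.2|) * taxi v.
  rewrite (le_trans (ler_normD _ _))// !normrM /taxi.
  by have := normr_ge0 l1.1; have := normr_ge0 l1.2; have := normr_ge0 v.1; have := normr_ge0 v.2; nra.
apply: (@le_trans _ _ ((`|l1.1| + `|l1.2| + 1) * taxi v)); first by rewrite mulrDl mul1r; lra.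
by rewrite -mulrA ler_wpM2l ?tx// !addr_ge0.
Qed.

Lemma graph_lipschitz : exists2 K : R, 1 <= K & forall q q', `|f q' - f q| <= K * `|q' - q|.
Proof.
have [K K1 HK] : exists2 K : R, 1 <= K & forall q, q \in `[0, 1] -> slope_le f K q.
  apply: segment_cover => q0 _; have [C [r [r0 Hr]]] := graph_slope_local q0.
  exists (r / 2), C; split; first by rewrite divr_gt0.
  move=> q K h1 CK; exists (r / 2) => [|q' qq']; first by rewrite divr_gt0.
  apply: le_trans (Hr q q' _ _) _; [lra| |by rewrite ler_wpM2r].
  by rewrite -(subrKA q) (le_lt_trans (ler_normD _ _))//; lra.
exists K => //; apply: slope_lipschitz; first by lra.
move=> q; have [k [q0 [-> /HK[d d0 Hd]]]] := floor_shift q.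
exists d => // q'.
have -> : q' - (q0 + k%:~R) = (q' - k%:~R) - q0 by ring.
have -> : f q' = f (q' - k%:~R) + k%:~R by rewrite -graph_shift subrK.
by rewrite graph_shift opprD addrACA subrr addr0; exact: Hd.
Qed.

(** An injective continuous map commuting with integer translations is increasing. *)
Lemma graph_homo : {homo f : x y / x < y}.
Proof.
have [K K1 fK] := graph_lipschitz.
have fc q : {for q, continuous f} by apply: (@slope_le_cont _ _ K); exists 1.
suff H a b : a < b -> f a < f b by [].
move=> ab; pose N : int := Num.ceil (b - a) + 1.
have N0 : 0 < N%:~R :> R.
  by rewrite /N intrD ltr_wpDl// ler0z ceil_ge0 (lt_trans (ltrN10 R))// subr_gt0.
have aN : b < a + N%:~R.
  have := ceil_ge (b - a); rewrite /N intrD; lra.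
have abI : a \in `[a, a + N%:~R] /\ b \in `[a, a + N%:~R].
  by rewrite !in_itv /= lexx lerDl (ltW N0) (ltW ab) (ltW aN).
have eI : a + N%:~R \in `[a, a + N%:~R] by rewrite in_itv /= lexx lerDl (ltW N0).
have [up|down] := @itv_continuous_inj_mono _ f `[a, a + N%:~R]
  (continuous_in_subspaceT (fun q _ => fc q)) (in2W graph_inj).
  exact: up abI.1 abI.2 ab.
have := down _ _ eI abI.1; rewrite ltrDl N0 graph_shift => /(_ isT).
by rewrite gtrDl ltNge (ltW N0).
Qed.

Lemma graph_iter_homo k : {homo iter k f : x y / x <= y}.
Proof.
move=> x y xy; elim: k => //= k; rewrite le_eqVlt => /predU1P[->//|].
by move/graph_homo/ltW.
Qed.

(** The inverse of f is f ^ (n - 1) up to a translation, and it inherits the Lipschitz constant. *)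
Lemma graph_bilip : exists2 K : R, 0 < K & exists2 mu : R, 0 < mu &
  forall q q', mu * `|q - q'| <= `|f q - f q'| <= K * `|q - q'|.
Proof.
have [K K1 fK] := graph_lipschitz; have K0 : 0 < K by lra.
exists K => //; exists (K ^+ n.-1)^-1 => [|q q']; first by rewrite invr_gt0 exprn_gt0.
rewrite fK andbT ler_pdivrMl ?exprn_gt0//.
have iK k x y : `|iter k f x - iter k f y| <= K ^+ k * `|x - y|.
  elim: k => [|k IHk]; first by rewrite expr0 mul1r.
  by rewrite /= exprS -mulrA (le_trans (fK _ _))// ler_wpM2l// ltW.
have := iK n.-1 (f q) (f q'); rewrite -!iterSr prednK// !graph_period.
by rewrite opprD addrACA subrr addr0.
Qed.

(** The invariant graph is a curve mapped to itself. *)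
Lemma graph_orientation q p : A (q, p) -> p != gam q ->
  0 < (p - gam q) * ((F (q, p)).2 - gam (F (q, p)).1).
Proof.
move=> Aqp pq.
have [K K0 [mu mu0 bl]] := graph_bilip.
have [L L0 gL] := lipschitz_const (proj2 (let: And4 h _ _ _ := pig in h)).
have gs q' : slope_le gam L q' by exists 1.
apply: (@orientation _ A F oA _ (twist_inj tw) twist_data gam gam f mu K) => //.
- by move=> q1 p1 p2 p3; exact: fiber_between.
- exact: graph_mem.
- exact: graph_map.
- exact: graph_onto.
- exact: graph_homo.
- by move=> q1; exists L, 1; split.
- by move=> q1; exact: (slope_le_cont (gs q1)).
Qed.

(** Points above the graph stay above it and at each step are ahead of the points of the graph. *)
Lemma above_graph_iter k q p : A (q, p) -> gam q <= p -> iter k f q <= (iter k F (q, p)).1.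
Proof.
elim: k q p => // k IHk q p Aqp; rewrite le_eqVlt => /predU1P[<-|qp].
  by rewrite graph_iter.
rewrite !iterSr; case E : (F (q, p)) => [Q P].
have fQ : f q < Q by have := twist_mono tw ti (graph_mem q) Aqp qp; rewrite E.
have AQP : A (Q, P) by rewrite -E; exact: twist_mem.
apply: le_trans (IHk Q P AQP _); first by rewrite graph_iter_homo// ltW.
have := graph_orientation Aqp (_ : p != gam q); rewrite E gt_eqF// => /(_ isT).
by rewrite pmulr_rgt0 ?subr_gt0// => /ltW.
Qed.

Lemma below_graph_iter k q p : A (q, p) -> p <= gam q -> (iter k F (q, p)).1 <= iter k f q.
Proof.
elim: k q p => // k IHk q p Aqp; rewrite le_eqVlt => /predU1P[->|qp].
  by rewrite graph_iter.
rewrite !iterSr; case E : (F (q, p)) => [Q P].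
have fQ : Q < f q by have := twist_mono tw ti Aqp (graph_mem q) qp; rewrite E.
have AQP : A (Q, P) by rewrite -E; exact: twist_mem.
apply: le_trans (IHk Q P AQP _) _; last by rewrite graph_iter_homo// ltW.
have := graph_orientation Aqp (_ : p != gam q); rewrite E lt_eqF// => /(_ isT).
by rewrite nmulr_rgt0 ?subr_lt0// => /ltW.
Qed.

(** After one step the point is ahead of the graph; the remaining n - 1 steps cannot lose
more than the Lipschitz constant of f, since f ^ n is a translation. *)
Lemma graph_torsion : exists2 K : R, 0 < K & forall q p, A (q, p) ->
  (gam q < p -> ((F (q, p)).1 - f q) / K <= (iter n F (q, p)).1 - (q + m%:~R)) /\
  (p < gam q -> (iter n F (q, p)).1 - (q + m%:~R) <= ((F (q, p)).1 - f q) / K).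
Proof.
have [K K1 fK] := graph_lipschitz; have K0 : 0 < K by lra.
exists K => // q p Aqp; case E : (F (q, p)) => [Q P] /=.
have AQP : A (Q, P) by rewrite -E; exact: twist_mem.
rewrite -[n in iter n](prednK n0) iterSr E.
have mE : q + m%:~R = iter n.-1 f (f q) by rewrite -iterSr prednK// graph_period.
have QE : `|Q - f q| <= K * `|iter n.-1 f Q - iter n.-1 f (f q)|.
  have := fK (iter n.-1 f (f q)) (iter n.-1 f Q).
  by rewrite -!iterS prednK// !graph_period opprD addrACA subrr addr0.
rewrite mE; split=> qp.
- have fQ : f q < Q by have := twist_mono tw ti (graph_mem q) Aqp qp; rewrite E.
  have gP : gam Q <= P.
    have := graph_orientation Aqp (_ : p != gam q); rewrite E gt_eqF// => /(_ isT).
    by rewrite pmulr_rgt0 ?subr_gt0// => /ltW.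
  rewrite (le_trans _ (lerB (above_graph_iter n.-1 AQP gP) (lexx _)))//.
  rewrite ler_pdivrMr// mulrC; move: QE; rewrite !ger0_norm ?subr_ge0 ?(ltW fQ)//.
  by rewrite graph_iter_homo// ltW.
- have fQ : Q < f q by have := twist_mono tw ti Aqp (graph_mem q) qp; rewrite E.
  have gP : P <= gam Q.
    have := graph_orientation Aqp (_ : p != gam q); rewrite E lt_eqF// => /(_ isT).
    by rewrite nmulr_rgt0 ?subr_lt0// => /ltW.
  rewrite (le_trans (lerB (below_graph_iter n.-1 AQP gP) (lexx _)))//.
  rewrite ler_pdivlMr// mulrC -lerN2 -mulrN !opprB.
  move: QE; rewrite !(distrC Q) (distrC (iter _ f Q)) !ger0_norm ?subr_ge0 ?(ltW fQ)//.
  by rewrite graph_iter_homo// ltW.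
Qed.

Lemma graph_sign q p : A (q, p) ->
  (gam q < p -> q + m%:~R < (iter n F (q, p)).1) /\
  (p < gam q -> (iter n F (q, p)).1 < q + m%:~R).
Proof.
move=> Aqp; have [K K0 /(_ q p Aqp)[h1 h2]] := graph_torsion; split=> qp.
  rewrite -subr_gt0 (lt_le_trans _ (h1 qp))// divr_gt0// subr_gt0.
  exact: (twist_mono tw ti (graph_mem q) Aqp qp).
rewrite -subr_lt0 (le_lt_trans (h2 qp))// ltr_pdivrMr// mul0r subr_lt0.
exact: (twist_mono tw ti Aqp (graph_mem q) qp).
Qed.

End GraphDynamics.

(** * Displacement near the ends of the annulus *)

Section Ends.
Context {R : realType}.
Variables (pm pp : R -> \bar R) (F : R * R -> R * R) (alpha : R).
Hypotheses (tw : exact_symplectic_twist_map pm pp F).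
Let A := annulus pm pp.
Hypotheses (oA : box_open A)
  (sF : forall x, A x -> exists l1 l2, strict_diff2 A (fun y => (F y).1) x l1 /\
     strict_diff2 A (fun y => (F y).2) x l2).
Hypothesis ti : twist_interval pm pp F alpha.
Hypothesis pm_lt_pp : forall q, (pm q < pp q)%E.

Lemma strict_diff2_graph_slope (g : R -> R) f q l L : (forall q, A (q, g q)) ->
  strict_diff2 A f (q, g q) l -> slope_le g L q ->
  exists K, slope_le (fun q => f (q, g q)) K q.
Proof.
move=> Ag sf [d d0 gL]; have [r r0 Hr] := sf _ ltr01.
have L1 : 0 < 1 + `|L| by rewrite ltr_pwDl.
exists ((`|l.1| + `|l.2| + 1) * (1 + `|L|)), (Num.min d (r / (1 + `|L|))).
  by rewrite lt_min d0 divr_gt0.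
move=> q'; rewrite lt_min ltr_pdivlMr// => /andP[qd qr].
have tx : taxi ((q', g q') - (q, g q)) <= (1 + `|L|) * `|q' - q|.
  rewrite /taxi /= mulrDl mul1r lerD2l (le_trans (gL _ qd))// ler_wpM2r// ler_norm//.
have tr : taxi ((q', g q') - (q, g q)) < r by rewrite (le_lt_trans tx)// mulrC.
have := Hr _ _ (Ag q') (Ag q) tr; rewrite mul1r.
set v := (q', g q') - (q, g q) => H.
have v0 : taxi ((q, g q) - (q, g q)) < r by rewrite subrr /taxi /= normr0 addr0.
have {}H := H v0.
rewrite -[X in `|X|](subrK (lin2 l v)) (le_trans (ler_normD _ _))//.
have lv : `|lin2 l v| <= (`|l.1| + `|l.2|) * taxi v.
  rewrite (le_trans (ler_normD _ _))// !normrM /taxi.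
  by have := normr_ge0 l.1; have := normr_ge0 l.2; have := normr_ge0 v.1; have := normr_ge0 v.2; nra.
apply: (@le_trans _ _ ((`|l.1| + `|l.2| + 1) * taxi v)); first by rewrite mulrDl mul1r; lra.
by rewrite -mulrA ler_wpM2l ?tx// !addr_ge0.
Qed.

Lemma fiber_low q p : fiber pm pp q p -> exists p', [/\ fiber pm pp q p', p' < p &
  (F (q, p')).1 - q <= alpha].
Proof.
move=> fp; have [Um [Up [nUm nUp HU]]] := ti.
have [||b [b1 b2 b3]] := @ereal_nbhs_right _ (pm q) (fun e => Um (q, e)) p.
- by case/andP: fp.
- exact: nbhs_slice (nUm (q, pm q) erefl).
have fb : fiber pm pp q b.
  by rewrite /fiber /= b1 /= (lt_trans _ (proj2 (andP fp)))// lte_fin.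
by exists b; split=> //; apply: (HU (q, b) fb).1; exact: b3.
Qed.

Lemma fiber_high q p : fiber pm pp q p -> exists p', [/\ fiber pm pp q p', p < p' &
  alpha <= (F (q, p')).1 - q].
Proof.
move=> fp; have [Um [Up [nUm nUp HU]]] := ti.
have [||b [b1 b2 b3]] := @ereal_nbhs_left _ (pp q) (fun e => Up (q, e)) p.
- by case/andP: fp.
- exact: nbhs_slice (nUp (q, pp q) erefl).
have fb : fiber pm pp q b.
  by rewrite /fiber /= b1 andbT (lt_trans (proj1 (andP fp)))// lte_fin.
by exists b; split=> //; apply: (HU (q, b) fb).2; exact: b3.
Qed.

(** The displacement is at most alpha near the bottom and at least alpha near the top. *)
Lemma level_exists q : exists p, A (q, p) /\ (F (q, p)).1 = q + alpha.
Proof.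
have [p fp] := fiber_nonempty (pm_lt_pp q).
have [b [fb bp db]] := fiber_low fp; have [t [ft pt dt]] := fiber_high fp.
have bt : b <= t by lra.
have [||r] := @IVT R (fun p => (F (q, p)).1) b t (q + alpha) bt.
- apply: continuous_in_subspaceT => r /set_mem /=; rewrite in_itv /= => brt.
  exact: (twist_cont_fiber tw (fiber_between fb ft brt)).
- by rewrite ge_min le_max; apply/andP; split; apply/orP; [left|right]; lra.
rewrite in_itv /= => brt E; exists r; split=> //; exact: fiber_between brt.
Qed.

Section level.
Variable c : R -> R.
Hypothesis cA : forall q, A (q, c q).
Hypothesis cE : forall q, (F (q, c q)).1 = q + alpha.
Let c' Q := (F (Q - alpha, c (Q - alpha))).2.

(** The level curve of the displacement is the solution of an equation with positive derivative in p;
the map increasing on fibers, the solution is found between two test points. *)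
Lemma level_slope q : exists2 K : R, 0 <= K & slope_le c K q.
Proof.
have [l1 [l2 [s1 s2 l12 det]]] := twist_data tw oA sF ti (cA q).
have h2 : 0 < l1.2 / 2 by rewrite divr_gt0.
have [r r0 Hr] := s1 _ h2; have [s s0 Hs] := oA (cA q).
pose K := (`|l1.1| + l1.2 / 2 + 2) / (l1.2 / 2).
have K0 : 0 < K by rewrite divr_gt0// ltr_wpDl// addr_ge0// ltW.
have KE : K * (l1.2 / 2) = `|l1.1| + l1.2 / 2 + 2 by rewrite divfK ?gt_eqF.
exists K; first exact: ltW.
have K1 : 0 < 1 + K by lra.
exists (Num.min r s / (1 + K)) => [|q']; first by rewrite divr_gt0// lt_min r0.
rewrite ltr_pdivlMr//; set a := `|q' - q| => aK.
have [mr ms] : Num.min r s <= r /\ Num.min r s <= s by rewrite !ge_min !lexx orbT.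
have [a0|a0] := eqVneq (q' - q) 0.
  move/eqP: a0; rewrite subr_eq0 => /eqP E; rewrite E subrr normr0.
  by apply: mulr_ge0; [exact: ltW|exact: normr_ge0].
have ap : 0 < a by rewrite normr_gt0.
have est b : `|b| = K * a -> A (q', c q + b) /\
    `|(F (q', c q + b)).1 - (q + alpha) - (l1.1 * (q' - q) + l1.2 * b)| <= l1.2 / 2 * (a + K * a).
  move=> bE; have vE : (q', c q + b) - (q, c q) = (q' - q, b) by congr pair => /=; ring.
  have tE : taxi ((q', c q + b) - (q, c q)) = a + K * a by rewrite vE /taxi /= bE.
  have taK : a + K * a = a * (1 + K) by ring.
  have A' : A (q', c q + b) by apply: Hs; rewrite tE taK; lra.
  split=> //; rewrite -cE -bE.
  have := Hr _ _ A' (cA q); rewrite tE vE /lin2 /= subrr [taxi 0]/taxi /= normr0 addr0 -bE.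
  by apply=> //; rewrite bE taK; lra.
have lq : `|l1.1 * (q' - q)| <= `|l1.1| * a by rewrite normrM.
have qa : `|q' - q| <= a by [].
have [|A1 e1] := est (K * a); first by rewrite gtr0_norm// mulr_gt0.
have [|A2 e2] := est (- (K * a)); first by rewrite normrN gtr0_norm// mulr_gt0.
have Ka : l1.2 / 2 * (K * a) = (`|l1.1| + l1.2 / 2 + 2) * a by rewrite -KE; ring.
have up : c q' < c q + K * a.
  rewrite ltNge; apply/negP => le; have : (F (q', c q + K * a)).1 <= (F (q', c q')).1.
    move: le; rewrite le_eqVlt => /predU1P[->//|lt]; exact/ltW/(twist_mono tw ti A1 (cA q')).
  rewrite cE; move: e1 lq qa; rewrite !ler_norml => /andP[? ?] /andP[? ?] /andP[? ?]; lra.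
have dn : c q - K * a < c q'.
  rewrite ltNge; apply/negP => le; have : (F (q', c q')).1 <= (F (q', c q - K * a)).1.
    move: le; rewrite le_eqVlt => /predU1P[->//|lt]; exact/ltW/(twist_mono tw ti (cA q') A2).
  rewrite cE; move: e2 lq qa; rewrite !ler_norml => /andP[? ?] /andP[? ?] /andP[? ?]; lra.
by rewrite ler_norml; apply/andP; split; lra.
Qed.

Lemma level_image_cont : continuous c'.
Proof.
move=> Q; have [l1 [l2 [s1 s2 _ _]]] := twist_data tw oA sF ti (cA (Q - alpha)).
have [K K0 cK] := level_slope (Q - alpha).
have [K' [d d0 Hd]] := strict_diff2_graph_slope cA s2 cK.
apply: (@slope_le_cont _ c' K'); exists d => // Q' QQ.
have E : Q' - Q = (Q' - alpha) - (Q - alpha) by ring.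
by rewrite E; apply: Hd; rewrite -E.
Qed.

(** The level curve is mapped to its translate in q by alpha, onto the curve c'. *)
Lemma level_orientation q p : A (q, p) -> p != c q ->
  0 < (p - c q) * ((F (q, p)).2 - c' (F (q, p)).1).
Proof.
move=> Aqp pq.
apply: (@orientation _ A F oA _ (twist_inj tw) (twist_data tw oA sF ti) c c' (+%R^~ alpha) 1 1) => //.
- by move=> q1 p1 p2 p3; exact: fiber_between.
- by move=> q1; rewrite /c' addrK -cE; case: (F _).
- by move=> Q; exists (Q - alpha); rewrite subrK.
- by move=> x y; rewrite ltrD2r.
- by move=> x y; rewrite opprD addrACA subrr addr0 mul1r lexx.
- move=> q1; have [K K0 [d d0 Hd]] := level_slope q1; exists K, d; split=> //.
- exact: level_image_cont.
Qed.

Lemma level_image_mem Q : A (Q, c' Q).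
Proof.
have := twist_mem tw (cA (Q - alpha)); rewrite -/A.
by rewrite /c' -[X in _ -> A (X, _)](subrK alpha) -cE; case: (F _).
Qed.

(** Points near one end of the annulus stay near that end. The boundary condition on twist maps only
says that they stay near the boundary; the sets G' and H tell the two ends apart, G being mapped to G'
because the level curve is crossed in one direction. *)
Lemma end_step (E E' : R -> \bar R) (G G' H N : set (R * \bar R)) :
  egraph E `|` egraph E' = egraph pm `|` egraph pp ->
  set_nbhs (egraph E) G -> set_nbhs (egraph E) G' -> set_nbhs (egraph E') H ->
  (forall z, G' z -> ~ H z) ->
  (forall x, A x -> G (einj x) -> G' (einj (F x))) ->
  set_nbhs (egraph E) N ->
  exists2 N', set_nbhs (egraph E) N' &
    forall x, A x -> N' (einj x) -> G (einj x) /\ N (einj (F x)).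
Proof.
move=> EE' nG nG' nH G'H GG' nN.
have [|U nU HU] := twist_boundary tw (V := (N `&` G') `|` H).
  rewrite -EE' => z [Ez|E'z]; first by apply: filterS (filterI (nN z Ez) (nG' z Ez)); left.
  by apply: filterS (nH z E'z); right.
exists (U `&` G) => [z Ez|x Ax [Ux Gx]].
  by apply: filterI; [apply: nU; rewrite -EE'; left|exact: nG].
split=> //; have [[[//]|Hx] _] := HU x Ax Ux.
by case: (G'H _ (GG' x Ax Gx)).
Qed.

Lemma end_iter (E : R -> \bar R) (G : set (R * \bar R)) :
  (forall N, set_nbhs (egraph E) N -> exists2 N', set_nbhs (egraph E) N' &
    forall x, A x -> N' (einj x) -> G (einj x) /\ N (einj (F x))) ->
  forall k, exists2 N, set_nbhs (egraph E) N & forall x, A x -> N (einj x) ->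
    forall i, (i < k)%N -> G (einj (iter i F x)).
Proof.
move=> step; elim=> [|k [N nN HN]]; first by exists setT => // z _; exact: filterT.
have [N' nN' HN'] := step N nN; exists N' => // x Ax N'x [_|i ik].
  by have [] := HN' x Ax N'x.
by rewrite iterSr; apply: HN => //; [exact: twist_mem|have [] := HN' x Ax N'x].
Qed.

Let gt_graph (g : R -> R) : set (R * \bar R) := [set z | ((g z.1)%:E < z.2)%E].
Let lt_graph (g : R -> R) : set (R * \bar R) := [set z | (z.2 < (g z.1)%:E)%E].

Let nbhs_gt_graph (g : R -> R) q (e : \bar R) : {for q, continuous g} -> ((g q)%:E < e)%E ->
  nbhs (q, e) (gt_graph g).
Proof.
move=> gc ge.
have [r gr re] : exists2 r, g q < r & (r%:E < e)%E.
  have [p /andP[]] := @fiber_nonempty _ (fun=> (g q)%:E) (fun=> e) q ge.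
  by rewrite lte_fin => ? ?; exists p.
exists ([set q' | g q' < r], [set e' | (r%:E < e')%E]) => /=.
  split; last exact: open_ereal_gt'.
  exact: (cvgr_lt (g q) gc r gr).
by move=> [q' e'] /= [h1 h2]; apply: lt_trans h2; rewrite lte_fin.
Qed.

Let nbhs_lt_graph (g : R -> R) q (e : \bar R) : {for q, continuous g} -> (e < (g q)%:E)%E ->
  nbhs (q, e) (lt_graph g).
Proof.
move=> gc ge.
have [r gr re] : exists2 r, r < g q & (e < r%:E)%E.
  have [p /andP[]] := @fiber_nonempty _ (fun=> e) (fun=> (g q)%:E) q ge.
  by rewrite lte_fin => ? ?; exists p.
exists ([set q' | r < g q'], [set e' | (e' < r%:E)%E]) => /=.
  split; last exact: open_ereal_lt'.
  exact: (cvgr_gt (g q) gc r gr).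
by move=> [q' e'] /= [h1 h2]; apply: (lt_trans h2); rewrite lte_fin.
Qed.

Lemma level_cont : continuous c.
Proof. by move=> q; have [K _ cK] := level_slope q; exact: slope_le_cont cK. Qed.

Lemma top_displacement k q p : (0 < k)%N -> A (q, p) ->
  (forall i, (i < k)%N -> gt_graph c (einj (iter i F (q, p)))) ->
  q + k%:R * alpha < (iter k F (q, p)).1.
Proof.
move=> k0 Aqp; elim: k k0 => // k IHk _ above.
have Ak := iter_mem tw k Aqp.
have step : (iter k F (q, p)).1 + alpha < (iter k.+1 F (q, p)).1.
  have := above k (leqnn _); rewrite /gt_graph /einj /= lte_fin => ck.
  rewrite -cE; case E : (iter k F (q, p)) Ak ck => [Q P] /= Ak ck.
  exact: (twist_mono tw ti (cA Q) Ak ck).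
rewrite -natr1 mulrDl mul1r addrA (le_lt_trans _ step)// lerD2r.
case: k IHk above {Ak step} => [|k] IHk above; first by rewrite mul0r addr0.
by apply/ltW/IHk => // i ik; apply: above; rewrite ltnW.
Qed.

Lemma bottom_displacement k q p : (0 < k)%N -> A (q, p) ->
  (forall i, (i < k)%N -> lt_graph c (einj (iter i F (q, p)))) ->
  (iter k F (q, p)).1 < q + k%:R * alpha.
Proof.
move=> k0 Aqp; elim: k k0 => // k IHk _ below.
have Ak := iter_mem tw k Aqp.
have step : (iter k.+1 F (q, p)).1 < (iter k F (q, p)).1 + alpha.
  have := below k (leqnn _); rewrite /lt_graph /einj /= lte_fin => ck.
  rewrite -cE; case E : (iter k F (q, p)) Ak ck => [Q P] /= Ak ck.
  exact: (twist_mono tw ti Ak (cA Q) ck).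
rewrite -natr1 mulrDl mul1r addrA (lt_le_trans step)// lerD2r.
case: k IHk below {Ak step} => [|k] IHk below; first by rewrite mul0r addr0.
by apply/ltW/IHk => // i ik; apply: below; rewrite ltnW.
Qed.

Lemma level_ends k q : (0 < k)%N -> exists p1 p2,
  [/\ A (q, p1), A (q, p2), q + k%:R * alpha < (iter k F (q, p1)).1 &
      (iter k F (q, p2)).1 < q + k%:R * alpha].
Proof.
move=> k0.
have cpp q' : ((c q')%:E < pp q')%E by case/andP: (cA q').
have cpm q' : (pm q' < (c q')%:E)%E by case/andP: (cA q').
have c'pp q' : ((c' q')%:E < pp q')%E by case/andP: (level_image_mem q').
have c'pm q' : (pm q' < (c' q')%:E)%E by case/andP: (level_image_mem q').
have nct : set_nbhs (egraph pp) (gt_graph c).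
  by move=> [q' e]; rewrite /egraph /= => ->; apply: nbhs_gt_graph => //; exact: level_cont.
have ncb : set_nbhs (egraph pm) (lt_graph c).
  by move=> [q' e]; rewrite /egraph /= => ->; apply: nbhs_lt_graph => //; exact: level_cont.
have nct' : set_nbhs (egraph pp) (gt_graph c').
  by move=> [q' e]; rewrite /egraph /= => ->; apply: nbhs_gt_graph => //; exact: level_image_cont.
have ncb' : set_nbhs (egraph pm) (lt_graph c').
  by move=> [q' e]; rewrite /egraph /= => ->; apply: nbhs_lt_graph => //; exact: level_image_cont.
have disj z : gt_graph c' z -> ~ lt_graph c' z.
  by rewrite /gt_graph /lt_graph /= => h1 h2; have := lt_trans h1 h2; rewrite ltxx.
have up x : A x -> gt_graph c (einj x) -> gt_graph c' (einj (F x)).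
  case: x => q' p' Ax; rewrite /gt_graph /= !lte_fin => cp.
  have := level_orientation Ax (_ : p' != c q'); rewrite gt_eqF// => /(_ isT).
  by rewrite pmulr_rgt0 ?subr_gt0.
have dn x : A x -> lt_graph c (einj x) -> lt_graph c' (einj (F x)).
  case: x => q' p' Ax; rewrite /lt_graph /= !lte_fin => cp.
  have := level_orientation Ax (_ : p' != c q'); rewrite lt_eqF// => /(_ isT).
  by rewrite nmulr_rgt0 ?subr_lt0.
have [N1 nN1 HN1] := end_iter (fun N => end_step (setUC _ _) nct nct' ncb' disj up) k.
have [N2 nN2 HN2] := end_iter (fun N => end_step erefl ncb ncb' nct'
  (fun z h1 h2 => disj z h2 h1) dn) k.
have [||p1 [p1t cp1 p1N]] := @ereal_nbhs_left _ (pp q) (fun e => N1 (q, e)) (c q).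
- exact: cpp.
- exact: nbhs_slice (nN1 (q, pp q) erefl).
have A1 : A (q, p1).
  by rewrite /A /annulus /fiber /= p1t andbT (lt_trans (cpm q))// lte_fin.
have [||p2 [p2b cp2 p2N]] := @ereal_nbhs_right _ (pm q) (fun e => N2 (q, e)) (c q).
- exact: cpm.
- exact: nbhs_slice (nN2 (q, pm q) erefl).
have A2 : A (q, p2).
  by rewrite /A /annulus /fiber /= p2b /= (lt_trans _ (cpp q))// lte_fin.
exists p1, p2; split=> //.
  by apply: top_displacement => //; apply: HN1 => //; exact: p1N.
by apply: bottom_displacement => //; apply: HN2 => //; exact: p2N.
Qed.

End level.

(** Above the level curve each step displaces by more than alpha, below it by less, and near the
ends k steps stay on one side of it. *)
Lemma annulus_ends k q : (0 < k)%N -> exists p1 p2,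
  [/\ A (q, p1), A (q, p2), q + k%:R * alpha < (iter k F (q, p1)).1 &
      (iter k F (q, p2)).1 < q + k%:R * alpha].
Proof.
move=> k0; have [c cH] := choice level_exists.
exact: (level_ends (fun q => (cH q).1) (fun q => (cH q).2) q k0).
Qed.

End Ends.

(** * Analytic families of twist maps and slopes of their graphs *)

Section RegularAffine.
Context {R : realType}.
Local Notation pt := (R * (R * R))%type.
Implicit Types (A : set pt) (I : set R) (f g : pt -> R) (a l x y : pt).

Lemma regular_affine I A f a l l' (c : R) : regular I A f a l ->
  regular I A (fun z => f z + (lin l' z + c)) a (l + l').
Proof.
have linD x : lin (l + l') x = lin l x + lin l' x by rewrite /lin /=; ring.
move=> [df [C [s [C0 s0 tf]]]]; split.
  move=> eta eta0; have [r r0 Hr] := df eta eta0; exists r => // x y Ax Ay xa ya.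
  have := Hr x y Ax Ay xa ya; rewrite linD (linB l' x).
  by congr (`|_| <= _); ring.
exists C, s; split => // r rho X r0 rp ps AX tX.
apply: eq_tame (tf r rho X r0 rp ps AX tX) => e _ _.
by rewrite linD (linB l' (X e)); ring.
Qed.

Lemma regular0 I A a : regular I A (fun=> 0) a 0.
Proof.
have lin0 x : lin 0 x = 0 by rewrite /lin /= !mul0r !addr0.
split=> [eta eta0|].
  exists 1 => // x y _ _ _ _; rewrite lin0 !subrr normr0 mulr_ge0 ?norm1_ge0//.
  exact: ltW.
exists 0, 1; split => // r rho X r0 rp ps AX tX.
rewrite mul0r -[X in tame _ _ _ X](normr0 R).
by apply: eq_tame (tame_cst _ _ _ 0) => e _ _; rewrite lin0 !subrr.
Qed.

Lemma regular_lin I A a l : regular I A (lin l) a l.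
Proof.
have := regular_affine l 0 (regular0 I A a); rewrite add0r.
by congr regular; apply/funext => z; rewrite add0r addr0.
Qed.

End RegularAffine.

(** The vector (a1, b1) is, up to errors, the image of (A1, B1) under a matrix of determinant one, so
that A1 is about kp * a1 - lp * b1. As A1 is positive, lp * b1 cannot exceed kp * a1 by much. *)
Lemma inverse_slope {R : realType} (lq lp kq kp a1 b1 A1 B1 eta C : R) :
  lq * kp - lp * kq = 1 -> C = `|lq| + `|lp| + `|kq| + `|kp| -> 0 <= eta ->
  eta * (4 * C) <= 1 -> eta * (4 * C ^+ 2) <= lp / 2 -> 0 < lp -> 0 < A1 ->
  0 <= a1 -> 0 <= b1 ->
  `|a1 - (lq * A1 + lp * B1)| <= eta * (`|A1| + `|B1|) ->
  `|b1 - (kq * A1 + kp * B1)| <= eta * (`|A1| + `|B1|) ->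
  lp / 2 * b1 <= (C + lp / 2) * a1.
Proof.
move=> det CE eta0 etaC etaC2 lp0 A10 a10 b10.
set N := `|A1| + `|B1|; set e1 := a1 - _; set e2 := b1 - _ => E1 E2.
have N0 : 0 <= N by rewrite addr_ge0.
have A1E : A1 = kp * a1 - lp * b1 - kp * e1 + lp * e2.
  by rewrite -[LHS]mulr1 -det /e1 /e2; ring.
have B1E : B1 = - kq * a1 + lq * b1 + kq * e1 - lq * e2.
  by rewrite -[LHS]mulr1 -det /e1 /e2; ring.
have M (x y B : R) : `|y| <= B -> - (`|x| * B) <= x * y <= `|x| * B.
  by move=> yB; rewrite -ler_norml normrM ler_wpM2l.
have a1' : `|a1| <= a1 by rewrite ger0_norm.
have b1' : `|b1| <= b1 by rewrite ger0_norm.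
have C0 : 0 <= C by rewrite CE !addr_ge0.
have NE : N <= 2 * C * (a1 + b1).
  have NA : N <= C * (a1 + b1) + 2 * C * (eta * N).
    have hA : `|A1| <= `|kp| * a1 + `|lp| * b1 + `|kp| * (eta * N) + `|lp| * (eta * N).
      rewrite ler_norml.
      move: A1E (M kp a1 _ a1') (M lp b1 _ b1') (M kp e1 _ E1) (M lp e2 _ E2).
      by move=> ? /andP[? ?] /andP[? ?] /andP[? ?] /andP[? ?]; apply/andP; split; lra.
    have hB : `|B1| <= `|kq| * a1 + `|lq| * b1 + `|kq| * (eta * N) + `|lq| * (eta * N).
      rewrite ler_norml.
      move: B1E (M kq a1 _ a1') (M lq b1 _ b1') (M kq e1 _ E1) (M lq e2 _ E2).
      by move=> ? /andP[? ?] /andP[? ?] /andP[? ?] /andP[? ?]; apply/andP; split; lra.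
    have p (x y : R) : 0 <= y -> 0 <= `|x| * y by move=> ?; rewrite mulr_ge0.
    have eN : 0 <= eta * N by rewrite mulr_ge0.
    rewrite {1}/N CE.
    have := p lq a1 a10; have := p lp a1 a10; have := p kq b1 b10; have := p kp b1 b10.
    have := p lq _ eN; have := p lp _ eN; have := p kq _ eN; have := p kp _ eN; lra.
  have : eta * (4 * C) * N <= N by rewrite ler_piMl.
  lra.
have key : lp * b1 <= C * a1 + C * (eta * N).
  move: (M kp a1 _ a1') (M kp e1 _ E1) (M lp e2 _ E2).
  move=> /andP[? ?] /andP[? ?] /andP[? ?].
  have p (x y : R) : 0 <= y -> 0 <= `|x| * y by move=> ?; rewrite mulr_ge0.
  have eN : 0 <= eta * N by rewrite mulr_ge0.
  rewrite CE; have := p lq a1 a10; have := p lp a1 a10; have := p kq a1 a10.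
  have := p lq _ eN; have := p kq _ eN; lra.
have : C * eta * N <= C * eta * (2 * C * (a1 + b1)) by rewrite ler_wpM2l// mulr_ge0.
have : eta * (4 * C ^+ 2) * (a1 + b1) <= lp / 2 * (a1 + b1) by rewrite ler_wpM2r// addr_ge0.
have : 0 <= lp * a1 by rewrite mulr_ge0// ltW.
have : 0 <= lp * b1 by rewrite mulr_ge0// ltW.
lra.
Qed.

Record twist_family (R : realType) (I : set R) (m : int) (n : nat)
    (pm pp : R -> R -> \bar R) (F : R -> R * R -> R * R) : Prop := {
  family_n_gt0 : (0 < n)%N;
  family_pm_cont : {within I `*` [set: R], continuous (fun x : R * R => pm x.1 x.2)};
  family_pp_cont : {within I `*` [set: R], continuous (fun x : R * R => pp x.1 x.2)};
  family_pm_periodic : forall e, I e -> forall q, pm e (q + 1) = pm e q;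
  family_pp_periodic : forall e, I e -> forall q, pp e (q + 1) = pp e q;
  family_pm_lt_pp : forall e, I e -> forall q, (pm e q < pp e q)%E;
  family_twist : forall e, I e -> exact_symplectic_twist_map (pm e) (pp e) (F e);
  family_analytic1 : analytic_on (annuli_family I pm pp) (fun x => (F x.1 x.2).1);
  family_analytic2 : analytic_on (annuli_family I pm pp) (fun x => (F x.1 x.2).2);
  family_twist_interval : forall e, I e ->
    twist_interval (pm e) (pp e) (F e) (m%:~R / n%:R)
}.

Section Family.
Context {R : realType}.
Local Notation pt := (R * (R * R))%type.
Variables (I : set R) (m : int) (n : nat) (pm pp : R -> R -> \bar R) (F : R -> R * R -> R * R).
Hypothesis fam : twist_family I m n pm pp F.
Let A : set pt := annuli_family I pm pp.
Let n_gt0 := family_n_gt0 fam.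
Let pm_cont := family_pm_cont fam.
Let pp_cont := family_pp_cont fam.
Let pm_periodic := family_pm_periodic fam.
Let pp_periodic := family_pp_periodic fam.
Let pm_lt_pp := family_pm_lt_pp fam.
Let F_twist := family_twist fam.
Let F_analytic1 := family_analytic1 fam.
Let F_analytic2 := family_analytic2 fam.
Let F_twist_interval := family_twist_interval fam.

Let within_lt (f : R * R -> \bar R) (e q : R) (r : \bar R) : I e ->
  {within I `*` [set: R], continuous f} -> (f (e, q) < r)%E ->
  exists2 d : R, 0 < d & forall e' q', I e' -> `|e' - e| < d -> `|q' - q| < d ->
    (f (e', q') < r)%E.
Proof.
move=> Ie /subspace_continuousP /(_ (e, q)) cf fr.
have /cf /(_ _ (open_ereal_lt' fr)) : (I `*` [set: R]) (e, q) by split.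
move=> /nbhs_ballP[d /= d0 Hd]; exists d => // e' q' Ie' ed qd.
apply: (Hd (e', q')); last by split.
by split; rewrite /ball /= distrC.
Qed.

Let within_gt (f : R * R -> \bar R) (e q : R) (r : \bar R) : I e ->
  {within I `*` [set: R], continuous f} -> (r < f (e, q))%E ->
  exists2 d : R, 0 < d & forall e' q', I e' -> `|e' - e| < d -> `|q' - q| < d ->
    (r < f (e', q'))%E.
Proof.
move=> Ie /subspace_continuousP /(_ (e, q)) cf fr.
have /cf /(_ _ (open_ereal_gt' fr)) : (I `*` [set: R]) (e, q) by split.
move=> /nbhs_ballP[d /= d0 Hd]; exists d => // e' q' Ie' ed qd.
apply: (Hd (e', q')); last by split.
by split; rewrite /ball /= distrC.
Qed.

(** The domain is open relative to I, by continuity of the boundary functions on I. *)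
Lemma family_open a : A a -> exists2 r : R, 0 < r & forall z, I z.1 -> norm1 (z - a) < r -> A z.
Proof.
case: a => e [q p] [/= Ie /andP[/= pmp ppp]].
have [s1 /andP[s1m s1p]] := @fiber_nonempty _ (pm e) (fun=> p%:E) q pmp.
have [s2 /andP[s2m s2p]] := @fiber_nonempty _ (fun=> p%:E) (pp e) q ppp.
have [d1 d10 H1] := within_lt Ie pm_cont s1m.
have [d2 d20 H2] := within_gt Ie pp_cont s2p.
rewrite lte_fin in s1p; rewrite lte_fin in s2m.
exists (Num.min (Num.min d1 d2) (Num.min (p - s1) (s2 - p))).
  by rewrite !lt_min d10 d20 !subr_gt0 s1p.
case=> e' [q' p'] /= Ie'; rewrite /norm1 /= !lt_min -!andbA => /and4P[h1 h2 h3 h4].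
have n1 := normr_ge0 (e' - e); have n2 := normr_ge0 (q' - q); have n3 := normr_ge0 (p' - p).
have [pa pb] : - `|p' - p| <= p' - p /\ p' - p <= `|p' - p|.
  by rewrite lerNnormlW// ler_norm.
split=> //=; apply/andP; split => /=.
  have := H1 e' q' Ie'; move=> /(_ _ _)/lt_trans; apply; [lra|lra|].
  by rewrite lte_fin; lra.
have h := H2 e' q' Ie' _ _; apply: lt_trans (h _ _); [|lra|lra].
by rewrite lte_fin; lra.
Qed.

Lemma family_mem e x : I e -> annulus (pm e) (pp e) x -> A (e, x).
Proof. by []. Qed.

Lemma planar_open e : I e -> box_open (annulus (pm e) (pp e)).
Proof.
move=> Ie x Ax; have [r r0 Hr] := family_open (family_mem Ie Ax); exists r => // y yr.
have [] // := Hr (e, y) Ie _.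
by rewrite /norm1 /= subrr normr0 add0r.
Qed.

Lemma planar_strict_diff f e x l : I e -> strict_diff A f (e, x) l ->
  strict_diff2 (annulus (pm e) (pp e)) (fun y => f (e, y)) x l.2.
Proof.
move=> Ie sf eta eta0; have [r r0 Hr] := sf eta eta0; exists r => // y z Ay Az yr zr.
have nE u v : norm1 ((e, u) - (e, v)) = taxi (u - v).
  by rewrite /norm1 /taxi /= subrr normr0 add0r.
have lE u v : lin l ((e, u) - (e, v)) = lin2 l.2 (u - v).
  by rewrite /lin /lin2 /= subrr mulr0 add0r.
have := Hr (e, y) (e, z) (family_mem Ie Ay) (family_mem Ie Az).
by rewrite !nE lE; apply.
Qed.

Definition family_map (z : pt) : pt := (z.1, F z.1 z.2).
Local Notation Phi := family_map.

Lemma planar_data e : I e -> forall x, annulus (pm e) (pp e) x -> exists l1 l2,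
  strict_diff2 (annulus (pm e) (pp e)) (fun y => (F e y).1) x l1 /\
  strict_diff2 (annulus (pm e) (pp e)) (fun y => (F e y).2) x l2.
Proof.
move=> Ie x Ax; have AA := family_mem Ie Ax.
have [l1 [s1 _]] := analytic_regular I F_analytic1 AA.
have [l2 [s2 _]] := analytic_regular I F_analytic2 AA.
by exists l1.2, l2.2; split; [exact: planar_strict_diff s1|exact: planar_strict_diff s2].
Qed.

Lemma family_map_mem z : A z -> A (Phi z).
Proof. by case=> Iz Az; split=> //=; exact: (twist_mem (F_twist Iz)). Qed.

Lemma family_iter k e x : iter k Phi (e, x) = (e, iter k (F e) x).
Proof. by elim: k => //= k ->. Qed.

Lemma family_iter_mem k z : A z -> A (iter k Phi z).
Proof. by move=> Az; elim: k => //= k; exact: family_map_mem. Qed.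

Lemma regular_iter k a : A a ->
  (exists l, regular I A (fun z => (iter k Phi z).2.1) a l) /\
  (exists l, regular I A (fun z => (iter k Phi z).2.2) a l).
Proof.
elim: k a => [|k IHk] a Aa.
  have E1 : (fun z : pt => z.2.1) = lin (0, (1, 0)) by apply/funext => z; rewrite /lin /=; ring.
  have E2 : (fun z : pt => z.2.2) = lin (0, (0, 1)) by apply/funext => z; rewrite /lin /=; ring.
  split; [exists (0, (1, 0))|exists (0, (0, 1))].
    by have := regular_lin I A a (0, (1, 0)); rewrite -E1.
  by have := regular_lin I A a (0, (0, 1)); rewrite -E2.
have [l1 r1] := analytic_regular I F_analytic1 Aa.
have [l2 r2] := analytic_regular I F_analytic2 Aa.
have AF z : A z -> A (z.1, ((F z.1 z.2).1, (F z.1 z.2).2)).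
  by move=> /family_map_mem; rewrite /family_map; case: (F _ _).
have PE (z : pt) : (z.1, ((F z.1 z.2).1, (F z.1 z.2).2)) = Phi z.
  by rewrite /family_map; case: (F _ _).
have [[lq rq] [lp rp]] := IHk (Phi a) (family_map_mem Aa).
rewrite -PE in rq rp.
split.
- exists (lcomp lq l1 l2).
  have := regular_comp Aa AF r1 r2 rq.
  by congr regular; apply/funext => z /=; rewrite PE -iterSr.
- exists (lcomp lp l1 l2).
  have := regular_comp Aa AF r1 r2 rp.
  by congr regular; apply/funext => z /=; rewrite PE -iterSr.
Qed.

Lemma iter_near k a (eta : R) : A a -> 0 < eta -> exists2 r : R, 0 < r &
  forall z, A z -> norm1 (z - a) < r -> norm1 (iter k Phi z - iter k Phi a) < eta.
Proof.
move=> Aa eta0; have [[l1 [s1 _]] [l2 [s2 _]]] := regular_iter k Aa.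
have [r1 r10 H1] := strict_diff_lip s1; have [r2 r20 H2] := strict_diff_lip s2.
pose K : R := 1 + (norm1 l1 + 1) + (norm1 l2 + 1).
have K0 : 0 < K by have := norm1_ge0 l1; have := norm1_ge0 l2; rewrite /K; lra.
exists (Num.min (Num.min r1 r2) (eta / K)) => [|z Az].
  by rewrite !lt_min r10 r20 divr_gt0.
rewrite !lt_min ltr_pdivlMr// -andbA => /and3P[zr1 zr2 zK].
have aa : norm1 (a - a) = 0 by rewrite subrr /norm1 /= normr0; lra.
have h1 := H1 z a Az Aa zr1; rewrite aa in h1; have {}h1 := h1 r10.
have h2 := H2 z a Az Aa zr2; rewrite aa in h2; have {}h2 := h2 r20.
have i1 x : (iter k Phi x).1 = x.1 by case: x => e x; rewrite family_iter.
have -> : norm1 (iter k Phi z - iter k Phi a) = `|z.1 - a.1| +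
   `|(iter k Phi z).2.1 - (iter k Phi a).2.1| + `|(iter k Phi z).2.2 - (iter k Phi a).2.2|.
  by rewrite /norm1 /= !i1.
have : `|z.1 - a.1| <= norm1 (z - a) by rewrite /norm1 /= -addrA lerDl addr_ge0.
by move: zK; rewrite /K; lra.
Qed.

Local Notation pig e g := (periodic_invariant_graph (pm e) (pp e) (F e) m n g).

Lemma family_shift (k : int) e q p : I e -> A (e, (q + k%:~R, p)) = A (e, (q, p)).
Proof.
move=> Ie; rewrite /A /annuli_family /annulus /fiber /=.
by rewrite (periodic_int (pm_periodic Ie)) (periodic_int (pp_periodic Ie)).
Qed.

Lemma family_graph_mem e g q : I e -> pig e g -> A (e, (q, g q)).
Proof. by move=> Ie pg; apply: family_mem Ie (graph_mem pg q). Qed.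

(** The circle map f of the graph increases, which bounds the descents of g through the strict
derivative of F at a. The inverse of f increases as well; written as f ^ (n - 1) minus m, it is
controlled at a by the derivative of F at the point b, the image of a under n - 1 steps translated by
- m, and [inverse_slope] bounds the ascents. *)
Lemma local_slope a : A a -> exists M r : R, [/\ 0 <= M, 0 < r &
  forall e g, I e -> pig e g -> forall u v : R, u < v ->
    norm1 ((e, (u, g u)) - a) < r -> norm1 ((e, (v, g v)) - a) < r ->
    `|g v - g u| <= M * (v - u)].
Proof.
move=> Aa; have Ia : I a.1 by case: Aa.
have Aa2 : annulus (pm a.1) (pp a.1) a.2 by case: Aa.
have aE : a = (a.1, a.2) by case: (a).
set ia := iter n.-1 Phi a.
have Aia : A ia by exact: family_iter_mem.
have ia1 : ia.1 = a.1 by rewrite /ia {1}aE family_iter.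
(* on a periodic graph the preimage of a is the image under n - 1 steps, translated by - m *)
pose b : pt := (a.1, (ia.2.1 - m%:~R, ia.2.2)).
have Ab : A b.
  rewrite /b -mulrNz family_shift//; move: Aia; rewrite -ia1.
  by case: (ia) => ? [].
have Ab2 : annulus (pm a.1) (pp a.1) b.2 by case: Ab.
have [l [sl _]] := analytic_regular I F_analytic1 Aa.
have [l1 [s1 _]] := analytic_regular I F_analytic1 Ab.
have [l2 [s2 _]] := analytic_regular I F_analytic2 Ab.
have tw := F_twist Ia; have oa := planar_open Ia; have ti := F_twist_interval Ia.
have sl' : strict_diff2 (annulus (pm a.1) (pp a.1)) (fun y => (F a.1 y).1) a.2 l.2.
  by rewrite aE in sl; exact: planar_strict_diff Ia sl.
have lp0 : 0 < l.2.2 := twist_partial_gt0 tw oa ti Aa2 sl'.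
have s1' : strict_diff2 (annulus (pm a.1) (pp a.1)) (fun y => (F a.1 y).1) b.2 l1.2.
  exact: planar_strict_diff Ia s1.
have s2' : strict_diff2 (annulus (pm a.1) (pp a.1)) (fun y => (F a.1 y).2) b.2 l2.2.
  exact: planar_strict_diff Ia s2.
have l1p0 : 0 < l1.2.2 := twist_partial_gt0 tw oa ti Ab2 s1'.
have det := twist_det tw oa Ab2 s1' s2'.
have lp20 : 0 < l.2.2 / 2 by rewrite divr_gt0.
have [r1 r10 H1] := sl _ lp20.
pose C : R := `|l1.2.1| + `|l1.2.2| + `|l2.2.1| + `|l2.2.2|.
have C0 : 0 < C.
  have : 0 < `|l1.2.2| by rewrite gtr0_norm.
  have := normr_ge0 l1.2.1; have := normr_ge0 l2.2.1; have := normr_ge0 l2.2.2.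
  by rewrite /C; lra.
pose eta := Num.min (1 / (4 * C)) (l1.2.2 / 2 / (4 * C ^+ 2)).
have eta0 : 0 < eta by rewrite lt_min !divr_gt0// mulr_gt0// exprn_gt0.
have [eta1 eta2] : eta * (4 * C) <= 1 /\ eta * (4 * C ^+ 2) <= l1.2.2 / 2.
  by rewrite -!ler_pdivlMr ?mulr_gt0 ?exprn_gt0// !ge_min !lexx orbT.
have [r2 r20 H2] := s1 _ eta0; have [r3 r30 H3] := s2 _ eta0.
have rb0 : 0 < Num.min r2 r3 by rewrite lt_min r20.
have [r4 r40 H4] := iter_near n.-1 Aa rb0.
pose M1 := (`|l.2.1| + l.2.2 / 2) / (l.2.2 / 2).
pose M2 := (C + l1.2.2 / 2) / (l1.2.2 / 2).
have M10 : 0 <= M1 by rewrite divr_ge0 ?addr_ge0// ltW.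
have M20 : 0 <= M2 by rewrite divr_ge0 ?addr_ge0// ltW// divr_gt0.
exists (M1 + M2), (Num.min r1 r4); split; [exact: addr_ge0|by rewrite lt_min r10|].
move=> e g Ie pg u v uv; rewrite !lt_min => /andP[ur1 ur4] /andP[vr1 vr4].
have twe := F_twist Ie; have oe := planar_open Ie; have tie := F_twist_interval Ie.
have sfe := planar_data Ie.
pose f q := (F e (q, g q)).1.
have fh : {homo f : x y / x < y} := graph_homo twe oe sfe tie pg.
have Ag q : A (e, (q, g q)) := family_graph_mem q Ie pg.
set a1 := v - u; set b1 := g v - g u.
have a10 : 0 < a1 by rewrite subr_gt0.
have dE x y x' y' : (e, (x, y)) - (e, (x', y')) = (0, (x - x', y - y')) :> pt.
  by congr pair; rewrite subrr.
have low : - b1 <= M1 * a1.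
  have := H1 _ _ (Ag v) (Ag u) vr1 ur1.
  rewrite dE /lin /norm1 /= mulr0 normr0 !add0r -/a1 -/b1 -/(f v) -/(f u).
  have fuv : f u < f v by exact: fh.
  rewrite (gtr0_norm a10) ler_norml => /andP[_ h].
  rewrite /M1 mulrAC ler_pdivlMr//.
  have : l.2.1 * a1 <= `|l.2.1| * a1 by rewrite ler_pM2r// ler_norm.
  have [b0|b0] := leP 0 b1; last by rewrite (ltr0_norm b0) in h; lra.
  have : 0 <= (`|l.2.1| + l.2.2 / 2) * a1.
    by apply: mulr_ge0; [apply: addr_ge0 => //; exact: ltW|exact: ltW].
  have : 0 <= b1 * (l.2.2 / 2) by rewrite mulr_ge0// ltW.
  lra.
have up : b1 <= M2 * a1.
  have [b0|b0] := ltP b1 0; first by rewrite (le_trans (ltW b0))// mulr_ge0// ltW.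
  pose pre q := iter n.-1 f q - m%:~R.
  have gsh q : g (q - m%:~R) = g q by rewrite -mulrNz (gam_shift pg).
  have preE q : (e, (pre q, g (pre q))) - b = iter n.-1 Phi (e, (q, g q)) - ia.
    rewrite family_iter (graph_iter pg) /pre gsh /b -ia1.
    by case: (ia) => i1 [i2 i3]; congr pair => /=; congr pair => /=; ring.
  have Fpre q : F e (pre q, g (pre q)) = (q, g q).
    have fsh (k : int) x : f (x + k%:~R) = f x + k%:~R := graph_shift twe pg k x.
    have fper x : iter n f x = x + m%:~R := graph_period pg x.
    have fpre : f (pre q) = q.
      by rewrite /pre -mulrNz fsh -iterS prednK// fper mulrNz addrK.
    by rewrite (graph_map pg) -/(f _) fpre.
  have near q : norm1 ((e, (q, g q)) - a) < r4 -> norm1 ((e, (pre q, g (pre q))) - b) < Num.min r2 r3.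
    by move=> qr; rewrite preE; exact: H4 qr.
  have := near u ur4; rewrite lt_min => /andP[ub2 ub3].
  have := near v vr4; rewrite lt_min => /andP[vb2 vb3].
  have preuv : pre u < pre v.
    rewrite /pre ltrD2r; elim: (n.-1) => //= k; exact: fh.
  have e1 := H2 _ _ (Ag (pre v)) (Ag (pre u)) vb2 ub2.
  have e2 := H3 _ _ (Ag (pre v)) (Ag (pre u)) vb3 ub3.
  rewrite dE /lin /norm1 /= !Fpre /= mulr0 normr0 !add0r -/a1 in e1.
  rewrite dE /lin /norm1 /= !Fpre /= mulr0 normr0 !add0r -/b1 in e2.
  rewrite /M2 mulrAC ler_pdivlMr ?divr_gt0// mulrC.
  apply: (inverse_slope det (erefl C) (ltW eta0) eta1 eta2 l1p0 _ (ltW a10) b0 e1 e2).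
  by rewrite subr_gt0.
rewrite mulrDl ler_norml; apply/andP; split.
  have : 0 <= M2 * a1 by rewrite mulr_ge0// ltW.
  lra.
have : 0 <= M1 * a1 by rewrite mulr_ge0// ltW.
lra.
Qed.

End Family.

(** * Limits of periodic invariant graphs *)

(** Used in place of a convergent subsequence: along one ultrafilter all the heights of the graphs
converge simultaneously. *)
Lemma ultra_segment_cvg {R : realType} (T : Type) (G : set_system T) (u : T -> R) (a b : R) :
  UltraFilter G -> (\forall t \near G, u t \in `[a, b]) ->
  exists2 l : R, l \in `[a, b] & forall d : R, 0 < d -> \forall t \near G, `|u t - l| < d.
Proof.
move=> GU uab; have [l [lab cl]] := @segment_compact R a b (u @ G) _ uab.
exists l => // d d0.
have [//|Gn] := in_ultra_setVsetC [set t | `|u t - l| < d] GU.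
have [x [/= ux lx]] := cl [set x | ~ `|x - l| < d] (ball l d) Gn (nbhsx_ballx l d d0).
by case: ux; rewrite distrC.
Qed.

Lemma const_lipschitz {R : realType} (g : R -> R) (K : R) :
  (forall q q', `|g q' - g q| <= K * `|q' - q|) -> lipschitz g.
Proof.
move=> gK; apply: (@klipschitzW _ _ _ K g); last by move=> -[q q'] _; exact: gK q' q.
by apply: (@globally_properfilter _ _ (0, 0)); split.
Qed.

Section Closed.
Context {R : realType}.
Local Notation pt := (R * (R * R))%type.
Variables (I : set R) (m : int) (n : nat) (pm pp : R -> R -> \bar R) (F : R -> R * R -> R * R).
Hypothesis fam : twist_family I m n pm pp F.
Let A : set pt := annuli_family I pm pp.
Local Notation Phi := (family_map F).
Local Notation pig e g := (periodic_invariant_graph (pm e) (pp e) (F e) m n g).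
Local Notation Spar := (periodic_parameters I pm pp F m n).

Lemma family_sign e g q p : I e -> pig e g -> A (e, (q, p)) ->
  (g q < p -> q + m%:~R < (iter n (F e) (q, p)).1) /\
  (p < g q -> (iter n (F e) (q, p)).1 < q + m%:~R).
Proof.
move=> Ie pg [_ Aqp].
exact: (graph_sign (family_twist fam Ie) (planar_open fam Ie) (planar_data fam Ie)
  (family_twist_interval fam Ie) (family_n_gt0 fam) pg Aqp).
Qed.

(** The heights p1 and p2 given by [annulus_ends] at e0 still work for nearby parameters, and a
periodic graph passes below p1 and above p2 by [family_sign]. *)
Lemma local_bound e0 q0 : I e0 -> exists r p1 p2 : R,
  [/\ 0 < r, A (e0, (q0, p1)), A (e0, (q0, p2)) &
   forall e g q, I e -> pig e g -> `|e - e0| < r -> `|q - q0| < r -> p2 < g q < p1].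
Proof.
move=> Ie0.
have [p1 [p2 [A1 A2 h1 h2]]] := annulus_ends (family_twist fam Ie0) (planar_open fam Ie0)
  (planar_data fam Ie0) (family_twist_interval fam Ie0) (family_pm_lt_pp fam Ie0) q0 (family_n_gt0 fam).
have nn : n%:R * (m%:~R / n%:R) = m%:~R :> R.
  by rewrite mulrC divfK// pnatr_eq0 -lt0n (family_n_gt0 fam).
rewrite nn in h1 h2.
have B1 : A (e0, (q0, p1)) by [].
have B2 : A (e0, (q0, p2)) by [].
have [w1 w10 W1] := family_open fam B1; have [w2 w20 W2] := family_open fam B2.
have [|r1 r10 H1] := iter_near fam n B1 (_ : 0 < ((iter n (F e0) (q0, p1)).1 - (q0 + m%:~R)) / 2).
  by rewrite divr_gt0// subr_gt0.
have [|r2 r20 H2] := iter_near fam n B2 (_ : 0 < ((q0 + m%:~R) - (iter n (F e0) (q0, p2)).1) / 2).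
  by rewrite divr_gt0// subr_gt0.
set g1 := (_ - _) / 2 in H1; set g2 := (_ - _) / 2 in H2.
have g10 : 0 < g1 by rewrite divr_gt0// subr_gt0.
have g20 : 0 < g2 by rewrite divr_gt0// subr_gt0.
exists (Num.min (Num.min (Num.min w1 w2) (Num.min r1 r2)) (Num.min g1 g2) / 2), p1, p2; split=> //.
  by rewrite divr_gt0// !lt_min w10 w20 r10 r20 g10 g20.
move=> e g q Ie pg; set mm := Num.min _ _ => er qr.
have [m1 m2 [m3 m4 m5 m6]] : [/\ mm <= w1, mm <= w2 & [/\ mm <= r1, mm <= r2, mm <= g1 & mm <= g2]].
  by rewrite /mm !ge_min !lexx !orbT.
have zE p : norm1 ((e, (q, p)) - (e0, (q0, p))) = `|e - e0| + `|q - q0|.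
  by rewrite /norm1 /= subrr normr0 addr0.
have zl p : norm1 ((e, (q, p)) - (e0, (q0, p))) < mm by rewrite zE; lra.
have C1 : A (e, (q, p1)) by apply: W1 => //; exact: lt_le_trans (zl p1) m1.
have C2 : A (e, (q, p2)) by apply: W2 => //; exact: lt_le_trans (zl p2) m2.
have k1 := H1 _ C1 (lt_le_trans (zl p1) m3); have k2 := H2 _ C2 (lt_le_trans (zl p2) m4).
rewrite !family_iter in k1 k2.
have fst_le (x y : pt) : `|x.2.1 - y.2.1| <= norm1 (x - y).
  by rewrite /norm1 /= -addrA addrCA lerDl addr_ge0.
have {}k1 := le_lt_trans (fst_le (e, _) (e0, _)) k1.
have {}k2 := le_lt_trans (fst_le (e, _) (e0, _)) k2.
have qq : `|q - q0| < mm by have := normr_ge0 (e - e0); lra.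
move: k1 k2 qq; rewrite /= !ltr_norml => /andP[k1 _] /andP[_ k2] /andP[q1 q2].
have [_ s1] := family_sign Ie pg C1; have [s2 _] := family_sign Ie pg C2.
have gA := family_graph_mem q Ie pg.
have gE : (iter n (F e) (q, g q)).1 = q + m%:~R by case: pg => _ _ _ ->.
apply/andP; split.
  case: (ltgtP p2 (g q)) => // [/s2|E]; first by rewrite /g2 in m6 k2; lra.
  by rewrite -E in gE; rewrite /g2 in m6 k2; lra.
case: (ltgtP (g q) p1) => // [/s1|E]; first by rewrite /g1 in m5 k1; lra.
by rewrite E in gE; rewrite /g1 in m5 k1; lra.
Qed.

Lemma slope_leW (g : R -> R) K K' q : K <= K' -> slope_le g K q -> slope_le g K' q.
Proof.
move=> KK [d d0 Hd]; exists d => // q' /Hd /le_trans; apply.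
by rewrite ler_wpM2r.
Qed.

(** By [local_bound] a periodic graph of a nearby parameter passes through a compact segment of the
fiber, each point of which has a slope bound by [local_slope]. The Lipschitz constant of each graph
only serves to keep its points near that segment. *)
Lemma local_uniform_slope e0 q0 : I e0 -> exists2 K : R, 1 <= K &
  forall e g q, I e -> pig e g -> `|e - e0| < K^-1 -> `|q - q0| < K^-1 -> slope_le g K q.
Proof.
move=> Ie0; have [rb [p1 [p2 [rb0 A1 A2 Hb]]]] := local_bound q0 Ie0.
pose P K p := forall e g q, I e -> pig e g -> `|e - e0| < K^-1 -> `|q - q0| < K^-1 ->
  g q = p -> slope_le g K q.
have [|K K1 HK] := @segment_cover _ P p2 p1.
  move=> p; rewrite in_itv /= => pI.
  have Ap : A (e0, (q0, p)).
    by split=> //=; exact: (fiber_between (proj2 A2) (proj2 A1)).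
  have [M [rho [M0 rho0 Hs]]] := local_slope fam Ap.
  exists (rho / 4), (Num.max M (4 / rho)); split; first by rewrite divr_gt0.
  move=> p' K pp'; rewrite ge_max => /andP[MK rK] e g q Ie pg eK qK gq.
  have K0 : 0 < K by apply: lt_le_trans rK; rewrite divr_gt0.
  have Kr : K^-1 <= rho / 4 by rewrite -[rho / 4]invf_div lef_pV2 ?posrE// divr_gt0.
  have [L L0 gL] := lipschitz_const (proj2 (let: And4 h _ _ _ := pg in h)).
  have L1 : 0 < 1 + L by lra.
  have zq : norm1 ((e, (q, g q)) - (e0, (q0, p))) < 3 * (rho / 4).
    by rewrite /norm1 /= gq; lra.
  apply: (slope_leW MK); exists (rho / 4 / (1 + L)) => [|q']; first by rewrite !divr_gt0.
  rewrite ltr_pdivlMr// => qq'.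
  have zq' : norm1 ((e, (q', g q')) - (e0, (q0, p))) < rho.
    have dd : norm1 ((e, (q', g q')) - (e, (q, g q))) <= `|q' - q| * (1 + L).
      by rewrite /norm1 /= subrr normr0 add0r mulrDr mulr1 lerD2l mulrC.
    rewrite -(subrKA (e, (q, g q))) (le_lt_trans (norm1D _ _))//; lra.
  have zq4 : norm1 ((e, (q, g q)) - (e0, (q0, p))) < rho by lra.
  have [h|h|->] := ltgtP q q'.
  - by have := Hs e g Ie pg q q' h zq4 zq'; rewrite (@gtr0_norm _ (q' - q)) ?subr_gt0.
  - have := Hs e g Ie pg q' q h zq' zq4.
    by rewrite distrC (distrC q') (@gtr0_norm _ (q - q')) ?subr_gt0.
  - by rewrite !subrr normr0 mulr0.
have Krb : K <= Num.max K rb^-1 by rewrite le_max lexx.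
exists (Num.max K rb^-1); first exact: le_trans Krb.
have K0 : 0 < K by lra.
have KKb : (Num.max K rb^-1)^-1 <= K^-1.
  by rewrite lef_pV2 ?posrE// (lt_le_trans K0).
have Kbr : (Num.max K rb^-1)^-1 <= rb.
  rewrite -[leRHS]invrK lef_pV2 ?posrE ?invr_gt0//; last exact: (lt_le_trans K0).
  by rewrite le_max lexx orbT.
move=> e g q Ie pg eK qK; apply: (slope_leW Krb).
have gqI : g q \in `[p2, p1].
  rewrite in_itv /=; have /andP[h1 h2] := Hb e g q Ie pg (lt_le_trans eK Kbr) (lt_le_trans qK Kbr).
  by rewrite !ltW.
exact: (HK (g q) gqI e g q Ie pg (lt_le_trans eK KKb) (lt_le_trans qK KKb) erefl).
Qed.

Lemma uniform_lipschitz e0 : I e0 -> exists2 K : R, 1 <= K &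
  forall e g, I e -> pig e g -> `|e - e0| < K^-1 ->
  forall q q', `|g q' - g q| <= K * `|q' - q|.
Proof.
move=> Ie0.
pose P K q := forall e g, I e -> pig e g -> `|e - e0| < K^-1 -> slope_le g K q.
have [|K K1 HK] := @segment_cover _ P 0 1.
  move=> q0 _; have [K K1 HK] := local_uniform_slope q0 Ie0.
  have K0 : 0 < K by lra.
  exists K^-1, K; split; first by rewrite invr_gt0.
  move=> q K' qK KK' e g Ie pg eK; apply: (slope_leW KK'); apply: (HK e) => //.
  by apply: (lt_le_trans eK); rewrite lef_pV2 ?posrE// (lt_le_trans K0).
exists K => // e g Ie pg eK; apply: slope_lipschitz; first by lra.
move=> q; have [k [q0 [-> q0I]]] := floor_shift q.
have [d d0 Hd] := HK q0 q0I e g Ie pg eK; exists d => // q'.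
have -> : q' - (q0 + k%:~R) = (q' - k%:~R) - q0 by ring.
by rewrite (gam_shift pg) => /Hd; rewrite -mulrNz (gam_shift pg).
Qed.

(** The pointwise limit g0 of the graphs along an ultrafilter inherits the uniform Lipschitz bound,
hence the convergence is good enough for invariance and periodicity to pass to the limit. *)
Lemma limit_parameter e0 : I e0 -> limit_point Spar e0 -> Spar e0.
Proof.
move=> Ie0 lim.
have [K K1 HK] := uniform_lipschitz Ie0.
have K0 : 0 < K by lra.
have [gam gamP] : exists gam : R -> R -> R, forall e, Spar e -> pig e (gam e).
  have H e : exists g : R -> R, Spar e -> pig e g.
    by have [[_ [g pg]]|nS] := pselect (Spar e); [exists g|exists (fun=> 0)].
  have [gam gamP] := choice H; by exists gam.
have FF : ProperFilter (within Spar (dnbhs e0)).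
  split; last exact: within_filter.
  move=> [d /= d0 Hd]; have [e [ne Se be]] := lim _ (nbhsx_ballx e0 d d0).
  exact: (Hd e be ne Se).
have [G [GU FG]] := ultraFilterLemma FF.
have GS : G Spar by apply: FG; exact: withinT.
have Gd (d : R) : 0 < d -> G [set e | `|e - e0| < d].
  move=> d0; apply: FG; exists d => // e /= be _ _.
  by rewrite distrC; exact: be.
have lq q : exists2 l, A (e0, (q, l)) & forall d : R, 0 < d -> \forall e \near G, `|gam e q - l| < d.
  have [r [p1 [p2 [r0 A1 A2 Hb]]]] := local_bound q Ie0.
  have [|l] := @ultra_segment_cvg _ _ G (fun e => gam e q) p2 p1 GU.
    apply: filterS (filterI GS (Gd r r0)) => e [Se er].
    have qr : `|q - q| < r by rewrite subrr normr0.
    have /andP[h1 h2] := Hb e (gam e) q (proj1 Se) (gamP e Se) er qr.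
    by rewrite in_itv /= !ltW.
  rewrite in_itv /= => lI Hl; exists l => //.
  by split=> //=; exact: (fiber_between (proj2 A2) (proj2 A1)).
have {}lq q : exists l, A (e0, (q, l)) /\ forall d : R, 0 < d -> \forall e \near G, `|gam e q - l| < d.
  by have [l] := lq q; exists l.
have [g0 g0P] := choice lq.
have approx (d : R) q1 q2 : 0 < d -> exists e, [/\ Spar e, `|e - e0| < d, `|gam e q1 - g0 q1| < d &
    `|gam e q2 - g0 q2| < d].
  move=> d0.
  have [e [[Se ed] [h1 h2]]] := filter_ex (filterI (filterI GS (Gd d d0))
    (filterI ((g0P q1).2 d d0) ((g0P q2).2 d d0))).
  by exists e.
have Kinv : 0 < K^-1 by rewrite invr_gt0.
have le0 (x C : R) : 0 < C -> (forall d : R, 0 < d -> d <= K^-1 -> `|x| <= C * d) -> x = 0.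
  move=> C0 H; apply/eqP; rewrite -normr_le0; apply/ler_addgt0Pr => d d0; rewrite add0r.
  have := H (Num.min (d / C) K^-1); rewrite lt_min divr_gt0//= => /(_ Kinv).
  rewrite ge_min lexx orbT => /(_ isT) /le_trans; apply.
  by rewrite mulrC -ler_pdivlMr// ge_min lexx.
have glip q q' : `|g0 q' - g0 q| <= K * `|q' - q|.
  apply/ler_addgt0Pr => d d0.
  pose d1 := Num.min (d / 2) K^-1.
  have d10 : 0 < d1 by rewrite lt_min Kinv divr_gt0.
  have [d1d d1K] : d1 <= d / 2 /\ d1 <= K^-1 by rewrite !ge_min !lexx orbT.
  have [e [Se ed h1 h2]] := approx d1 q q' d10.
  have h3 := HK e (gam e) (proj1 Se) (gamP e Se) (lt_le_trans ed d1K) q q'.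
  have -> : g0 q' - g0 q = (gam e q' - gam e q) + ((gam e q - g0 q) - (gam e q' - g0 q')) by ring.
  rewrite (le_trans (ler_normD _ _))// (le_trans (lerD (lexx _) (ler_normB _ _)))//; lra.
have gper q : g0 (q + 1) = g0 q.
  apply/eqP; rewrite -subr_eq0; apply/eqP; apply: (le0 _ 2) => // d d0 dK.
  have [e [Se ed h1 h2]] := approx d (q + 1) q d0.
  have E : gam e (q + 1) = gam e q by case: (gamP e Se) => -[+ _] _ _ _; exact.
  have -> : g0 (q + 1) - g0 q = (gam e q - g0 q) - (gam e (q + 1) - g0 (q + 1)) by rewrite E; ring.
  by rewrite (le_trans (ler_normB _ _))//; lra.
have conv k q (d : R) : 0 < d -> exists2 r : R, 0 < r & forall e, Spar e -> `|e - e0| < r ->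
    `|gam e q - g0 q| < r ->
    norm1 (iter k Phi (e, (q, gam e q)) - iter k Phi (e0, (q, g0 q))) < d.
  move=> d0; have [r r0 Hr] := iter_near fam k (g0P q).1 d0.
  exists (r / 2) => [|e Se er gr]; first by rewrite divr_gt0.
  apply: Hr; first exact: (family_graph_mem q (proj1 Se) (gamP e Se)).
  by rewrite /norm1 /= subrr normr0; lra.
have n2 (e : R) (x y : R * R) : norm1 ((e, x) - (e0, y)) = `|e - e0| + `|x.1 - y.1| + `|x.2 - y.2|.
  by [].
have gmap q : F e0 (q, g0 q) = ((F e0 (q, g0 q)).1, g0 (F e0 (q, g0 q)).1).
  case E : (F e0 (q, g0 q)) => [Q P] /=; congr pair.
  apply/eqP; rewrite -subr_eq0; apply/eqP; apply: (le0 _ (2 + K)) => [|d d0 dK]; first by lra.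
  have [r r0 Hr] := conv 1%N q d d0.
  have [e [Se ed h1 h2]] := approx (Num.min r d) q Q ltac:(by rewrite lt_min r0).
  move: ed h1 h2; rewrite !lt_min => /andP[er ed] /andP[h1 _] /andP[_ h2].
  have := Hr e Se er h1; rewrite !family_iter /= E.
  rewrite (graph_map (gamP e Se)); set fe := (F e _).1; rewrite n2 /= => h3.
  have h4 := HK e (gam e) (proj1 Se) (gamP e Se) (lt_le_trans ed dK) Q fe.
  have := normr_ge0 (e - e0); have := normr_ge0 (fe - Q); have := normr_ge0 (gam e fe - P) => n3 n4 n5.
  have -> : P - g0 Q = (gam e fe - gam e Q) - (gam e fe - P) + (gam e Q - g0 Q) by ring.
  have h5 : K * `|fe - Q| <= K * d by rewrite ler_wpM2l//; lra.
  rewrite (le_trans (ler_normD _ _))// (le_trans (lerD (ler_normB _ _) (lexx _)))//; lra.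
split=> //; exists g0; split.
- by split; [exact: gper|exact: const_lipschitz glip].
- by move=> _ [q _ <-]; exact: (proj2 (g0P q).1).
- by move=> _ [_ [q _ <-] <-]; rewrite gmap; exists (F e0 (q, g0 q)).1.
move=> q; rewrite [LHS]surjective_pairing.
have E k : iter k (F e0) (q, g0 q) = (iter k Phi (e0, (q, g0 q))).2 by rewrite family_iter.
have Hn (d : R) : 0 < d -> d <= K^-1 -> exists e, [/\ `|q + m%:~R - (iter n (F e0) (q, g0 q)).1| <= d,
    `|gam e q - (iter n (F e0) (q, g0 q)).2| <= d & `|gam e q - g0 q| <= d].
  move=> d0 dK; have [r r0 Hr] := conv n q d d0.
  have [e [Se ed h1 _]] := approx (Num.min r d) q q ltac:(by rewrite lt_min r0).
  move: ed h1; rewrite !lt_min => /andP[er ed] /andP[h1 h2].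
  have := Hr e Se er h1; rewrite !family_iter; have [_ _ _ ->] := gamP e Se.
  rewrite n2 /= => h3; exists e.
  have := normr_ge0 (e - e0); have := normr_ge0 (q + m%:~R - (iter n (F e0) (q, g0 q)).1).
  have := normr_ge0 (gam e q - (iter n (F e0) (q, g0 q)).2) => *; split; lra.
congr pair; apply/eqP; rewrite -subr_eq0; apply/eqP.
  apply: (le0 _ 1) => // d d0 dK; have [e [h1 _ _]] := Hn d d0 dK.
  by rewrite mul1r distrC.
apply: (le0 _ 2) => // d d0 dK; have [e [_ h1 h2]] := Hn d d0 dK.
have -> : (iter n (F e0) (q, g0 q)).2 - g0 q =
  (gam e q - g0 q) - (gam e q - (iter n (F e0) (q, g0 q)).2) by ring.
by rewrite (le_trans (ler_normB _ _))//; lra.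
Qed.

End Closed.

(** * Torsion in a tube around a periodic graph *)

Section TubeAroundGraph.
Context {R : realType}.
Local Notation pt := (R * (R * R))%type.
Variables (I : set R) (m : int) (n : nat) (pm pp : R -> R -> \bar R) (F : R -> R * R -> R * R).
Hypothesis fam : twist_family I m n pm pp F.
Let A : set pt := annuli_family I pm pp.
Local Notation Phi := (family_map F).
Local Notation pig e g := (periodic_invariant_graph (pm e) (pp e) (F e) m n g).
Let Qn e q p := (iter n (F e) (q, p)).1.

(** Linear growth in p, observed on one side only, determines the sign of the partial derivative. *)
Lemma strict_diff_growth f e q p l (c : R) : A (e, (q, p)) -> 0 < c ->
  strict_diff A f (e, (q, p)) l ->
  (exists2 r : R, 0 < r & forall h, 0 < h -> h < r -> A (e, (q, p + h)) ->
     c * h <= f (e, (q, p + h)) - f (e, (q, p))) -> 0 < l.2.2.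
Proof.
move=> Aa c0 sf [r r0 Hr]; have c20 : 0 < c / 2 by rewrite divr_gt0.
have [s s0 Hs] := sf _ c20; have [t t0 Ht] := family_open fam Aa.
pose h := Num.min r (Num.min s t) / 2.
have m0 : 0 < Num.min r (Num.min s t) by rewrite !lt_min r0 s0.
have [m1 m2 m3] : [/\ Num.min r (Num.min s t) <= r, Num.min r (Num.min s t) <= s
   & Num.min r (Num.min s t) <= t] by rewrite !ge_min !lexx !orbT.
have h0 : 0 < h by rewrite divr_gt0.
have hm : h < Num.min r (Num.min s t) by rewrite /h; lra.
have vE : (e, (q, p + h)) - (e, (q, p)) = (0, (0, h)) :> pt.
  by congr pair; rewrite ?subrr//; congr pair; rewrite ?subrr//= addrAC subrr add0r.
have nE : norm1 ((e, (q, p + h)) - (e, (q, p))) = h.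
  by rewrite vE /norm1 /= normr0 !add0r gtr0_norm.
have Ah : A (e, (q, p + h)) by apply: Ht; [case: Aa|rewrite nE (lt_le_trans hm)].
have := Hs _ _ Ah Aa; rewrite nE vE subrr [norm1 0]/norm1 /lin /= normr0 !addr0.
rewrite !mulr0 !add0r => /(_ (lt_le_trans hm m2) s0).
have := Hr h h0 (lt_le_trans hm m1) Ah.
rewrite ler_norml => k /andP[_ k2].
have ch : 0 < c / 2 * h by rewrite mulr_gt0.
by rewrite -(pmulr_lgt0 _ h0); lra.
Qed.

(** [graph_torsion] turns the growth of the first step, given by the twist, into growth of the n-th
iterate. *)
Lemma torsion_gt0 e g q l : I e -> pig e g ->
  strict_diff A (fun z => (iter n Phi z).2.1) (e, (q, g q)) l -> 0 < l.2.2.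
Proof.
move=> Ie pg sf.
have Aq := family_graph_mem q Ie pg.
have tw := family_twist fam Ie; have oa := planar_open fam Ie.
have ti := family_twist_interval fam Ie; have sd := planar_data fam Ie.
have [l1 [l2 [s1 s2 l1p det]]] := twist_data tw oa sd ti (proj2 Aq).
have [K K0 HK] := graph_torsion tw oa sd ti (family_n_gt0 fam) pg.
have l20 : 0 < l1.2 / 2 by rewrite divr_gt0.
have [r r0 Hr] := s1 _ l20.
apply: (@strict_diff_growth _ e q (g q) l (l1.2 / 2 / K) Aq _ sf); first by rewrite divr_gt0.
exists r => // h h0 hr Ah; rewrite !family_iter /=.
have [k1 _] := HK q (g q + h) (proj2 Ah).
have {}k1 := k1 _; rewrite ltrDl in k1; have {}k1 := k1 h0.
have gE : (iter n (F e) (q, g q)).1 = q + m%:~R by case: pg => _ _ _ ->.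
rewrite gE; apply: le_trans k1; rewrite mulrAC ler_pM2r ?invr_gt0//.
have vE : (q, g q + h) - (q, g q) = (0, h) :> R * R.
  by congr pair; rewrite ?subrr//= addrAC subrr add0r.
have tE : taxi ((0, h) : R * R) = h by rewrite /taxi /= normr0 add0r gtr0_norm.
have t0 : taxi (0 : R * R) = 0 by rewrite /taxi /= normr0 addr0.
have lE : lin2 l1 (0, h) = l1.2 * h by rewrite /lin2 /= mulr0 add0r.
have := Hr _ _ (proj2 Ah) (proj2 Aq); rewrite vE subrr tE t0 lE => /(_ hr r0).
by rewrite ler_norml => /andP[k _]; lra.
Qed.

Section tube.
Variables (e0 : R) (g0 : R -> R).
Hypotheses (Ie0 : I e0) (pg0 : pig e0 g0).

Let invK_le (K r : R) : 0 < r -> r^-1 <= K -> K^-1 <= r.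
Proof.
move=> r0 rK; rewrite -[leRHS]invrK lef_pV2 ?posrE ?invr_gt0//.
by rewrite (lt_le_trans _ rK)// invr_gt0.
Qed.

(** Positivity of the torsion at the points of the graph, made uniform over a tube and over nearby
parameters by compactness; one constant K is used for all bounds. *)
Lemma tube_growth : exists2 K : R, 1 <= K & forall q e, I e -> `|e - e0| < K^-1 ->
  (forall q1 p1, `|q1 - q| < K^-1 -> `|p1 - g0 q| < K^-1 -> A (e, (q1, p1))) /\
  (forall q1 q2 p1 p2, `|q1 - q| < K^-1 -> `|q2 - q| < K^-1 -> `|p1 - g0 q| < K^-1 ->
     `|p2 - g0 q| < K^-1 -> p1 <= p2 ->
     K^-1 * (p2 - p1) - K * `|q2 - q1| <= Qn e q2 p2 - Qn e q1 p1).
Proof.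
pose P K q := forall e, I e -> `|e - e0| < K^-1 ->
  (forall q1 p1, `|q1 - q| < K^-1 -> `|p1 - g0 q| < K^-1 -> A (e, (q1, p1))) /\
  (forall q1 q2 p1 p2, `|q1 - q| < K^-1 -> `|q2 - q| < K^-1 -> `|p1 - g0 q| < K^-1 ->
     `|p2 - g0 q| < K^-1 -> p1 <= p2 ->
     K^-1 * (p2 - p1) - K * `|q2 - q1| <= Qn e q2 p2 - Qn e q1 p1).
have [L L0 gL] := lipschitz_const (proj2 (let: And4 h _ _ _ := pg0 in h)).
have [|K K1 HK] := @segment_cover _ P 0 1.
  move=> q0 _; have Aq := family_graph_mem q0 Ie0 pg0.
  have [[l [sl _]] _] := regular_iter fam n Aq.
  have lp0 := torsion_gt0 Ie0 pg0 sl.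
  have [|r r0 Hr] := sl (l.2.2 / 2); first by rewrite divr_gt0.
  have [s s0 Hs] := family_open fam Aq.
  pose rho := Num.min r s; have rho0 : 0 < rho by rewrite lt_min r0.
  have [rr rs] : rho <= r /\ rho <= s by rewrite !ge_min !lexx orbT.
  have L1 : 0 < 1 + L by lra.
  exists (rho / 4 / (1 + L)), (Num.max (8 / rho) (Num.max ((l.2.2 / 2)^-1) (`|l.2.1| + l.2.2 / 2))).
  split=> [|q K]; first by rewrite !divr_gt0.
  rewrite ltr_pdivlMr// !ge_max => qq /and3P[K1 K2 K3].
  have Kr : K^-1 <= rho / 8.
    by apply: invK_le; [rewrite divr_gt0|rewrite invf_div].
  have Kl : K^-1 <= l.2.2 / 2 by apply: invK_le => //; rewrite divr_gt0.
  move=> e Ie eK.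
  have gq : `|q - q0| + `|g0 q - g0 q0| < rho / 4.
    by have := gL q0 q; move: qq; rewrite mulrDr mulr1; lra.
  have near q1 p1 : `|q1 - q| < K^-1 -> `|p1 - g0 q| < K^-1 ->
      norm1 ((e, (q1, p1)) - (e0, (q0, g0 q0))) < rho.
    move=> q1K p1K; rewrite /norm1 /=.
    have := ler_distD q q1 q0; have := ler_distD (g0 q) p1 (g0 q0); lra.
  have AA q1 p1 : `|q1 - q| < K^-1 -> `|p1 - g0 q| < K^-1 -> A (e, (q1, p1)).
    by move=> h1 h2; apply: Hs => //; exact: lt_le_trans (near _ _ h1 h2) rs.
  split=> // q1 q2 p1 p2 q1K q2K p1K p2K p12.
  have := Hr _ _ (AA _ _ q2K p2K) (AA _ _ q1K p1K) (lt_le_trans (near _ _ q2K p2K) rr)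
    (lt_le_trans (near _ _ q1K p1K) rr).
  rewrite !family_iter /lin /norm1 /= subrr mulr0 normr0 !add0r => h.
  have pE : `|p2 - p1| = p2 - p1 by rewrite ger0_norm ?subr_ge0.
  rewrite pE ler_norml in h; move: h => /andP[h _].
  have pp0 : 0 <= p2 - p1 by rewrite subr_ge0.
  have h1 : K^-1 * (p2 - p1) <= l.2.2 / 2 * (p2 - p1) by rewrite ler_wpM2r.
  have h2 : (`|l.2.1| + l.2.2 / 2) * `|q2 - q1| <= K * `|q2 - q1| by rewrite ler_wpM2r.
  have h3 : - (`|l.2.1| * `|q2 - q1|) <= l.2.1 * (q2 - q1).
    by rewrite -normrM lerNl -normrN ler_norm.
  rewrite /Qn; lra.
exists K => // q e Ie eK; have [k [q0 [-> q0I]]] := floor_shift q.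
have [AA Gr] := HK q0 q0I e Ie eK.
have g0k : g0 (q0 + k%:~R) = g0 q0 := gam_shift pg0 k q0.
have sh q1 : q1 - (q0 + k%:~R) = (q1 - k%:~R) - q0 by ring.
have AA' q1 p1 : `|q1 - (q0 + k%:~R)| < K^-1 -> `|p1 - g0 (q0 + k%:~R)| < K^-1 -> A (e, (q1, p1)).
  rewrite sh g0k => h1 h2; have := AA _ _ h1 h2.
  by have := family_shift fam (- k) q1 p1 Ie; rewrite mulrNz => E; rewrite /A E.
split=> // q1 q2 p1 p2; rewrite !sh !g0k => q1K q2K p1K p2K p12.
have QE q3 p3 : `|q3 - k%:~R - q0| < K^-1 -> `|p3 - g0 q0| < K^-1 ->
    Qn e q3 p3 = Qn e (q3 - k%:~R) p3 + k%:~R.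
  move=> h1 h2; rewrite /Qn -{1}(subrK k%:~R q3).
  by rewrite (iter_shift (family_twist fam Ie))//; exact: proj2 (AA _ _ h1 h2).
rewrite (QE q2 p2)// (QE q1 p1)//.
have E1 : q2 - k%:~R - (q1 - k%:~R) = q2 - q1 by ring.
have := Gr _ _ _ _ q1K q2K p1K p2K p12; rewrite E1 => /le_trans; apply.
by rewrite opprD addrACA subrr addr0.
Qed.

(** By compactness of one period of the graph. *)
Lemma tube_close (eta : R) : 0 < eta -> exists2 K : R, 1 <= K & forall q e p, I e ->
  `|e - e0| < K^-1 -> `|p - g0 q| < K^-1 ->
  [/\ A (e, (q, p)), `|(F e (q, p)).1 - (F e0 (q, g0 q)).1| < eta,
     `|(F e (q, p)).2 - (F e0 (q, g0 q)).2| < eta & `|Qn e q p - (q + m%:~R)| < eta].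
Proof.
move=> eta0; have e20 : 0 < eta / 2 by rewrite divr_gt0.
pose P K q := forall e p, I e -> `|e - e0| < K^-1 -> `|p - g0 q| < K^-1 ->
  [/\ A (e, (q, p)), `|(F e (q, p)).1 - (F e0 (q, g0 q)).1| < eta,
     `|(F e (q, p)).2 - (F e0 (q, g0 q)).2| < eta & `|Qn e q p - (q + m%:~R)| < eta].
have [L L0 gL] := lipschitz_const (proj2 (let: And4 h _ _ _ := pg0 in h)).
have gE q : Qn e0 q (g0 q) = q + m%:~R by rewrite /Qn; case: pg0 => _ _ _ ->.
have [|K K1 HK] := @segment_cover _ P 0 1.
  move=> q0 _; have Aq := family_graph_mem q0 Ie0 pg0.
  have [r1 r10 H1] := iter_near fam 1 Aq e20.
  have [r2 r20 H2] := iter_near fam n Aq e20.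
  have [s s0 Hs] := family_open fam Aq.
  pose rho := Num.min (Num.min r1 r2) s; have rho0 : 0 < rho by rewrite !lt_min r10 r20.
  have [rr1 rr2 rs] : [/\ rho <= r1, rho <= r2 & rho <= s] by rewrite !ge_min !lexx !orbT.
  have L1 : 0 < 1 + L by lra.
  exists (rho / 4 / (1 + L)), (8 / rho); split=> [|q K]; first by rewrite !divr_gt0.
  rewrite ltr_pdivlMr// => qq K1.
  have Kr : K^-1 <= rho / 8.
    by apply: invK_le; [rewrite divr_gt0|rewrite invf_div].
  move=> e p Ie eK pK.
  have gq : `|q - q0| + `|g0 q - g0 q0| < rho / 4.
    by have := gL q0 q; move: qq; rewrite mulrDr mulr1; lra.
  have z1 : norm1 ((e, (q, p)) - (e0, (q0, g0 q0))) < rho.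
    by rewrite /norm1 /=; have := ler_distD (g0 q) p (g0 q0); lra.
  have z2 : norm1 ((e0, (q, g0 q)) - (e0, (q0, g0 q0))) < rho.
    by rewrite /norm1 /= subrr normr0; lra.
  have A1 : A (e, (q, p)) by apply: Hs => //; exact: lt_le_trans z1 rs.
  have A2 : A (e0, (q, g0 q)) := family_graph_mem q Ie0 pg0.
  have cmp (x y w : pt) : norm1 (x - w) < eta / 2 -> norm1 (y - w) < eta / 2 ->
      `|x.2.1 - y.2.1| < eta /\ `|x.2.2 - y.2.2| < eta.
    move=> xw yw; have : norm1 (x - y) < eta.
      rewrite -(subrKA w) (le_lt_trans (norm1D _ _))// -(norm1N (w - y)) opprB.
      by rewrite (splitr eta) ltrD.
    rewrite /norm1 /=; have := normr_ge0 (x.1 - y.1); have := normr_ge0 (x.2.1 - y.2.1).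
    by have := normr_ge0 (x.2.2 - y.2.2) => *; split; lra.
  have [c1 c2] := cmp _ _ _ (H1 _ A1 (lt_le_trans z1 rr1)) (H1 _ A2 (lt_le_trans z2 rr1)).
  have [c3 _] := cmp _ _ _ (H2 _ A1 (lt_le_trans z1 rr2)) (H2 _ A2 (lt_le_trans z2 rr2)).
  rewrite !family_iter /= in c1 c2 c3.
  by split=> //; rewrite -gE.
exists K => // q e p Ie eK; have [k [q0 [-> q0I]]] := floor_shift q.
rewrite (gam_shift pg0) => pK.
have [A1 c1 c2 c3] := HK q0 q0I e p Ie eK pK.
have A0 := proj2 (family_graph_mem q0 Ie0 pg0).
split; first by have E := family_shift fam k q0 p Ie; rewrite /A E.
- rewrite (twist_lift (family_twist fam Ie) k (proj2 A1)) (twist_lift (family_twist fam Ie0) k A0) /=.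
  by rewrite opprD addrACA subrr addr0.
- by rewrite (twist_lift (family_twist fam Ie) k (proj2 A1)) (twist_lift (family_twist fam Ie0) k A0).
rewrite /Qn (iter_shift (family_twist fam Ie) n k (proj2 A1)) /=.
by rewrite (addrAC q0) opprD addrACA subrr addr0.
Qed.

End tube.

End TubeAroundGraph.

(** * The radial graph *)

Section RadialGraph.
Context {R : realType}.
Local Notation pt := (R * (R * R))%type.
Variables (I : set R) (m : int) (n : nat) (pm pp : R -> R -> \bar R) (F : R -> R * R -> R * R).
Hypothesis fam : twist_family I m n pm pp F.
Let A : set pt := annuli_family I pm pp.
Local Notation Phi := (family_map F).
Local Notation pig e g := (periodic_invariant_graph (pm e) (pp e) (F e) m n g).
Let Qn e q p := (iter n (F e) (q, p)).1.

(** In the tube the equation Qn e q p = q + m has at most one solution, by the growth clause, and a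
solution by the intermediate value theorem: at height tau above and below g0 the growth t * tau
exceeds the defect at g0, which is small near e0. The fourth clause says that images of points near
g0 remain in the tube, where uniqueness is available. *)
Lemma radial_graph e0 g0 : I e0 -> pig e0 g0 -> exists (t L d tau : R) (gam : R -> R -> R),
  [/\ [/\ 0 < t, 0 < d, 0 < tau, tau < t & 0 <= L],
     forall e q p, I e -> `|e - e0| < d -> `|p - g0 q| < t -> A (e, (q, p)),
     forall e q1 q2 p1 p2 q, I e -> `|e - e0| < d -> `|q1 - q| < t -> `|q2 - q| < t ->
       `|p1 - g0 q| < t -> `|p2 - g0 q| < t -> p1 <= p2 ->
       t * (p2 - p1) - L * `|q2 - q1| <= Qn e q2 p2 - Qn e q1 p1,
     forall e q p, I e -> `|e - e0| < d -> `|p - g0 q| <= tau ->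
       `|(F e (q, p)).2 - g0 (F e (q, p)).1| < t &
     forall e q, I e -> `|e - e0| < d ->
       `|gam e q - g0 q| <= tau /\ Qn e q (gam e q) = q + m%:~R].
Proof.
move=> Ie0 pg0.
have [K K1 HK] := tube_growth fam Ie0 pg0.
have [L L0 gL] := lipschitz_const (proj2 (let: And4 h _ _ _ := pg0 in h)).
pose t := K^-1; have K0 : 0 < K by lra.
have t0 : 0 < t by rewrite invr_gt0.
have L1 : 0 < 2 * (1 + L) by lra.
have [K3 K31 H3] := tube_close fam Ie0 pg0 (divr_gt0 t0 L1).
have t30 : 0 < K3^-1 by rewrite invr_gt0; lra.
pose tau := Num.min t K3^-1 / 2.
have mt0 : 0 < Num.min t K3^-1 by rewrite lt_min t0.
have tau0 : 0 < tau by rewrite divr_gt0.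
have [mt mt3] : Num.min t K3^-1 <= t /\ Num.min t K3^-1 <= K3^-1 by rewrite !ge_min !lexx orbT.
have taut : tau < t by rewrite /tau; lra.
have taut3 : tau < K3^-1 by rewrite /tau; lra.
have tt0 : 0 < t * tau / 2 by rewrite divr_gt0// mulr_gt0.
have [K4 K41 H4] := tube_close fam Ie0 pg0 tt0.
have t40 : 0 < K4^-1 by rewrite invr_gt0; lra.
pose d := Num.min t (Num.min K3^-1 K4^-1).
have d0 : 0 < d by rewrite !lt_min t0 t30.
have [dt d3 d4] : [/\ d <= t, d <= K3^-1 & d <= K4^-1] by rewrite !ge_min !lexx !orbT.
have qq (q : R) : `|q - q| < t by rewrite subrr normr0.
have AA e q p : I e -> `|e - e0| < d -> `|p - g0 q| < t -> A (e, (q, p)).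
  by move=> Ie ed pt; apply: (proj1 (HK q e Ie (lt_le_trans ed dt))).
have Gr e q1 q2 p1 p2 q : I e -> `|e - e0| < d -> `|q1 - q| < t -> `|q2 - q| < t ->
       `|p1 - g0 q| < t -> `|p2 - g0 q| < t -> p1 <= p2 ->
       t * (p2 - p1) - K * `|q2 - q1| <= Qn e q2 p2 - Qn e q1 p1.
  move=> Ie ed h1 h2 h3 h4 h5.
  exact: (proj2 (HK q e Ie (lt_le_trans ed dt)) _ _ _ _ h1 h2 h3 h4 h5).
have [gam gamP] : exists gam : R * R -> R, forall z, I z.1 -> `|z.1 - e0| < d ->
    `|gam z - g0 z.2| <= tau /\ Qn z.1 z.2 (gam z) = z.2 + m%:~R.
  suff H (z : R * R) : exists g : R, I z.1 -> `|z.1 - e0| < d ->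
    `|g - g0 z.2| <= tau /\ Qn z.1 z.2 g = z.2 + m%:~R.
    by have [gam gamP] := choice H; exists gam.
  case: z => e q /=.
  (* intermediate value theorem between the heights g0 q - tau and g0 q + tau *)
  have [[Ie ed]|N] := pselect (I e /\ `|e - e0| < d); last by exists 0 => Ie ed; case: N.
  have [_ _ _ c] := H4 q e (g0 q) Ie (lt_le_trans ed d4) ltac:(by rewrite subrr normr0).
  have ab : g0 q - tau <= g0 q + tau by lra.
  have inT p : `|p - g0 q| <= tau -> `|p - g0 q| < t by move/le_lt_trans; apply.
  have a1 : `|g0 q - tau - g0 q| < t by rewrite addrAC subrr add0r normrN gtr0_norm.
  have a2 : `|g0 q + tau - g0 q| < t by rewrite addrAC subrr add0r gtr0_norm.
  have a3 : `|g0 q - g0 q| < t by rewrite subrr normr0.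
  have u1 := Gr e q q _ _ q Ie ed (qq q) (qq q) a1 a3 ltac:(lra).
  have u2 := Gr e q q _ _ q Ie ed (qq q) (qq q) a3 a2 ltac:(lra).
  have c' := ltW c; move: u1 u2 c'; rewrite subrr normr0 mulr0 ler_norml => u1 u2 /andP[c1 c2].
  have e1 : t * (g0 q - (g0 q - tau)) = t * tau by ring.
  have e2 : t * (g0 q + tau - g0 q) = t * tau by ring.
  rewrite e1 in u1; rewrite e2 in u2.
  have [||p pI pE] := @IVT R (fun p => Qn e q p) _ _ (q + m%:~R) ab.
  - apply: continuous_in_subspaceT => p; rewrite inE /= in_itv /= -ler_distl => /inT pt.
    have Ap := AA e q p Ie ed pt.
    have [[l [sl _]] _] := regular_iter fam n Ap.
    have := strict_diff2_fiber_cont (planar_open fam Ie) (proj2 Ap) (planar_strict_diff Ie sl).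
    suff -> : (fun p1 => (iter n Phi (e, (q, p1))).2.1) = Qn e q by [].
    by apply/funext => p1; rewrite family_iter.
  - by rewrite ge_min le_max; apply/andP; split; apply/orP; [left|right]; lra.
  by exists p => _ _; split=> //; move: pI; rewrite in_itv /= ler_distl.
exists t, K, d, tau, (fun e q => gam (e, q)); split.
- by split=> //; lra.
- exact: AA.
- exact: Gr.
- move=> e q p Ie ed pt.
  have [_ c1 c2 _] := H3 q e p Ie (lt_le_trans ed d3) (le_lt_trans pt taut3).
  move: c1 c2; rewrite (graph_map pg0) /=.
  set Q0 := (F e0 (q, g0 q)).1; set Q := (F e (q, p)).1; set P := (F e (q, p)).2.
  have tE : t / (2 * (1 + L)) * (1 + L) = t / 2 by field; lra.
  set eta := t / (2 * (1 + L)) in tE *; move=> c1 c2.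
  have g1 := gL Q Q0; rewrite (distrC Q0) in g1.
  have g2 : L * `|Q - Q0| <= L * eta by rewrite ler_wpM2l// ltW.
  rewrite -(subrKA (g0 Q0)) (le_lt_trans (ler_normD _ _))//; lra.
- by move=> e q; exact: (gamP (e, q)).
Qed.

End RadialGraph.

(** * Continuation in the parameter *)

(** The points of J near which Z contains all of J form a relatively open set. It is closed in J,
since its limit points in J are limit points of Z. *)
Lemma interval_relative_clopen {R : realType} (J Z : set R) (e0 : R) : is_interval J ->
  (forall e, J e -> limit_point Z e -> exists2 r : R, 0 < r &
     forall e', J e' -> `|e' - e| < r -> Z e') ->
  J e0 -> limit_point Z e0 -> J `<=` Z.
Proof.
move=> /connected_intervalP cJ H Je0 le0.
pose C := [set e : R | exists2 r : R, 0 < r & forall e', J e' -> `|e' - e| < r -> Z e'].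
have CZ e : J e -> C e -> Z e by move=> Je [r r0]; apply; rewrite // subrr normr0.
suff E : J `&` C = J by move=> e Je; apply: CZ => //; rewrite -E in Je; case: Je.
apply: cJ.
- by exists e0; split=> //; exact: H.
- exists C => //; rewrite openE => e [r r0 Hr] /=.
  exists (r / 2) => /=; first by rewrite divr_gt0.
  move=> x; rewrite /ball /= => ex; exists (r / 2); first by rewrite divr_gt0.
  move=> e' Je' e'x; apply: Hr => //; rewrite -(subrKA x) (le_lt_trans (ler_normD _ _))//.
  by rewrite (splitr r) ltrD// distrC.
exists (closure (J `&` C)); first exact: closed_closure.
apply/seteqP; split=> e [Je]; first by move=> Ce; split=> //; exact: subset_closure.
move=> cle; split=> //; have [//|nCe] := pselect (C e).
apply: H => // U /cle[x [[Jx Cx] Ux]]; exists x; split=> //; last exact: CZ.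
by apply/eqP => xe; rewrite xe in Cx.
Qed.

Section Continuation.
Context {R : realType}.
Local Notation pt := (R * (R * R))%type.
Variables (I : set R) (m : int) (n : nat) (pm pp : R -> R -> \bar R) (F : R -> R * R -> R * R).
Hypothesis fam : twist_family I m n pm pp F.
Hypothesis I_interval : is_interval I.
Let A : set pt := annuli_family I pm pp.
Local Notation Phi := (family_map F).
Local Notation pig e g := (periodic_invariant_graph (pm e) (pp e) (F e) m n g).
Local Notation Spar := (periodic_parameters I pm pp F m n).
Let Qn e q p := (iter n (F e) (q, p)).1.

(** For fixed q the relation P_n = p on the radial graph holds on the set Z q, which contains the
parameters of S near e0; by the identity principle Z q contains a neighborhood of each of its limit
points, hence an interval around e0 which does not depend on q. *)
Lemma continuation e0 : I e0 -> Spar e0 -> limit_point Spar e0 ->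
  exists2 r : R, 0 < r & forall e, I e -> `|e - e0| < r -> Spar e.
Proof.
move=> Ie0 [_ [g0 pg0]] lim.
have [L L0 gL] := lipschitz_const (proj2 (let: And4 h _ _ _ := pg0 in h)).
have [t [K [d [tau [gam [[t0 d0 tau0 taut K0] AA Gr FF gamP]]]]]] := radial_graph fam Ie0 pg0.
have {}gamP e q : I e -> `|e - e0| < d ->
  `|gam e q - g0 q| <= tau /\ Qn e q (gam e q) = q + m%:~R := gamP e q.
have qq (q : R) : `|q - q| < t by rewrite subrr normr0.
have gt e q : I e -> `|e - e0| < d -> `|gam e q - g0 q| < t.
  by move=> Ie ed; apply: le_lt_trans taut; case: (gamP e q Ie ed).
have gamA e q : I e -> `|e - e0| < d -> A (e, (q, gam e q)).
  by move=> Ie ed; apply: AA => //; exact: gt.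
have Gn e q1 q2 p1 p2 q : I e -> `|e - e0| < d -> `|q1 - q| < t -> `|q2 - q| < t ->
    `|p1 - g0 q| < t -> `|p2 - g0 q| < t ->
    t * `|p2 - p1| <= `|Qn e q2 p2 - Qn e q1 p1| + K * `|q2 - q1|.
  move=> Ie ed h1 h2 h3 h4; have [p12|/ltW p12] := leP p1 p2.
    have := Gr e q1 q2 p1 p2 q Ie ed h1 h2 h3 h4 p12.
    rewrite (@ger0_norm _ (p2 - p1)) ?subr_ge0// => h.
    have := ler_norm (Qn e q2 p2 - Qn e q1 p1); lra.
  have := Gr e q2 q1 p2 p1 q Ie ed h2 h1 h4 h3 p12.
  rewrite (distrC p2) (@ger0_norm _ (p1 - p2)) ?subr_ge0// (distrC q1) => h.
  have := ler_norm (Qn e q1 p1 - Qn e q2 p2); rewrite (distrC (Qn e q1 p1)); lra.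
have uniq e q p1 p2 : I e -> `|e - e0| < d -> `|p1 - g0 q| < t -> `|p2 - g0 q| < t ->
    Qn e q p1 = Qn e q p2 -> p1 = p2.
  move=> Ie ed h1 h2 E; have := Gn e q q p1 p2 q Ie ed (qq q) (qq q) h1 h2.
  rewrite E !subrr !normr0 mulr0 addr0 pmulr_rle0// normr_le0 subr_eq0.
  by move/eqP.
pose J := [set e : R | I e /\ `|e - e0| < d].
have J_interval : is_interval J.
  move=> x y [Ix xd] [Iy yd] z /andP[xz zy]; split.
    by apply: (I_interval Ix Iy); rewrite xz zy.
  by move: xd yd; rewrite !ltr_distl => /andP[? ?] /andP[? ?]; apply/andP; split; lra.
pose Z q := [set e : R | J e /\ (iter n (F e) (q, gam e q)).2 = gam e q].
have SZ q e : Spar e -> `|e - e0| < d -> Z q e.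
  move=> [Ie [g pg]] ed; split=> //.
  have [s1 s2] := family_sign fam Ie pg (gamA e q Ie ed).
  have [_ gE] := gamP e q Ie ed; rewrite /Qn in gE; rewrite gE in s1 s2.
  have [h|h|<-] := ltgtP (g q) (gam e q); [by have := s1 h; rewrite ltxx|by have := s2 h; rewrite ltxx|].
  by case: pg => _ _ _ ->.
(* the identity principle is applied to G = Q_n - q - m and H = P_n - p, with q fixed *)
have ZJ q : J `<=` Z q.
  apply: (interval_relative_clopen J_interval (e0 := e0)); first last.
  - move=> U [u /= u0 Hu].
    have du0 : 0 < Num.min u d by rewrite lt_min u0.
    have [e [ne Se be]] := lim _ (nbhsx_ballx e0 _ du0).
    have : `|e - e0| < Num.min u d by rewrite distrC.
    rewrite lt_min => /andP[eu ed]; exists e; split=> //; first exact: SZ.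
    by apply: Hu; rewrite /= distrC.
  - by split=> //; rewrite subrr normr0.
  move=> e1 [Ie1 ed1] lim1; pose p1 := gam e1 q.
  have A1 : A (e1, (q, p1)) by exact: gamA.
  have [[l1 r1] [l2 r2]] := regular_iter fam n A1.
  have dd : 0 < d - `|e1 - e0| by rewrite subr_gt0.
  have near_e e : `|e - e1| < d - `|e1 - e0| -> `|e - e0| < d.
    by move=> ee; rewrite -(subrKA e1) (le_lt_trans (ler_normD _ _))//; lra.
  have rG := regular_affine (0, (-1, 0)) (- m%:~R) r1.
  have rH := regular_affine (0, (0, -1)) 0 r2.
  have [||||||r r0 Hr] := implicit_zero_identity _ rG rH _ _ _ _ _ (gam := fun e => gam e q).
  - by rewrite family_iter /lin /=; have [_] := gamP e1 q Ie1 ed1; rewrite /Qn -/p1 => ->; ring.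
  - rewrite /= addr0; apply: (strict_diff_growth fam A1 t0 (proj1 r1)).
    have tp : 0 < t - `|p1 - g0 q| by rewrite subr_gt0; exact: gt.
    exists (t - `|p1 - g0 q|) => // h h0 hr Ah.
    have ph : `|p1 + h - g0 q| < t.
      by rewrite addrAC (le_lt_trans (ler_normD _ _))// (gtr0_norm h0); lra.
    have pph : p1 <= p1 + h by lra.
    have := Gr e1 q q p1 (p1 + h) q Ie1 ed1 (qq q) (qq q) (gt _ _ Ie1 ed1) ph pph.
    by rewrite subrr normr0 mulr0 subr0 (addrAC p1) subrr add0r !family_iter.
  - have [s s0 Hs] := family_open fam A1; exists (s / 2) => [|e p Ie es ps]; first by rewrite divr_gt0.
    by apply: Hs => //; rewrite /norm1 /= subrr normr0; lra.
  - exists (d - `|e1 - e0|) => // e Ie /near_e ed.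
    by rewrite family_iter /lin /=; have [_] := gamP e q Ie ed; rewrite /Qn => ->; ring.
  - move=> eta eta0; have te : 0 < t * eta by rewrite mulr_gt0.
    have [s s0 Hs] := iter_near fam n A1 te.
    exists (Num.min (d - `|e1 - e0|) s) => [|e Ie]; first by rewrite lt_min dd.
    rewrite lt_min => /andP[/near_e ed es].
    have Ae : A (e, (q, p1)) by apply: AA => //; exact: gt.
    have := Hs _ Ae; rewrite !family_iter /norm1 /=. rewrite !subrr normr0 !addr0 => /(_ es) hs.
    have [_ g1] := gamP e1 q Ie1 ed1; have [_ g2] := gamP e q Ie ed.
    have {}g1 : (iter n (F e1) (q, p1)).1 = q + m%:~R := g1.
    rewrite g1 in hs.
    have := Gn e q q p1 (gam e q) q Ie ed (qq q) (qq q) (gt _ _ Ie1 ed1) (gt _ _ Ie ed).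
    rewrite g2 subrr normr0 mulr0 addr0 (distrC _ (Qn e q p1)) => h.
    rewrite -(ltr_pM2l t0) (le_lt_trans h)// /Qn.
    have := normr_ge0 (e - e1).
    have := normr_ge0 ((iter n (F e) (q, p1)).2 - (iter n (F e1) (q, p1)).2); lra.
  - move=> eta eta0.
    have eta1 : 0 < Num.min eta (d - `|e1 - e0|) by rewrite lt_min eta0.
    have [e [ne [Je Ze] be]] := lim1 _ (nbhsx_ballx e1 _ eta1).
    have : `|e - e1| < Num.min eta (d - `|e1 - e0|) by rewrite distrC.
    rewrite lt_min => /andP[ee _]; exists e; split=> //; first by case: Je.
    by rewrite family_iter /lin /= Ze; ring.
  exists r => // e Je er; split=> //.
  by have := Hr e (proj1 Je) er; rewrite family_iter /lin /=; lra.
exists d => // e Ie ed; split=> //; exists (gam e).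
have K10 : 0 <= (K + 1) / t by rewrite divr_ge0 ?ltW//; lra.
have close q P : `|P - g0 q| < t -> Qn e q P = q + m%:~R -> P = gam e q.
  move=> Pt PE; apply: (uniq e q) => //; first exact: gt.
  by have [_ ->] := gamP e q Ie ed.
have gE q : iter n (F e) (q, gam e q) = (q + m%:~R, gam e q).
  have [_ g1] := gamP e q Ie ed; have [_ g2] := ZJ q e (conj Ie ed).
  by rewrite [LHS]surjective_pairing g2 -g1.
split=> //.
- split=> [q|].
    have per : g0 (q + 1) = g0 q by case: pg0 => -[+ _] _ _ _; exact.
    have Aq1 : A (e, (q, gam e (q + 1))).
      have E := family_shift fam 1 q (gam e (q + 1)) Ie.
      by rewrite mulr1z in E; rewrite /A -E; exact: gamA.
    apply: close; first by have := gt e (q + 1) Ie ed; rewrite per.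
    have [_ h] := gamP e (q + 1) Ie ed.
    have := iter_shift (family_twist fam Ie) n 1 (proj2 Aq1); rewrite mulr1z => E.
    rewrite /Qn E /= in h; apply: (addIr 1); rewrite h; ring.
  apply: const_lipschitz; apply: (slope_lipschitz K10) => q.
  have L1 : 0 < 1 + L by lra.
  have mm : 0 < Num.min t (t - tau) by rewrite lt_min t0 subr_gt0.
  exists (Num.min t (t - tau) / (1 + L)); first by rewrite divr_gt0.
  move=> q'; rewrite ltr_pdivlMr// lt_min => /andP[h1 h2].
  have [g1 g2] := gamP e q Ie ed; have [g3 g4] := gamP e q' Ie ed.
  have Lq : 0 <= L * `|q' - q| by rewrite mulr_ge0.
  have a1 : `|q' - q| < t by lra.
  have a2 : `|gam e q' - g0 q| < t.
    rewrite -(subrKA (g0 q')) (le_lt_trans (ler_normD _ _))//.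
    have := gL q q'; have := normr_ge0 (q' - q); lra.
  have := Gn e q q' _ _ q Ie ed (qq q) a1 (gt _ _ Ie ed) a2.
  have -> : Qn e q' (gam e q') - Qn e q (gam e q) = q' - q by rewrite g2 g4; ring.
  by move=> h; rewrite (mulrAC (K + 1)) ler_pdivlMr// mulrC (le_trans h)// mulrDl mul1r addrC.
- by move=> _ [q _ <-]; exact: (proj2 (gamA e q Ie ed)).
move=> _ [_ [q _ <-] <-]; have [g1 g2] := gamP e q Ie ed.
exists (F e (q, gam e q)).1 => //; rewrite [RHS]surjective_pairing; congr pair.
(* the image point is in the tube and it solves the same equation since F commutes with its iterates *)
apply/esym/close; first exact: FF.
rewrite /Qn -surjective_pairing -iterSr iterS gE.
by rewrite (twist_lift (family_twist fam Ie) m (proj2 (gamA e q Ie ed))).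
Qed.

End Continuation.

(** * The dichotomy *)

Theorem theorem8 (R : realType) (I : set R) (m : int) (n : nat)
    (pm pp : R -> R -> \bar R) (F : R -> R * R -> R * R)
    (I_interval : is_interval I)
    (n_gt0 : (0 < n)%N) (mn_coprime : coprimez m n%:Z)
    (pm_cont : {within I `*` [set: R], continuous (fun x : R * R => pm x.1 x.2)})
    (pp_cont : {within I `*` [set: R], continuous (fun x : R * R => pp x.1 x.2)})
    (pm_periodic : forall e, I e -> forall q, pm e (q + 1) = pm e q)
    (pp_periodic : forall e, I e -> forall q, pp e (q + 1) = pp e q)
    (pm_lt_pp : forall e, I e -> forall q, (pm e q < pp e q)%E)
    (F_twist : forall e, I e -> exact_symplectic_twist_map (pm e) (pp e) (F e))
    (F_analytic1 :
      analytic_on (annuli_family I pm pp) (fun x => (F x.1 x.2).1))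
    (F_analytic2 :
      analytic_on (annuli_family I pm pp) (fun x => (F x.1 x.2).2))
    (F_twist_interval : forall e, I e ->
      twist_interval (pm e) (pp e) (F e) (m%:~R / n%:R)) :
  (discrete_in I (periodic_parameters I pm pp F m n) \/
   periodic_parameters I pm pp F m n = I) /\
  (compact I ->
   periodic_parameters I pm pp F m n = I \/
   finite_set (periodic_parameters I pm pp F m n)).
Proof.
have fam : twist_family I m n pm pp F by split.
set Spar := periodic_parameters I pm pp F m n.
have SI : Spar `<=` I by move=> e [].
have all_or e : I e -> limit_point Spar e -> Spar = I.
  move=> Ie le; apply/seteqP; split=> //.
  apply: (interval_relative_clopen I_interval _ Ie le) => e1 Ie1 le1.
  exact: (continuation fam I_interval Ie1 (limit_parameter fam Ie1 le1) le1).
have dich : discrete_in I Spar \/ Spar = I.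
  have [[e [Ie le]]|N] := pselect (exists e, (I `&` limit_point Spar) e).
    by right; exact: all_or Ie le.
  left; split=> //; apply/seteqP; split=> // e Se; case: N; by exists e.
split=> // cI; case: dich => [[_ D]|]; last by left.
right; apply: contrapT => infS.
have bS : bounded_set Spar.
  have [M [Mr MI]] := compact_bounded cI; exists M; split=> // x Mx e Se.
  exact: MI Mx e (SI e Se).
have [e le] := infinite_bounded_limit_point_nonempty infS bS.
have : (I `&` limit_point Spar) e; last by rewrite D.
split=> //; have cl := compact_closed (@Rhausdorff R) cI.
exact: (cl e (closureS SI (subset_limit_point le))).
Qed.
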